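(* For every $\mathbf f\in[L^2(\Omega)]^2$, there is a unique $(\mathbf u_h,p_h)\in V_h\times M_h$ such that $$(\nabla_w\mathbf u_h,\nabla_w\mathbf v)_h-(p_h,\operatorname{div}_w\mathbf v)_h=(\mathbf f,\mathbf v^0)\quad\forall\,\mathbf v\in V_h,$$ $$(\operatorname{div}_w\mathbf u_h,q_h)_h=0\quad\forall\,q_h\in M_h.$$
   Context: Let $\Omega\subset\mathbb R^2$ be a convex polygonal domain. Let $T_h$ be a shape-regular triangulation into triangles $K$. Fix an integer $k\ge0$. Local space: $W_{k,k+1}(K)=\{\{v^0,v^b\}: v^0\in P_k(K),\ v^b\in P_{k+1}(\partial K)\}$, where $P_{k+1}(\partial K)$ means polynomials of degree at most $k+1$ on each edge. The weak gradient $\nabla_wv\in[P_{k+1}(K)]^2$ is defined by $\int_K\nabla_wv\cdot\mathbf q=-\int_Kv^0\operatorname{div}\mathbf q+\int_{\partial K}v^b\mathbf q\cdot\mathbf n$ for all $\mathbf q\in[P_{k+1}(K)]^2$, taken row-wise for vectors. The weak divergence $\operatorname{div}_w\mathbf v\in P_{k+1}(K)$ is defined by $\int_K\operatorname{div}_w\mathbf v\,q=-\int_K\mathbf v^0\cdot\nabla q+\int_{\partial K}\mathbf v^b\cdot\mathbf n\,q$ for all $q\in P_{k+1}(K)$. Both are applied elementwise. $S_h^0$ is the set of weak functions with $v|_K\in W_{k,k+1}(K)$ for every $K$, $v^b$ single-valued on interior edges, and $v^b=0$ on $\partial\Omega$. $V_h=[S_h^0]^2$ and $M_h=\{q\in L^2_0(\Omega):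 q|_K\in P_k(K)\}$. $(u,v)_h=\sum_K\int_Kuv$ (for matrices, summed over entries), $\|u\|_h^2=(u,u)_h$, and $(\cdot,\cdot)$ is the $L^2(\Omega)$ inner product. *)

(* Defs.v *)
From HB Require Import structures.
From mathcomp Require Import all_boot all_order all_algebra.
From mathcomp Require Import all_classical all_reals all_analysis.
Set Implicit Arguments. Unset Strict Implicit. Unset Printing Implicit Defensive.
Import Order.TTheory GRing.Theory Num.Theory.
Import numFieldNormedType.Exports.
Local Open Scope classical_set_scope.
Local Open Scope ring_scope.

Section WG.
Variable R : realType.
Local Notation pt2 := (R * R)%type.

Definition leb2 := ((@lebesgue_measure R) \x (@lebesgue_measure R))%E.
Definition I2 (D : set pt2) (g : pt2 -> R) : R := Rintegral leb2 D g.
Definition I01 (g : R -> R) : R := Rintegral (@lebesgue_measure R) `[0%R, 1%R] g.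

Definition poly2 (k : nat) (c : nat -> nat -> R) (x : pt2) : R :=
  \sum_(a < k.+1) \sum_(b < k.+1 | (a + b <= k)%N) c a b * x.1 ^+ a * x.2 ^+ b.
Definition poly2_dx (k : nat) (c : nat -> nat -> R) (x : pt2) : R :=
  \sum_(a < k.+1) \sum_(b < k.+1 | (a + b <= k)%N)
     c a b * a%:R * x.1 ^+ a.-1 * x.2 ^+ b.
Definition poly2_dy (k : nat) (c : nat -> nat -> R) (x : pt2) : R :=
  \sum_(a < k.+1) \sum_(b < k.+1 | (a + b <= k)%N)
     c a b * b%:R * x.1 ^+ a * x.2 ^+ b.-1.
Definition poly1 (k : nat) (c : nat -> R) (t : R) : R :=
  \sum_(l < k.+1) c l * t ^+ l.

Definition lerp (a b : pt2) (t : R) : pt2 :=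
  (a.1 + t * (b.1 - a.1), a.2 + t * (b.2 - a.2)).
Definition segment (a b : pt2) : set pt2 := [set lerp a b t | t in `[0%R, 1%R]].
Definition convex_set2 (O : set pt2) : Prop :=
  forall x y, O x -> O y -> forall t, 0 <= t <= 1 -> O (lerp x y t).

Definition nxt (j : 'I_3) : 'I_3 := inord (j.+1 %% 3).
Definition tri n (V : 'I_n -> 'I_3 -> pt2) (i : 'I_n) : set pt2 :=
  [set x | exists l : 'I_3 -> R, (forall j, 0 <= l j) /\ \sum_j l j = 1 /\
           x = (\sum_j l j * (V i j).1, \sum_j l j * (V i j).2)].
Definition eA n (V : 'I_n -> 'I_3 -> pt2) i j := V i j.
Definition eB n (V : 'I_n -> 'I_3 -> pt2) i j := V i (nxt j).
Definition edge n (V : 'I_n -> 'I_3 -> pt2) i j : set pt2 :=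
  segment (eA V i j) (eB V i j).
(* outward normal times edge length (triangles are counterclockwise) *)
Definition nrm n (V : 'I_n -> 'I_3 -> pt2) i j : pt2 :=
  ((eB V i j).2 - (eA V i j).2, (eA V i j).1 - (eB V i j).1).

Definition ccw n (V : 'I_n -> 'I_3 -> pt2) i : Prop :=
  0 < ((V i 1).1 - (V i 0).1) * ((V i 2).2 - (V i 0).2)
      - ((V i 2).1 - (V i 0).1) * ((V i 1).2 - (V i 0).2).

Definition triangulation n (V : 'I_n -> 'I_3 -> pt2) : Prop :=
  (forall i, ccw V i) /\
  (forall i i', i != i' ->
     tri V i `&` tri V i' = set0 \/
     (exists j j', V i j = V i' j' /\ tri V i `&` tri V i' = [set V i j]) \/
     (exists j j', edge V i j = edge V i' j' /\
                   tri V i `&` tri V i' = edge V i j)).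

Definition bnd (O : set pt2) : set pt2 := closure O `\` O.

(* a scalar weak function: interior parts v0 i (on triangle i) and
   boundary parts vb i j (on local edge j of triangle i) *)
Definition wfun n := (('I_n -> pt2 -> R) * ('I_n -> 'I_3 -> pt2 -> R))%type.

Definition in_Sh0 (k n : nat) (V : 'I_n -> 'I_3 -> pt2) (O : set pt2)
    (v : wfun n) : Prop :=
  (forall i, exists c, forall x, tri V i x -> v.1 i x = poly2 k c x) /\
  (forall i j, exists c, forall t, 0 <= t <= 1 ->
      v.2 i j (lerp (eA V i j) (eB V i j) t) = poly1 k.+1 c t) /\
  (forall i j i' j', edge V i j = edge V i' j' ->
      forall x, edge V i j x -> v.2 i j x = v.2 i' j' x) /\
  (forall i j, edge V i j `<=` bnd O -> forall x, edge V i j x -> v.2 i j x = 0).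

Definition wfun_eq n (V : 'I_n -> 'I_3 -> pt2) (v w : wfun n) : Prop :=
  (forall i x, tri V i x -> v.1 i x = w.1 i x) /\
  (forall i j x, edge V i j x -> v.2 i j x = w.2 i j x).

(* boundary integral over edge j of triangle i of g, against n ds *)
Definition eint n (V : 'I_n -> 'I_3 -> pt2) i j (g : pt2 -> R) : R :=
  I01 (fun t => g (lerp (eA V i j) (eB V i j) t)).

Definition wgrad_spec (k n : nat) (V : 'I_n -> 'I_3 -> pt2) (v : wfun n) i
    (g : (nat -> nat -> R) * (nat -> nat -> R)) : Prop :=
  forall d : (nat -> nat -> R) * (nat -> nat -> R),
    I2 (tri V i) (fun x => poly2 k.+1 g.1 x * poly2 k.+1 d.1 x
                         + poly2 k.+1 g.2 x * poly2 k.+1 d.2 x)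
    = - I2 (tri V i) (fun x => v.1 i x *
                         (poly2_dx k.+1 d.1 x + poly2_dy k.+1 d.2 x))
      + \sum_(j < 3) eint V i j (fun x => v.2 i j x *
           (poly2 k.+1 d.1 x * (nrm V i j).1 + poly2 k.+1 d.2 x * (nrm V i j).2)).

Definition wgrad k n V (v : wfun n) i (x : pt2) : pt2 :=
  let g := get [set g | wgrad_spec k V v i g] in
  (poly2 k.+1 g.1 x, poly2 k.+1 g.2 x).

Definition wdiv_spec (k n : nat) (V : 'I_n -> 'I_3 -> pt2) (v : wfun n * wfun n)
    i (g : nat -> nat -> R) : Prop :=
  forall d : nat -> nat -> R,
    I2 (tri V i) (fun x => poly2 k.+1 g x * poly2 k.+1 d x)
    = - I2 (tri V i) (fun x => v.1.1 i x * poly2_dx k.+1 d x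
                             + v.2.1 i x * poly2_dy k.+1 d x)
      + \sum_(j < 3) eint V i j (fun x =>
          (v.1.2 i j x * (nrm V i j).1 + v.2.2 i j x * (nrm V i j).2)
          * poly2 k.+1 d x).

Definition wdiv k n V (v : wfun n * wfun n) i (x : pt2) : R :=
  poly2 k.+1 (get [set g | wdiv_spec k V v i g]) x.

Definition in_Vh k n V O (v : wfun n * wfun n) : Prop :=
  in_Sh0 k V O v.1 /\ in_Sh0 k V O v.2.

Definition in_Mh (k n : nat) (V : 'I_n -> 'I_3 -> pt2) (p : 'I_n -> pt2 -> R)
    : Prop :=
  (forall i, exists c, forall x, tri V i x -> p i x = poly2 k c x) /\
  \sum_(i < n) I2 (tri V i) (p i) = 0.

Definition Mh_eq n (V : 'I_n -> 'I_3 -> pt2) (p q : 'I_n -> pt2 -> R) : Prop :=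
  forall i x, tri V i x -> p i x = q i x.

Definition a_h k n V (u v : wfun n * wfun n) : R :=
  \sum_(i < n) I2 (tri V i) (fun x =>
      (wgrad k V u.1 i x).1 * (wgrad k V v.1 i x).1
    + (wgrad k V u.1 i x).2 * (wgrad k V v.1 i x).2
    + (wgrad k V u.2 i x).1 * (wgrad k V v.2 i x).1
    + (wgrad k V u.2 i x).2 * (wgrad k V v.2 i x).2).

Definition b_h k n V (p : 'I_n -> pt2 -> R) (v : wfun n * wfun n) : R :=
  \sum_(i < n) I2 (tri V i) (fun x => p i x * wdiv k V v i x).

Definition f_h n V (f : pt2 -> pt2) (v : wfun n * wfun n) : R :=
  \sum_(i < n) I2 (tri V i) (fun x => (f x).1 * v.1.1 i x + (f x).2 * v.2.1 i x).

Definition L2vec (O : set pt2) (f : pt2 -> pt2) : Prop :=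
  measurable_fun O (fun x => (f x).1) /\ measurable_fun O (fun x => (f x).2) /\
  (\int[leb2]_(x in O) (((f x).1) ^+ 2)%:E < +oo)%E /\
  (\int[leb2]_(x in O) (((f x).2) ^+ 2)%:E < +oo)%E.

Definition WG_Stokes k n V (f : pt2 -> pt2) (u : wfun n * wfun n)
    (p : 'I_n -> pt2 -> R) O : Prop :=
  in_Vh k V O u /\ in_Mh k V p /\
  (forall v, in_Vh k V O v -> a_h k V u v - b_h k V p v = f_h V f v) /\
  (forall q, in_Mh k V q -> \sum_(i < n) I2 (tri V i) (fun x => wdiv k V u i x * q i x) = 0).

End WG.

(* Main.v *)
(** On one triangle a weak gradient that vanishes forces the interior part v0 and the
    edge parts vb to be the same constant.  Testing with
    q = h h' (tau . grad v0) tau, where tau is tangent to one edge and h, h' are the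
    affine functions vanishing on the other two, kills all boundary terms and gives
    tau . grad v0 = 0; once v0 is constant, a field of degree k + 1 whose normal
    component is the jump vb - v0 on one edge and zero on the others shows that the
    jump vanishes.  Globally the constants agree across shared edges and vanish on the
    boundary; following a segment that avoids all vertices until it leaves the domain,
    they are all zero.

    For the pressure, testing with v0 = grad p makes p constant on each triangle, and
    a test function equal to the normal on one interior edge makes the constants on
    both sides equal.  A segment avoiding the vertices stays in the convex domain and
    crosses only edges, so p is a global constant, which is zero by the mean value
    condition.  Uniqueness gives existence since the discrete problem is a square
    linear system. *)

Require Import Defs.
From HB Require Import structures.
From mathcomp Require Import all_boot all_order all_algebra.
From mathcomp Require Import all_classical all_reals all_analysis.
From mathcomp Require Import measurable_realfun.
From mathcomp Require Import ring lra.
Import Order.TTheory GRing.Theory Num.Theory.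
Import numFieldNormedType.Exports.
Local Open Scope classical_set_scope.
Local Open Scope ring_scope.

Set Implicit Arguments. Unset Strict Implicit. Unset Printing Implicit Defensive.

(** * Bivariate polynomials *)

(** The degree [k + 1] of the weak gradient is exactly what the kernel argument consumes: two affine
    factors times a derivative of [v0] give [2 + (k - 1)], and a normal jump of degree [k + 1] needs
    a field of that degree. Both tests rest on the divergence theorem for polynomials on a triangle,
    obtained from Fubini on horizontal slices; since edges are parametrised by [0,1] and normals
    carry the edge length, no square root occurs. [wgrad] and [wdiv] are picked by [get]; linearity
    is proved not for the choice but for the right-hand sides [Ldx] and [Ldy], the weak gradient
    being itself a test polynomial. The load needs care: [f] is square integrable on the open
    domain, while [f_h] integrates over closed triangles, so edges are removed as null sets.
    Segments avoid vertices because triangles meeting only at a vertex exchange no information.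
    Coordinates of weak functions are redundant, so uniqueness holds only up to equality on
    triangles and edges, and the square-system argument becomes a Fredholm alternative: the load has
    to vanish on the kernel of the form. *)

Section BivariatePolynomials.
Variable R : realType.
Local Notation pt := (R * R)%type.
Implicit Types (g gx gy h hx hy : pt -> R).

(* A polynomial is carried together with its partial derivatives, so that products
   never require differentiating a table of coefficients. *)
Inductive pd (m : nat) : (pt -> R) -> (pt -> R) -> (pt -> R) -> Prop :=
| pd0 : pd m (fun=> 0) (fun=> 0) (fun=> 0)
| pdD g gx gy h hx hy : pd m g gx gy -> pd m h hx hy ->
    pd m (fun x => g x + h x) (fun x => gx x + hx x) (fun x => gy x + hy x)
| pd_mono a b r : (a + b <= m)%N ->
    pd m (fun x => r * x.1 ^+ a * x.2 ^+ b)
         (fun x => r * a%:R * x.1 ^+ a.-1 * x.2 ^+ b)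
         (fun x => r * b%:R * x.1 ^+ a * x.2 ^+ b.-1).

Lemma pd_eq m g gx gy h hx hy : pd m g gx gy ->
  g =1 h -> gx =1 hx -> gy =1 hy -> pd m h hx hy.
Proof. by move=> p /funext <- /funext <- /funext <-. Qed.

Lemma pd_sum (I : Type) m (s : seq I) (P : pred I) (g gx gy : I -> pt -> R) :
  (forall i, P i -> pd m (g i) (gx i) (gy i)) ->
  pd m (fun x => \sum_(i <- s | P i) g i x) (fun x => \sum_(i <- s | P i) gx i x)
       (fun x => \sum_(i <- s | P i) gy i x).
Proof.
move=> H; elim: s => [|i s IH].
  by apply: (pd_eq (pd0 m)) => x; rewrite big_nil.
case: (boolP (P i)) => Pi.
  by apply: (pd_eq (pdD (H i Pi) IH)) => x; rewrite big_cons Pi.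
by apply: (pd_eq IH) => x; rewrite big_cons (negbTE Pi).
Qed.

Lemma pd_poly2 m c : pd m (poly2 m c) (poly2_dx m c) (poly2_dy m c).
Proof. by do 2! apply: pd_sum => ? ?; exact: pd_mono. Qed.

Lemma sum2_delta m a b (F : nat -> nat -> R) : (a + b <= m)%N ->
  (forall a' b', (a', b') != (a, b) -> F a' b' = 0) ->
  \sum_(i < m.+1) \sum_(j < m.+1 | (i + j <= m)%N) F i j = F a b.
Proof.
move=> ab F0.
have am : (a < m.+1)%N by rewrite ltnS (leq_trans _ ab)// leq_addr.
have bm : (b < m.+1)%N by rewrite ltnS (leq_trans _ ab)// leq_addl.
rewrite (bigD1 (Ordinal am))//= (bigD1 (Ordinal bm))//= big1 ?addr0; last first.
  by move=> j /andP[_ jb]; apply: F0; rewrite xpair_eqE eqxx.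
rewrite big1 ?addr0// => i ia; rewrite big1// => j _; apply: F0.
rewrite xpair_eqE negb_and; apply/orP; left.
by apply: contra ia => /eqP ia; apply/eqP/val_inj.
Qed.

(** The weak operators are tested against coefficient tables; this turns a test field built by sums
    and products back into such a table. *)
Lemma pdP m g gx gy : pd m g gx gy ->
  exists c, [/\ g = poly2 m c, gx = poly2_dx m c & gy = poly2_dy m c].
Proof.
elim=> [|{}g {}gx {}gy h hx hy _ [c [-> -> ->]] _ [d [-> -> ->]]|a b r ab].
- exists (fun _ _ => 0); split; apply/funext => x;
    rewrite /poly2 /poly2_dx /poly2_dy big1// => i _;
    by rewrite big1// => j _; rewrite !mul0r.
- exists (fun a b => c a b + d a b); split; apply/funext => x;
    rewrite /poly2 /poly2_dx /poly2_dy -big_split; apply: eq_bigr => i _; rewrite -big_split;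
    by apply: eq_bigr => j _; rewrite !mulrDl.
- have D a' b' : (a', b') != (a, b) -> (a' == a) && (b' == b) = false.
    by rewrite xpair_eqE => /negbTE.
  exists (fun a' b' => if (a' == a) && (b' == b) then r else 0).
  have S (F : nat -> nat -> R) : (forall a' b', (a' == a) && (b' == b) = false -> F a' b' = 0) ->
      F a b = \sum_(i < m.+1) \sum_(j < m.+1 | (i + j <= m)%N) F i j.
    by move=> F0; symmetry; apply: (sum2_delta (F := F) ab) => a' b' /D; exact: F0.
  split; apply/funext => x; [
    rewrite -[RHS](S (fun i j => (if (i == a) && (j == b) then r else 0) *
      x.1 ^+ i * x.2 ^+ j)) |
    rewrite -[RHS](S (fun i j => (if (i == a) && (j == b) then r else 0) * i%:R *
      x.1 ^+ i.-1 * x.2 ^+ j)) |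
    rewrite -[RHS](S (fun i j => (if (i == a) && (j == b) then r else 0) * j%:R *
      x.1 ^+ i * x.2 ^+ j.-1))];
    by [rewrite !eqxx | move=> a' b' ->; rewrite !mul0r].
Qed.

Lemma pdZ m r g gx gy : pd m g gx gy ->
  pd m (fun x => r * g x) (fun x => r * gx x) (fun x => r * gy x).
Proof.
elim=> [|{}g {}gx {}gy h hx hy _ IH1 _ IH2|a b s ab].
- by apply: (pd_eq (pd0 m)) => x; rewrite mulr0.
- by apply: (pd_eq (pdD IH1 IH2)) => x; rewrite mulrDr.
- by apply: (pd_eq (pd_mono (r * s) ab)) => x; ring.
Qed.

Lemma pd_leq m m' g gx gy : (m <= m')%N -> pd m g gx gy -> pd m' g gx gy.
Proof.
move=> mm; elim=> [|{}g {}gx {}gy h hx hy _ IH1 _ IH2|a b s ab].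
- exact: pd0.
- exact: pdD.
- exact/pd_mono/(leq_trans ab).
Qed.

(** The product rule for powers, with truncated predecessors: the zero exponents are split off
    because [a.-1] is then 0, and the factor [a%:R] makes up for it. *)
Lemma deriv_exp_mul (x : R) a a' :
  a%:R * x ^+ a.-1 * x ^+ a' + x ^+ a * (a'%:R * x ^+ a'.-1)
  = (a + a')%:R * x ^+ (a + a').-1.
Proof.
case: a => [|a]; first by rewrite expr0 !mul0r add0r mul1r.
case: a' => [|a']; first by rewrite expr0 !mul0r mulr0 addn0 mulr1 addr0.
rewrite natrD -!natr1 addnS !addSn/= !exprS exprD; ring.
Qed.

Lemma pdM m m' g gx gy h hx hy : pd m g gx gy -> pd m' h hx hy ->
  pd (m + m') (fun x => g x * h x) (fun x => gx x * h x + g x * hx x)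
              (fun x => gy x * h x + g x * hy x).
Proof.
move=> pg; elim: pg h hx hy => {g gx gy}
    [|g gx gy h hx hy _ IH1 _ IH2|a b s ab] k kx ky pk.
- by apply: (pd_eq (pd0 _)) => x; rewrite !mul0r ?addr0.
- by apply: (pd_eq (pdD (IH1 _ _ _ pk) (IH2 _ _ _ pk))) => x /=; ring.
- elim: pk => {k kx ky} [|g gx gy h hx hy _ IH1 _ IH2|a' b' s' ab'].
  + by apply: (pd_eq (pd0 _)) => x; rewrite !mulr0 ?addr0.
  + by apply: (pd_eq (pdD IH1 IH2)) => x /=; ring.
  + have abab : (a + a' + (b + b') <= m + m')%N by rewrite addnACA leq_add.
    apply: (pd_eq (pd_mono (s * s') abab)) => x /=.
    * rewrite !exprD; ring.
    * transitivity (s * s' * ((a + a')%:R * x.1 ^+ (a + a').-1) * x.2 ^+ (b + b')).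
        by ring.
      rewrite -deriv_exp_mul exprD; ring.
    * transitivity (s * s' * ((b + b')%:R * x.2 ^+ (b + b').-1) * x.1 ^+ (a + a')).
        by ring.
      rewrite -deriv_exp_mul exprD; ring.
Qed.

Lemma pd_affine (r s t : R) :
  pd 1 (fun x => r + s * x.1 + t * x.2) (fun=> s) (fun=> t).
Proof.
apply: (pd_eq (pdD (pdD (@pd_mono 1 0 0 r isT) (@pd_mono 1 1 0 s isT))
  (@pd_mono 1 0 1 t isT))) => x /=; rewrite ?expr0 ?expr1; ring.
Qed.

Lemma pd_cst m r : pd m (fun=> r) (fun=> 0) (fun=> 0).
Proof. by apply: (pd_eq (@pd_mono m 0 0 r isT)) => x; rewrite /= ?expr0; ring. Qed.

Lemma pdX m n g gx gy : pd m g gx gy -> exists hx hy,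
  pd (n * m) (fun x => g x ^+ n) hx hy.
Proof.
move=> pg; elim: n => [|n [hx [hy IH]]].
  by do 2! exists (fun=> 0); apply: (pd_eq (pd_cst 0 1)).
eexists; eexists; rewrite mulSn; apply: (pd_eq (pdM pg IH)) => x;
  rewrite ?exprS//; reflexivity.
Qed.

Lemma pd_deriv m g gx gy : pd m g gx gy ->
  (exists hx hy, pd m.-1 gx hx hy) /\ (exists hx hy, pd m.-1 gy hx hy).
Proof.
elim=> {g gx gy} [|g gx gy h hx hy _
  [[? [? IHg]] [? [? IHg']]] _ [[? [? IHh]] [? [? IHh']]]|a b s ab].
- by split; do 2!exists (fun=> 0); exact: pd0.
- by split; do 2!eexists; apply: pdD; eassumption.
- split.
    case: a ab => [|a] ab.
      by do 2!exists (fun=> 0); apply: (pd_eq (pd0 _)) => x //=; rewrite ?mulr0 ?mul0r.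
    do 2!eexists; apply: (pd_mono (s * a.+1%:R)).
    by rewrite -ltnS (leq_trans ab)// leqSpred.
  case: b ab => [|b] ab.
    by do 2!exists (fun=> 0); apply: (pd_eq (pd0 _)) => x //=; rewrite ?mulr0 ?mul0r.
  do 2!eexists; apply: (pd_mono (s * b.+1%:R)).
  by rewrite -ltnS -addnS (leq_trans ab)// leqSpred.
Qed.

(** In degree 0 the bound [m.-1] of [pd_deriv] does not drop. The test field of
    [tangential_derivative0] would then have degree [k + 2], so the case [k = 0] is settled by this
    lemma. *)
Lemma pd_deg0 g gx gy : pd 0 g gx gy -> gx =1 (fun=> 0) /\ gy =1 (fun=> 0).
Proof.
elim=> {g gx gy} [|g gx gy h hx hy _ [a b] _ [c d]|a b s].
- by [].
- by split=> x; rewrite ?a ?b ?c ?d addr0.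
- by rewrite leqn0 addn_eq0 => /andP[/eqP-> /eqP->]; split=> x; rewrite ?mulr0 ?mul0r.
Qed.

(** Chain rule along a line. Edge integrals, slices and vanishing arguments are reduced to
    univariate polynomials through it. *)
Lemma pd_line m g gx gy (A B : pt) : pd m g gx gy -> exists p : {poly R},
  forall t, p.[t] = g (lerp A B t) /\
    p^`().[t] = gx (lerp A B t) * (B.1 - A.1) + gy (lerp A B t) * (B.2 - A.2).
Proof.
elim=> {g gx gy} [|g gx gy h hx hy _ [p Hp] _ [q Hq]|a b s ab].
- by exists 0 => t; rewrite deriv0 !horner0 !mul0r addr0.
- exists (p + q) => t; have [p1 p2] := Hp t; have [q1 q2] := Hq t.
  rewrite derivD !hornerD p1 p2 q1 q2; split=> //; ring.
- pose u : {poly R} := A.1%:P + (B.1 - A.1) *: 'X.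
  pose v : {poly R} := A.2%:P + (B.2 - A.2) *: 'X.
  have uE t : u.[t] = A.1 + t * (B.1 - A.1) by rewrite !hornerE mulrC.
  have vE t : v.[t] = A.2 + t * (B.2 - A.2) by rewrite !hornerE mulrC.
  have du : u^`() = (B.1 - A.1)%:P.
    by rewrite derivD derivC derivZ derivX add0r alg_polyC.
  have dv : v^`() = (B.2 - A.2)%:P.
    by rewrite derivD derivC derivZ derivX add0r alg_polyC.
  exists (s *: (u ^+ a * v ^+ b)) => t.
  rewrite derivZ derivM !deriv_exp du dv !hornerZ hornerD !hornerM !hornerMn.
  rewrite !hornerM !hornerC !horner_exp uE vE /lerp/= -[_ *+ a]mulr_natr -[_ *+ b]mulr_natr.
  set U := _ + t * _; set W := _ + t * _; split; first by rewrite mulrA.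
  set da := B.1 - _; set db := B.2 - _.
  move: (U ^+ a) (U ^+ a.-1) (W ^+ b) (W ^+ b.-1) => {}U U' {}W W'.
  ring.
Qed.

End BivariatePolynomials.

(** * Roots and integrals of univariate polynomials *)

Section UnivariatePolynomials.
Variable R : realType.
Implicit Types p q : {poly R}.

(** A nonzero [p] has fewer than [size p] roots, so one of the [size p] distinct points [e / i.+2]
    is not a root; the offset 2 keeps them strictly below [e]. *)
Lemma poly_nonroot p (e : R) : p != 0 -> 0 < e -> exists2 t, 0 < t < e & p.[t] != 0.
Proof.
move=> p0 e0; apply: contrapT => H.
pose f (i : nat) : R := e / i.+2%:R.
have f_inj : injective f.
  move=> i j /(mulfI (lt0r_neq0 e0)) /invr_inj /eqP.
  by rewrite eqr_nat => /eqP[].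
have := @max_poly_roots _ p [seq f i | i <- iota 0 (size p)] p0.
rewrite map_inj_uniq// iota_uniq size_map size_iota ltnn => F.
apply: notF; apply: F => //; apply/allP => _ /mapP[i _ ->]; apply/contraT => /= nr.
exfalso; apply: H; exists (f i) => //; apply/andP; split.
  by rewrite divr_gt0// ltr0n.
by rewrite ltr_pdivrMr ?ltr0n// ltr_pMr// ltr1n.
Qed.

Lemma poly_eq0_itv p : (forall t, 0 < t < 1 -> p.[t] = 0) -> p = 0.
Proof.
move=> H; apply/eqP; apply: contraT => p0.
by have [t /H ->] := poly_nonroot p0 ltr01; rewrite eqxx.
Qed.

Lemma poly_primitive p : exists P : {poly R}, P^`() = p.
Proof.
exists (\poly_(i < (size p).+1) (p`_i.-1 / i%:R)); apply/polyP => i.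
rewrite coef_deriv coef_poly ltnS; case: ltnP => [ip|pi].
  by rewrite -[LHS]mulr_natr divfK// pnatr_eq0.
by rewrite mul0rn nth_default.
Qed.

Lemma integrable_poly p (a b : R) :
  (@lebesgue_measure R).-integrable `[a, b] (EFin \o (fun t => p.[t])).
Proof.
apply: continuous_compact_integrable; first exact: segment_compact.
by apply: continuous_subspaceT => x; exact: continuous_horner.
Qed.

Lemma Rintegral_poly (P : {poly R}) (a b : R) : a <= b ->
  Rintegral (@lebesgue_measure R) `[a, b] (fun t => P^`().[t]) = P.[b] - P.[a].
Proof.
rewrite le_eqVlt => /predU1P[->|ab].
  by rewrite set_itv1 Rintegral_set1 subrr.
rewrite /Rintegral (@continuous_FTC2 _ _ (horner P))//.
- by apply: continuous_subspaceT => x; exact: continuous_horner.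
- split => [x _||]; first exact: derivable_horner.
  + by apply: cvg_at_right_filter; exact: continuous_horner.
  + by apply: cvg_at_left_filter; exact: continuous_horner.
- by move=> x _; rewrite derivE.
Qed.

Lemma Rintegral_poly_affine (P : {poly R}) (a b c u : R) : a <= b -> u != 0 ->
  Rintegral (@lebesgue_measure R) `[a, b] (fun t => P^`().[(t - c) / u]) =
  u * (P.[(b - c) / u] - P.[(a - c) / u]).
Proof.
move=> ab u0; pose q : {poly R} := u^-1 *: ('X - c%:P).
have qE t : q.[t] = (t - c) / u by rewrite !hornerE mulrC.
transitivity (Rintegral (@lebesgue_measure R) `[a, b]
    (fun t => (u *: (P \Po q))^`().[t])).
  apply: eq_Rintegral => t _; rewrite derivZ deriv_comp derivZ derivXsubC hornerZ.
  by rewrite hornerM hornerZ horner_comp qE hornerC mulr1 mulrCA mulfV// mulr1.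
by rewrite Rintegral_poly// !hornerZ !horner_comp !qE mulrBr.
Qed.

Lemma I01_poly (P : {poly R}) : I01 (fun t => P^`().[t]) = P.[1] - P.[0].
Proof. exact: Rintegral_poly. Qed.

(** Slicing runs each edge from its lower to its upper end, whereas the boundary runs
    counterclockwise; reversal reconciles the two. *)
Lemma I01_poly_rev p : I01 (fun t => p.[1 - t]) = I01 (fun t => p.[t]).
Proof.
have [P <-] := poly_primitive p; rewrite I01_poly.
transitivity (I01 (fun t => P^`().[(t - 1) / (-1)])).
  by apply: eq_Rintegral => t _; rewrite invrN1 mulrN1 opprB.
rewrite /I01 Rintegral_poly_affine// ?oppr_eq0 ?oner_eq0//.
by rewrite subrr mul0r sub0r divff ?oppr_eq0 ?oner_eq0// mulN1r opprB.
Qed.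

(* The primitive of p^2 is monotone with equal end values, hence constant. *)
Lemma I01_sq_eq0 p : I01 (fun t => p.[t] ^+ 2) = 0 -> p = 0.
Proof.
have [P HP] := poly_primitive (p ^+ 2).
have E a b : a <= b -> 0 <= P.[b] - P.[a].
  move=> ab; rewrite -Rintegral_poly// HP; apply: Rintegral_ge0 => t _.
  by rewrite horner_exp sqr_ge0.
have -> : (fun t => p.[t] ^+ 2) = (fun t => P^`().[t]).
  by apply/funext => t; rewrite HP horner_exp.
rewrite I01_poly => P01.
have : P - (P.[0])%:P = 0.
  apply: poly_eq0_itv => t /andP[t0 t1]; rewrite hornerD hornerN hornerC.
  by have := E _ _ (ltW t0); have := E _ _ (ltW t1); lra.
move/(congr1 (@deriv R)); rewrite derivB derivC subr0 HP deriv0 => /eqP.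
by rewrite expf_eq0 => /eqP.
Qed.

End UnivariatePolynomials.

(** * Integrals over triangles *)

Section TriangleIntegrals.
Variable R : realType.
Local Notation pt := (R * R)%type.
Local Notation mu := (@lebesgue_measure R).
Implicit Types (A B C x y : pt) (g h : pt -> R).

(* Packaged as a measure once and for all: R carries two convertible measurable
   structures with different displays, which defeats inference on the product. *)
Definition mu2 := [the {measure set _ -> \bar R} of (mu \x mu)%E].

(** Twice the signed area of the triangle [a b c]. As a function of [c] it is affine, vanishes on
    the line [a b] and is positive to its left; [ccw] unfolds to its positivity. *)
Definition cr (a b c : pt) : R :=
  (b.1 - a.1) * (c.2 - a.2) - (c.1 - a.1) * (b.2 - a.2).

(** Half-plane form of a closed counterclockwise triangle, identified with [tri] in [triE];
    measurability and slices are read off the three inequalities. *)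
Definition T3 A B C : set pt :=
  [set x | [/\ 0 <= cr A B x, 0 <= cr B C x & 0 <= cr C A x]].

Lemma cr_cycle A B C : cr B C A = cr A B C.
Proof. by rewrite /cr; ring. Qed.

Lemma T3_cycle A B C : T3 B C A = T3 A B C.
Proof. by apply/seteqP; split => x []. Qed.

Lemma cr_sum A B C x : cr A B x + cr B C x + cr C A x = cr A B C.
Proof. by rewrite /cr; ring. Qed.

Lemma cr_bary A B C x :
  cr A B C * x.1 = cr B C x * A.1 + cr C A x * B.1 + cr A B x * C.1 /\
  cr A B C * x.2 = cr B C x * A.2 + cr C A x * B.2 + cr A B x * C.2.
Proof. by rewrite /cr; split; ring. Qed.

Lemma pd_cr A B : pd 1 (cr A B) (fun=> A.2 - B.2) (fun=> B.1 - A.1).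
Proof.
apply: (pd_eq (pd_affine (A.1 * B.2 - A.2 * B.1) (A.2 - B.2) (B.1 - A.1))) => x //.
by rewrite /cr; ring.
Qed.

Lemma measurable_pd m g gx gy : pd m g gx gy -> measurable_fun setT g.
Proof.
elim=> [|{}g {}gx {}gy h hx hy _ mg _ mh|a b s _].
- exact: measurable_cst.
- exact: measurable_funD.
- apply: measurable_funM; last exact: measurable_funX measurable_snd.
  by apply: measurable_funM => //; exact: measurable_funX measurable_fst.
Qed.

Lemma continuous_pd m g gx gy : pd m g gx gy -> continuous g.
Proof.
elim=> [|{}g {}gx {}gy h hx hy _ cg _ ch|a b s _] x.
- exact: cvg_cst.
- by apply: cvgD; [exact: cg|exact: ch].
- have cX n (h : pt -> R) : h y @[y --> x] --> h x ->
      h y ^+ n @[y --> x] --> h x ^+ n.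
    move=> ch; elim: n => [|n IH]; first exact: cvg_cst.
    rewrite exprS [X in X @ _ --> _](_ : _ = (fun y => h y * h y ^+ n)).
      exact: cvgM.
    by apply/funext => y; rewrite exprS.
  apply: cvgM; last by apply: cX; exact: cvg_snd.
  by apply: cvgM; [exact: cvg_cst|apply: cX; exact: cvg_fst].
Qed.

Lemma measurable_halfplane A B : measurable [set x | 0 <= cr A B x].
Proof.
rewrite (_ : [set _ | _] = cr A B @^-1` `[0, +oo[); last first.
  by apply/seteqP; split => x /=; rewrite in_itv/= andbT.
by rewrite -[X in measurable X]setTI; exact: (measurable_pd (pd_cr A B)).
Qed.

Lemma measurable_T3 A B C : measurable (T3 A B C).
Proof.
rewrite (_ : T3 _ _ _ = [set x | 0 <= cr A B x] `&` [set x | 0 <= cr B C x]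
    `&` [set x | 0 <= cr C A x]); last first.
  by apply/seteqP; split => x /= [] => [|[]] *; do ?split.
by do 2?apply: measurableI; exact: measurable_halfplane.
Qed.

(** By [cr_bary], [cr A B C] times a coordinate of [x] is a combination of vertex coordinates with
    nonnegative weights of sum [cr A B C]. *)
Lemma T3_bounded A B C : 0 < cr A B C ->
  exists M : R, forall x, T3 A B C x -> `|x.1| <= M /\ `|x.2| <= M.
Proof.
move=> D0; have key (a b c : R) x : T3 A B C x ->
    `|cr B C x * a + cr C A x * b + cr A B x * c| <= cr A B C * (`|a| + `|b| + `|c|).
  move=> [h1 h2 h3]; rewrite -(cr_sum A B C x).
  have n3 (u v w : R) : `|u + v + w| <= `|u| + `|v| + `|w|.
    by rewrite (le_trans (ler_normD _ _))// lerD2r ler_normD.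
  apply: le_trans (n3 _ _ _) _; rewrite !normrM (ger0_norm h1) (ger0_norm h2) (ger0_norm h3).
  have := mulr_ge0 h1 (normr_ge0 a); have := mulr_ge0 h1 (normr_ge0 b).
  have := mulr_ge0 h2 (normr_ge0 b); have := mulr_ge0 h2 (normr_ge0 c).
  have := mulr_ge0 h3 (normr_ge0 a); have := mulr_ge0 h3 (normr_ge0 c).
  nra.
exists (`|A.1| + `|B.1| + `|C.1| + (`|A.2| + `|B.2| + `|C.2|)) => x Tx.
have [e1 e2] := cr_bary A B C x.
have := key A.1 B.1 C.1 x Tx; have := key A.2 B.2 C.2 x Tx.
rewrite -e1 -e2 !normrM (gtr0_norm D0) !ler_pM2l// => l2 l1.
by split; [apply: le_trans l1 _; rewrite lerDl|apply: le_trans l2 _; rewrite lerDr];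
  rewrite !addr_ge0.
Qed.

Lemma fin_T3 A B C : 0 < cr A B C -> (mu2 (T3 A B C) < +oo)%E.
Proof.
move=> /T3_bounded[M HM].
have sub : T3 A B C `<=` `[- M, M]%classic `*` `[- M, M]%classic.
  by move=> x /HM[]; rewrite /= !in_itv/= -!ler_norml => -> ->.
have mX : measurable (`[- M, M]%classic `*` `[- M, M]%classic).
  by apply: measurableX; exact: measurable_itv.
have := le_measure mu2 (mem_set (measurable_T3 A B C)) (mem_set mX) sub.
move/le_lt_trans; apply; rewrite [ltLHS]product_measure1E; [|exact: measurable_itv..].
have L : (mu `[(- M)%R, M]%classic < +oo)%E.
  by rewrite lebesgue_measure_itv/=; case: ifP => _; rewrite -?EFinB ?ltry.
apply: lte_mul_pinfty => //.
by rewrite ge0_fin_numE.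
Qed.

(** Unlike integrability, this property is stable under products, and on a set of finite measure it
    implies integrability. *)
Definition bm (D : set pt) g :=
  measurable_fun D g /\ exists M : R, forall x, D x -> `|g x| <= M.

Lemma bm_cst D r : bm D (fun=> r).
Proof. by split; [exact: measurable_cst|exists `|r|]. Qed.

Lemma bmD D g h : bm D g -> bm D h -> bm D (fun x => g x + h x).
Proof.
move=> [mg [M HM]] [mh [N HN]]; split; first exact: measurable_funD.
by exists (M + N) => x Dx; rewrite (le_trans (ler_normD _ _))// lerD ?HM ?HN.
Qed.

Lemma bmM D g h : bm D g -> bm D h -> bm D (fun x => g x * h x).
Proof.
move=> [mg [M HM]] [mh [N HN]]; split; first exact: measurable_funM.
by exists (M * N) => x Dx; rewrite normrM ler_pM ?HM ?HN.
Qed.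

Lemma bm_eq D g h : (forall x, D x -> g x = h x) -> bm D g -> bm D h.
Proof.
move=> gh [mg [M HM]]; split; last by exists M => x Dx; rewrite -gh// HM.
by apply: eq_measurable_fun mg => x; rewrite inE => /gh ->.
Qed.

Lemma bm_pd A B C m g gx gy : 0 < cr A B C -> pd m g gx gy -> bm (T3 A B C) g.
Proof.
move=> D0; have [M HM] := T3_bounded D0.
have b1 : bm (T3 A B C) fst.
  split; last by exists M => x /HM[].
  exact: measurable_funTS measurable_fst.
have b2 : bm (T3 A B C) snd.
  split; last by exists M => x /HM[].
  exact: measurable_funTS measurable_snd.
have bX n h : bm (T3 A B C) h -> bm (T3 A B C) (fun x => h x ^+ n).
  move=> bh; elim: n => [|n IH]; first exact: bm_cst.
  by apply: bm_eq (bmM bh IH) => x _; rewrite exprS.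
elim=> [|{}g {}gx {}gy h hx hy _ bg _ bh|a b s _].
- exact: bm_cst.
- exact: bmD.
- by apply: bmM; [apply: bmM; [exact: bm_cst|exact: bX]|exact: bX].
Qed.

Lemma integrable_bm D g : measurable D -> (mu2 D < +oo)%E -> bm D g ->
  mu2.-integrable D (EFin \o g).
Proof.
move=> mD fD [mg [M HM]]; apply: measurable_bounded_integrable => //.
exists M; split; first exact: num_real.
by move=> x Mx y Dy; apply: le_trans (HM y Dy) _; exact: ltW.
Qed.

Lemma I2E D g : I2 D g = Rintegral mu2 D g. Proof. by []. Qed.

Lemma eq_I2 D g h : (forall x, D x -> g x = h x) -> I2 D g = I2 D h.
Proof. by move=> gh; apply: eq_Rintegral => x; rewrite inE => /gh. Qed.

Section Linearity.
Variables (A B C : pt) (D0 : 0 < cr A B C).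
Local Notation T := (T3 A B C).

Lemma I2D g h : bm T g -> bm T h -> I2 T (fun x => g x + h x) = I2 T g + I2 T h.
Proof.
by move=> bg bh; apply: RintegralD; [exact: measurable_T3|
  by apply: integrable_bm => //; [exact: measurable_T3|exact: fin_T3]..].
Qed.

Lemma I2Z r g : bm T g -> I2 T (fun x => r * g x) = r * I2 T g.
Proof.
by move=> bg; apply: RintegralZl; [exact: measurable_T3|
  by apply: integrable_bm => //; [exact: measurable_T3|exact: fin_T3]..].
Qed.

End Linearity.

Lemma I2_ge0 (D : set pt) g : (forall x, D x -> 0 <= g x) -> 0 <= I2 D g.
Proof. by move=> g0; rewrite I2E; apply: Rintegral_ge0. Qed.


Lemma I2_cst0 (D : set pt) : I2 D (fun=> 0) = 0.
Proof. by rewrite /I2 /Rintegral integral0. Qed.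

Lemma cr_gt0_near A B x : 0 < cr A B x -> \forall y \near x, 0 < cr A B y.
Proof.
by move=> cr0; refine (@cvgr_gt _ pt (nbhs x) _ (cr A B) _ _ _ cr0);
  exact: continuous_pd (pd_cr A B) x.
Qed.

Lemma open_interior_T3 A B C x :
  0 < cr A B x -> 0 < cr B C x -> 0 < cr C A x -> nbhs x (T3 A B C).
Proof.
move=> /cr_gt0_near h1 /cr_gt0_near h2 /cr_gt0_near h3; near=> y; split; apply/ltW.
- near: y; exact: h1.
- near: y; exact: h2.
- near: y; exact: h3.
Unshelve. all: by end_near. Qed.

Lemma measurable_ball1 (a e : R) : measurable (ball a e).
Proof. by rewrite ball_itv; exact: measurable_itv. Qed.

Lemma box_measure_gt0 x (e : R) : 0 < e ->
  (0 < mu2 (ball x.1 e `*` ball x.2 e))%E.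
Proof.
move=> e0; have L a : (0 < mu (ball a e))%E.
  by rewrite lebesgue_measure_ball ?ltW// lte_fin mulrn_wgt0.
have mB := measurable_ball1; have := product_measure1E mu mu (mB x.1 e) (mB x.2 e).
by move=> E; rewrite [ltRHS]E; apply: mule_gt0; exact: L.
Qed.

(* A continuous nonnegative function with zero integral vanishes: otherwise it is
   positive on a box, which has positive measure. *)
Lemma I2_eq0_interior A B C m g gx gy : 0 < cr A B C -> pd m g gx gy ->
  (forall x, T3 A B C x -> 0 <= g x) -> I2 (T3 A B C) g = 0 ->
  forall x, 0 < cr A B x -> 0 < cr B C x -> 0 < cr C A x -> g x = 0.
Proof.
move=> D0 pg g0 Ig x h1 h2 h3; apply: contrapT => /eqP gx0.
have ig : mu2.-integrable (T3 A B C) (EFin \o g).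
  by apply: integrable_bm; [exact: measurable_T3|exact: fin_T3|exact: bm_pd pg].
have mg : measurable_fun (T3 A B C) (EFin \o g) by case/integrableP: ig.
have Ig0 : (\int[mu2]_(y in T3 A B C) `|(EFin \o g) y| = 0)%E.
  transitivity (\int[mu2]_(y in T3 A B C) (EFin \o g) y)%E.
    by apply: eq_integral => y; rewrite inE => /g0 gy0 /=; rewrite ger0_norm.
  have fi : (\int[mu2]_(y in T3 A B C) (EFin \o g) y)%E \is a fin_num.
    by apply: integrable_fin_num ig; exact: measurable_T3.
  rewrite -(fineK fi); congr EFin; exact: Ig.
have : ae_eq mu2 (T3 A B C) (EFin \o g) (cst 0%E).
  by apply/ae_eq_integral_abs => //; exact: measurable_T3.
move=> [N [mN N0 sN]].
have : nbhs x [set y | T3 A B C y /\ g y != 0].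
  apply: filterI; first exact: open_interior_T3.
  have [k kg] : exists k, k < `|g x| /\ 0 < k.
    by exists (`|g x| / 2); rewrite divr_gt0 ?normr_gt0//; split=> //;
      rewrite ltr_pdivrMr// ltr_pMr ?normr_gt0// ltr1n.
  have : g y @[y --> x] --> g x by exact: continuous_pd pg _.
  by move=> /cvgr_neq0; apply.
move=> /nbhs_ballP[e /= e0 be].
have sub : ball x.1 e `*` ball x.2 e `<=` N.
  move=> y [y1 y2]; apply: sN => /= H.
  have [Ty gy0] := be y (conj y1 y2).
  by move: (H Ty) => [] /eqP; apply/negP.
have := box_measure_gt0 x e0.
rewrite ltNge => /negP; apply; rewrite -N0.
have mB : measurable (ball x.1 e `*` ball x.2 e).
  by apply: measurableX; exact: measurable_ball1.
by apply: (le_measure mu2 _ _ sub); rewrite inE.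
Qed.

(** Join a point of the closed triangle to the centroid [G]: past the starting point the segment is
    interior, so the restricted polynomial vanishes on (0,1), hence also at 0. *)
Lemma pd_eq0_T3 A B C m g gx gy : 0 < cr A B C -> pd m g gx gy ->
  (forall x, 0 < cr A B x -> 0 < cr B C x -> 0 < cr C A x -> g x = 0) ->
  forall x, T3 A B C x -> g x = 0.
Proof.
move=> D0 pg g0 x [h1 h2 h3].
pose G : pt := ((A.1 + B.1 + C.1) / 3%:R, (A.2 + B.2 + C.2) / 3%:R).
have [p Hp] := pd_line x G pg.
have -> : g x = p.[0] by rewrite (Hp 0).1 /lerp !mul0r !addr0 -surjective_pairing.
rewrite (poly_eq0_itv (p := p)) ?horner0// => t /andP[t0 t1].
have crl a b : cr a b (lerp x G t) = (1 - t) * cr a b x + t * cr a b G.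
  by rewrite /cr /lerp/=; ring.
have HG : [/\ cr A B G = cr A B C / 3%:R, cr B C G = cr A B C / 3%:R &
              cr C A G = cr A B C / 3%:R].
  by rewrite /cr /G/=; split; field.
have D3 : 0 < t * (cr A B C / 3%:R) by rewrite mulr_gt0// divr_gt0.
have t1' : 0 <= 1 - t by lra.
by rewrite (Hp t).1; case: HG => a b c; apply: g0; rewrite crl ?a ?b ?c;
  rewrite ltr_wpDl// mulr_ge0.
Qed.

Lemma I2_eq0 A B C m g gx gy : 0 < cr A B C -> pd m g gx gy ->
  (forall x, T3 A B C x -> 0 <= g x) -> I2 (T3 A B C) g = 0 ->
  forall x, T3 A B C x -> g x = 0.
Proof. by move=> D0 pg g0 Ig; apply: (pd_eq0_T3 D0 pg); exact: I2_eq0_interior pg g0 Ig. Qed.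

(* Differentiate g = 0 along the segments from x to the three vertices. *)
Lemma pd_eq0_deriv A B C m g gx gy : 0 < cr A B C -> pd m g gx gy ->
  (forall x, T3 A B C x -> g x = 0) ->
  forall x, T3 A B C x -> gx x = 0 /\ gy x = 0.
Proof.
move=> D0 pg g0 x Tx.
have dir P : T3 A B C P -> gx x * (P.1 - x.1) + gy x * (P.2 - x.2) = 0.
  move=> TP; have [p Hp] := pd_line x P pg.
  have p0 : p = 0.
    apply: poly_eq0_itv => t /andP[t0 t1]; rewrite (Hp t).1; apply: g0.
    case: Tx TP => [a1 a2 a3] [b1 b2 b3].
    have crl a b : cr a b (lerp x P t) = (1 - t) * cr a b x + t * cr a b P.
      by rewrite /cr /lerp/=; ring.
    have t1' : 0 <= 1 - t by lra.
    by split; rewrite crl addr_ge0// mulr_ge0// ltW.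
  have := (Hp 0).2; rewrite p0 deriv0 horner0 /lerp !mul0r !addr0.
  by rewrite -surjective_pairing.
have cr_aab a b : cr a b a = 0 by rewrite /cr; ring.
have cr_abb a b : cr a b b = 0 by rewrite /cr; ring.
have TA : T3 A B C A by split; rewrite ?cr_aab ?cr_abb// cr_cycle ltW.
have TB : T3 A B C B by split; rewrite ?cr_aab ?cr_abb// 2!cr_cycle ltW.
have TC : T3 A B C C by split; rewrite ?cr_aab ?cr_abb// ltW.
have := dir _ TA; have := dir _ TB; have := dir _ TC.
move: D0; rewrite /cr => D0 eC eB eA.
have U : gx x * (B.1 - A.1) + gy x * (B.2 - A.2) = 0 by lra.
have W : gx x * (C.1 - A.1) + gy x * (C.2 - A.2) = 0 by lra.
move/lt0r_neq0 : D0 => D0.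
(* Cramer's rule: two edge directions have determinant [cr A B C], so a gradient orthogonal to both
   is zero. *)
split; apply: (mulfI D0); rewrite mulr0.
- transitivity ((C.2 - A.2) * (gx x * (B.1 - A.1) + gy x * (B.2 - A.2)) -
    (B.2 - A.2) * (gx x * (C.1 - A.1) + gy x * (C.2 - A.2))); first by ring.
  by rewrite U W; ring.
- transitivity ((B.1 - A.1) * (gx x * (C.1 - A.1) + gy x * (C.2 - A.2)) -
    (C.1 - A.1) * (gx x * (B.1 - A.1) + gy x * (B.2 - A.2))); first by ring.
  by rewrite U W; ring.
Qed.

End TriangleIntegrals.

(** * The divergence theorem on a triangle *)

Section DivergenceTheorem.
Variable R : realType.
Local Notation pt := (R * R)%type.
Local Notation mu := (@lebesgue_measure R).
Local Notation mu2 := (mu2 R).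
Implicit Types (A B C : pt) (g h : pt -> R).

Lemma Rintegral_poly_affineB (P Q : {poly R}) (r a b c u d v : R) :
  a <= b -> u != 0 -> v != 0 ->
  Rintegral mu `[a, b]
    (fun t => r * (P^`().[(t - c) / u] - Q^`().[(t - d) / v])) =
  r * (u * (P.[(b - c) / u] - P.[(a - c) / u]) -
       v * (Q.[(b - d) / v] - Q.[(a - d) / v])).
Proof.
move=> ab u0 v0.
have [q [qE dq]] : exists q : R -> R -> {poly R},
    (forall e w t, (q e w).[t] = (t - e) / w) /\
    (forall e w, (q e w)^`() = (w^-1)%:P).
  exists (fun e w => w^-1 *: ('X - e%:P)); split => [e w t|e w].
    by rewrite !hornerE mulrC.
  by rewrite derivZ derivXsubC alg_polyC.
transitivity (Rintegral mu `[a, b]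
    (fun t => (r *: (u *: (P \Po q c u) - v *: (Q \Po q d v)))^`().[t])).
  apply: eq_Rintegral => t _; rewrite derivZ derivB !derivZ !deriv_comp !dq.
  rewrite hornerZ hornerD hornerN !hornerZ !hornerM !horner_comp !qE !hornerC.
  by rewrite !(mulrC _ (_^-1)) !mulVKf.
rewrite Rintegral_poly// !(hornerZ, hornerD, hornerN, horner_comp) !qE; ring.
Qed.

(** Here [a], [b], [c] stand for the heights of the sorted vertices, [p1], [p2], [p3] for the traces
    on the edges low-middle, middle-high and low-high, and [phi] for the slice integral. If [a = b],
    the quotient by [b - a] is meaningless but the lower range is a null set; if [b = c], the
    half-open upper range is empty. *)
Lemma Rintegral_sorted (p1 p2 p3 : {poly R}) (a b c r : R) (phi : R -> R) :
  a <= b -> b <= c -> a < c -> mu.-integrable setT (EFin \o phi) ->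
  (forall y, y < a \/ c < y -> phi y = 0) ->
  (forall y, a < b -> a <= y <= b ->
     phi y = r * (p1.[(y - a) / (b - a)] - p3.[(y - a) / (c - a)])) ->
  (forall y, b < y <= c ->
     phi y = r * (p2.[(y - b) / (c - b)] - p3.[(y - a) / (c - a)])) ->
  Rintegral mu setT phi = r * ((b - a) * I01 (horner p1) +
    (c - b) * I01 (horner p2) - (c - a) * I01 (horner p3)).
Proof.
move=> ab bc ac iphi H0 H1 H2.
have [P1 E1] := poly_primitive p1; have [P2 E2] := poly_primitive p2.
have [P3 E3] := poly_primitive p3; subst p1 p2 p3.
have ca0 : c - a != 0 by rewrite subr_eq0 gt_eqF.
have iS (D : set R) : measurable D -> mu.-integrable D (EFin \o phi).
  by move=> mD; apply: integrableS iphi.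
have -> : Rintegral mu setT phi = Rintegral mu `[a, c] phi.
  rewrite [RHS]Rintegral_mkcond; apply: eq_Rintegral => y _; rewrite patchE.
  case: ifPn => //; rewrite notin_setE/= in_itv/= => /negP.
  by rewrite negb_and -!ltNge => /orP Hy; rewrite H0.
have I1 : Rintegral mu `[a, b] phi = r * ((b - a) * (P1.[1] - P1.[0]) -
    (c - a) * (P3.[(b - a) / (c - a)] - P3.[0])).
  have [ba|lab] := eqVneq b a.
    by rewrite ba set_itv1 Rintegral_set1 subrr !mul0r !subrr; ring.
  have lab' : a < b by rewrite lt_neqAle eq_sym lab.
  rewrite (@eq_Rintegral _ _ _ mu _ (fun y => r *
    (P1^`().[(y - a) / (b - a)] - P3^`().[(y - a) / (c - a)]))); last first.
    by move=> y; rewrite inE/= in_itv/= => Hy; rewrite H1.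
  have ba0 : b - a != 0 by rewrite subr_eq0.
  by rewrite Rintegral_poly_affineB// divff// subrr !mul0r.
have I2 : Rintegral mu `]b, c] phi = r * ((c - b) * (P2.[1] - P2.[0]) -
    (c - a) * (P3.[1] - P3.[(b - a) / (c - a)])).
  have [cb|lbc] := eqVneq c b.
    by rewrite -cb set_itvoc0 Rintegral_set0 subrr divff//; ring.
  have lbc' : b < c by rewrite lt_neqAle eq_sym lbc.
  rewrite (@eq_Rintegral _ _ _ mu _ (fun y => r *
    (P2^`().[(y - b) / (c - b)] - P3^`().[(y - a) / (c - a)]))); last first.
    by move=> y; rewrite inE/= in_itv/= => Hy; rewrite H2.
  rewrite Rintegral_itv_obnd_cbnd.
    have cb0 : c - b != 0 by rewrite subr_eq0.
    by rewrite Rintegral_poly_affineB// !divff// subrr !mul0r.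
  apply: (@eq_integrable _ _ _ mu _ _ (EFin \o phi)) => //; last exact: iS.
  by move=> y; rewrite inE/= in_itv/= => Hy; rewrite H2.
have := @Rintegral_itvB R phi (BLeft a) (BRight c) b.
rewrite !bnd_simp => /(_ (iS _ (measurable_itv _)) ab bc) /eqP.
rewrite subr_eq => /eqP ->; rewrite I1 I2 !I01_poly; ring.
Qed.

Lemma restrict_I2_integrable A B C g : 0 < cr A B C -> bm (T3 A B C) g ->
  mu2.-integrable setT (EFin \o (g \_ (T3 A B C))).
Proof.
move=> D0 bg; rewrite -restrict_EFin.
rewrite -(@integrable_mkcond _ _ _ mu2 (T3 A B C)); last exact: measurable_T3.
by apply: integrable_bm => //; [exact: measurable_T3|exact: fin_T3].
Qed.

(** Fubini with the horizontal variable integrated first. [phi] is integrable because it is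
    dominated by the slice integral of the absolute value. *)
Lemma I2_iterated A B C g (phi : R -> R) : 0 < cr A B C -> bm (T3 A B C) g ->
  (forall y, \int[mu]_x ((g \_ (T3 A B C)) (x, y))%:E = (phi y)%:E)%E ->
  mu.-integrable setT (EFin \o phi) /\
  I2 (T3 A B C) g = Rintegral mu setT phi.
Proof.
move=> D0 bg H; have ig := restrict_I2_integrable D0 bg.
have GE : fubini_G mu (EFin \o (g \_ (T3 A B C))) = EFin \o phi.
  by apply/funext => y; exact: H.
have mf := measurable_int mu2 ig.
split.
  apply/integrableP; split; first by rewrite -GE; exact: (measurable_fubini_G ig).
  have := (integrable21ltyP mu mu mf).1 ig; apply: le_lt_trans.
  apply: ge0_le_integral => //.
  - apply: measurableT_comp => //; rewrite -GE; exact: (measurable_fubini_G ig).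
  - refine (@measurable_fun_fubini_tonelli_G _ _ _ _ _ mu
      (abse \o (EFin \o (g \_ (T3 A B C)))) _ _).
      exact: measurableT_comp.
    by move=> y; exact: abse_ge0.
  - move=> y _; rewrite -[leLHS]/(`|(phi y)%:E|)%E -H; apply: le_abse_integral => //.
    exact: (measurable_fun_pair1 y mf).
rewrite I2E Rintegral_mkcond /Rintegral.
by rewrite -(integral21_prod_meas1 ig); congr fine; apply: eq_integral => y _; exact: H.
Qed.

Definition sw (x : pt) : pt := (x.2, x.1).

(** The two iterated integrals agree. Exchanging the coordinates reverses orientation, whence the
    order [A], [C], [B] of the new vertices. *)
Lemma I2_swap A B C g : 0 < cr A B C -> bm (T3 A B C) g ->
  bm (T3 (sw A) (sw C) (sw B)) (g \o sw) ->
  I2 (T3 A B C) g = I2 (T3 (sw A) (sw C) (sw B)) (g \o sw).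
Proof.
move=> D0 bg bg'.
have D0' : 0 < cr (sw A) (sw C) (sw B) by rewrite /cr/=; rewrite /cr in D0; lra.
have i1 := restrict_I2_integrable D0 bg.
have i2 := restrict_I2_integrable D0' bg'.
rewrite !I2E Rintegral_mkcond [RHS]Rintegral_mkcond /Rintegral.
rewrite -(integral21_prod_meas1 i1) -(integral12_prod_meas1 i2).
congr fine; apply: eq_integral => y _; apply: eq_integral => x _ /=.
rewrite !patchE; congr (EFin _).
have -> // : ((y, x) \in T3 (sw A) (sw C) (sw B)) = ((x, y) \in T3 A B C).
by apply/idP/idP; rewrite !inE /T3/= /cr/= => -[h1 h2 h3]; split; lra.
Qed.

(** The abscissa at height [y] of the line through [A] and [B], meaningful when the line is not
    horizontal. *)
Definition absc A B (y : R) : R := A.1 + (y - A.2) / (B.2 - A.2) * (B.1 - A.1).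

Lemma lerp_absc A B (y : R) : A.2 < B.2 ->
  lerp A B ((y - A.2) / (B.2 - A.2)) = (absc A B y, y).
Proof.
move=> AB; rewrite /lerp /absc; congr pair; rewrite divfK ?subr_eq0 ?gt_eqF//; ring.
Qed.

Lemma cr_absc A B (x y : R) : A.2 < B.2 ->
  cr A B (x, y) = (B.2 - A.2) * (absc A B y - x).
Proof.
move=> AB; have : B.2 - A.2 != 0 by rewrite subr_eq0 gt_eqF.
by rewrite /cr /absc/= => AB0; field.
Qed.

Lemma cr_absc_ge0 A B (x y : R) : A.2 < B.2 ->
  (0 <= cr A B (x, y)) = (x <= absc A B y).
Proof. by move=> AB; rewrite cr_absc// pmulr_rge0 ?subr_gt0// subr_ge0. Qed.

Lemma mulr_subr_ge0 (u v w : R) : 0 <= u -> v <= w -> 0 <= u * (w - v).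
Proof. by move=> u0 vw; rewrite mulr_ge0// subr_ge0. Qed.

(** * Horizontal slices of a triangle with vertices sorted by height *)

Section Slices.
Variables (A B C : pt).
Hypotheses (D0 : 0 < cr A B C) (AB : A.2 <= B.2) (BC : B.2 <= C.2).

Lemma sorted_lt : A.2 < C.2.
Proof.
rewrite lt_neqAle (le_trans AB BC) andbT; apply: contraL D0 => /eqP AC.
have -> : cr A B C = 0; last by rewrite ltxx.
have e : B.2 = A.2 by apply/eqP; rewrite eq_le AB AC BC.
by rewrite /cr e AC; ring.
Qed.

Lemma cr_CA_absc (x y : R) : cr C A (x, y) = (C.2 - A.2) * (x - absc A C y).
Proof.
transitivity (- cr A C (x, y)); first by rewrite /cr/=; ring.
by rewrite (cr_absc _ _ sorted_lt); ring.
Qed.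

Lemma cr_CA_ge0 (x y : R) : (0 <= cr C A (x, y)) = (absc A C y <= x).
Proof. by rewrite cr_CA_absc pmulr_rge0 ?subr_gt0 ?sorted_lt// subr_ge0. Qed.

(** Below the middle vertex the slice runs from the edge [CA] to [AB]. The inequality for [BC] then
    follows: [(B.2 - A.2) * cr B C] is a sum of [cr A B] and [cr A B C] with nonnegative
    coefficients. *)
Lemma slice_low (x y : R) : A.2 < B.2 -> A.2 <= y <= B.2 ->
  absc A C y <= absc A B y /\
  (T3 A B C (x, y) <-> absc A C y <= x <= absc A B y).
Proof.
move=> lAB /andP[y1 y2].
have pAB : 0 < B.2 - A.2 by rewrite subr_gt0.
have pAC : 0 < C.2 - A.2 by rewrite subr_gt0 sorted_lt.
split.
  rewrite -cr_absc_ge0// -(pmulr_rge0 _ pAC).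
  have -> : (C.2 - A.2) * cr A B (absc A C y, y) =
      cr A B C * (y - A.2) - (B.2 - A.2) * cr C A (absc A C y, y).
    by rewrite /cr/=; ring.
  by rewrite cr_CA_absc subrr !mulr0 subr0; exact: mulr_subr_ge0 (ltW D0) y1.
rewrite -(cr_absc_ge0 _ _ lAB) -cr_CA_ge0.
split; first by move=> [-> _ ->].
move=> /andP[h1 h2]; split => //; rewrite -(pmulr_rge0 _ pAB).
have -> : (B.2 - A.2) * cr B C (x, y) =
    cr A B (x, y) * (C.2 - B.2) + cr A B C * (B.2 - y).
  by rewrite /cr/=; ring.
by apply: addr_ge0; apply: mulr_subr_ge0 => //; exact: ltW D0.
Qed.

Lemma slice_high (x y : R) : B.2 < y <= C.2 ->
  absc A C y <= absc B C y /\
  (T3 A B C (x, y) <-> absc A C y <= x <= absc B C y).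
Proof.
move=> /andP[y1 y2]; have lBC := lt_le_trans y1 y2.
have pBC : 0 < C.2 - B.2 by rewrite subr_gt0.
have pAC : 0 < C.2 - A.2 by rewrite subr_gt0 sorted_lt.
split.
  rewrite -cr_absc_ge0// -(pmulr_rge0 _ pAC).
  have -> : (C.2 - A.2) * cr B C (absc A C y, y) =
      cr A B C * (C.2 - y) - (C.2 - B.2) * cr C A (absc A C y, y).
    by rewrite /cr/=; ring.
  by rewrite cr_CA_absc subrr !mulr0 subr0; exact: mulr_subr_ge0 (ltW D0) y2.
rewrite -(cr_absc_ge0 _ _ lBC) -cr_CA_ge0.
split; first by move=> [_ -> ->].
move=> /andP[h1 h2]; split => //; rewrite -(pmulr_rge0 _ pBC).
have -> : (C.2 - B.2) * cr A B (x, y) =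
    cr B C (x, y) * (B.2 - A.2) + cr A B C * (y - B.2).
  by rewrite /cr/=; ring.
by apply: addr_ge0; apply: mulr_subr_ge0 => //; exact: ltW.
Qed.

Lemma slice_out (x y : R) : y < A.2 \/ C.2 < y -> ~ T3 A B C (x, y).
Proof.
move=> Hy [h1 h2 h3]; have AC := ltW sorted_lt.
case: Hy => Hy.
  have : 0 <= cr A B C * (y - A.2).
    have -> : cr A B C * (y - A.2) =
        cr A B (x, y) * (C.2 - A.2) + cr C A (x, y) * (B.2 - A.2).
      by rewrite /cr/=; ring.
    by apply: addr_ge0; exact: mulr_subr_ge0.
  by rewrite pmulr_rge0// subr_ge0 leNgt Hy.
have : 0 <= cr A B C * (C.2 - y).
  have -> : cr A B C * (C.2 - y) =
      cr B C (x, y) * (C.2 - A.2) + cr C A (x, y) * (C.2 - B.2).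
    by rewrite /cr/=; ring.
  by apply: addr_ge0; exact: mulr_subr_ge0.
by rewrite pmulr_rge0// subr_ge0 leNgt Hy.
Qed.

End Slices.

Lemma slice_integral m g gx gy (S : set pt) (y l r : R) : pd m g gx gy -> l <= r ->
  (forall x, S (x, y) <-> l <= x <= r) ->
  (\int[mu]_x ((gx \_ S) (x, y))%:E = (g (r, y) - g (l, y))%:E)%E.
Proof.
move=> pg lr HS; have [P HP] := pd_line (0, y) (1, y) pg.
have lE t : lerp (0, y) (1, y) t = (t, y) :> pt.
  by rewrite /lerp/=; congr pair; ring.
have P1 t : P.[t] = g (t, y) by rewrite (HP t).1 lE.
have P2 t : P^`().[t] = gx (t, y) by rewrite (HP t).2 lE/=; ring.
rewrite -!P1 -Rintegral_poly// fineK; last first.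
  by apply: integrable_fin_num => //; exact: integrable_poly.
rewrite [RHS]integral_mkcond; apply: eq_integral => x _.
rewrite /patch P2; have -> : ((x, y) \in S) = (x \in `[l, r]%classic).
  by apply/idP/idP; rewrite !inE/= in_itv/= => /HS.
by case: ifP.
Qed.

Lemma slice_integral0 (S : set pt) g (y : R) : (forall x, ~ S (x, y)) ->
  (\int[mu]_x ((g \_ S) (x, y))%:E = 0%:E)%E.
Proof.
move=> HS; rewrite (eq_integral (cst 0%E)) ?integral0// => x _.
by rewrite patchE memNset.
Qed.

Lemma I01_lerp m g gx gy A B : pd m g gx gy -> exists p : {poly R},
  (forall t, p.[t] = g (lerp A B t)) /\ I01 (g \o lerp A B) = I01 (horner p).
Proof.
move=> pg; have [p Hp] := pd_line A B pg; exists p; split=> [t|].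
  by rewrite (Hp t).1.
by apply: eq_Rintegral => t _; exact: esym (Hp t).1.
Qed.

Lemma I01_lerp_rev m g gx gy A B : pd m g gx gy ->
  I01 (g \o lerp B A) = I01 (g \o lerp A B).
Proof.
move=> pg; have [p [Hp ->]] := I01_lerp A B pg; rewrite -I01_poly_rev.
apply: eq_Rintegral => t _ /=; rewrite Hp; congr g.
by rewrite /lerp; congr pair; ring.
Qed.

(** The triangle is [S1 S2 S3], while [A], [B], [C] are the points that bound its slices, ordered by
    height; [r] is a sign telling on which side [B] lies. At the height of a horizontal lower edge
    only finiteness of the slice integral is asked for, a single height being negligible. *)
Lemma I2_dx_core m g gx gy A B C S1 S2 S3 (r : R) :
  pd m g gx gy -> A.2 <= B.2 -> B.2 <= C.2 -> A.2 < C.2 ->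
  0 < cr S1 S2 S3 ->
  (forall y, y < A.2 \/ C.2 < y ->
    (\int[mu]_x ((gx \_ (T3 S1 S2 S3)) (x, y))%:E = 0%:E)%E) ->
  (forall y, A.2 < B.2 -> A.2 <= y <= B.2 ->
    (\int[mu]_x ((gx \_ (T3 S1 S2 S3)) (x, y))%:E =
      (r * (g (absc A B y, y) - g (absc A C y, y)))%:E)%E) ->
  (forall y, B.2 < y <= C.2 ->
    (\int[mu]_x ((gx \_ (T3 S1 S2 S3)) (x, y))%:E =
      (r * (g (absc B C y, y) - g (absc A C y, y)))%:E)%E) ->
  (A.2 = B.2 -> exists v,
    (\int[mu]_x ((gx \_ (T3 S1 S2 S3)) (x, A.2))%:E = v%:E)%E) ->
  I2 (T3 S1 S2 S3) gx = r * ((B.2 - A.2) * I01 (g \o lerp A B) +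
    (C.2 - B.2) * I01 (g \o lerp B C) - (C.2 - A.2) * I01 (g \o lerp A C)).
Proof.
move=> pg AB BC AC D0 H0 H1 H2 H3.
have [[gxx [gxy pgx]] _] := pd_deriv pg.
have bgx := bm_pd D0 pgx.
pose phi y := fine (\int[mu]_x ((gx \_ (T3 S1 S2 S3)) (x, y))%:E)%E.
have phiE y : (\int[mu]_x ((gx \_ (T3 S1 S2 S3)) (x, y))%:E = (phi y)%:E)%E.
  suff [v vE] : exists v,
    (\int[mu]_x ((gx \_ (T3 S1 S2 S3)) (x, y))%:E = v%:E)%E by rewrite /phi vE.
  have [yA|Ay] := ltP y A.2; first by exists 0; apply: H0; left.
  have [Cy|yC] := ltP C.2 y; first by exists 0; apply: H0; right.
  have [By|yB] := ltP B.2 y; first by eexists; apply: H2; rewrite By.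
  have [BA|lAB] := leP B.2 A.2; last by eexists; apply: H1; rewrite ?Ay.
  have e : A.2 = B.2 by apply/eqP; rewrite eq_le AB.
  by have -> : y = A.2; [apply/eqP; rewrite eq_le Ay {1}e yB|exact: H3].
have [iphi ->] := I2_iterated D0 bgx phiE.
have [p1 [P1 ->]] := I01_lerp A B pg; have [p2 [P2 ->]] := I01_lerp B C pg.
have [p3 [P3 ->]] := I01_lerp A C pg.
apply: Rintegral_sorted => //.
- by move=> y /H0; rewrite phiE => -[].
- move=> y lAB yAB; have := H1 y lAB yAB; rewrite phiE => -[->].
  by rewrite P1 P3 !lerp_absc.
- move=> y yBC; have := H2 y yBC; rewrite phiE => -[->].
  by rewrite P2 P3 !lerp_absc//; case/andP: yBC => y1 y2; exact: lt_le_trans y1 y2.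
Qed.

Lemma absc_refl A B (y : R) :
  absc (- A.1, A.2) (- B.1, B.2) y = - absc A B y.
Proof. by rewrite /absc/=; ring. Qed.

Lemma T3_refl A B C (x y : R) :
  T3 (- A.1, A.2) (- B.1, B.2) (- C.1, C.2) (- x, y) <-> T3 A C B (x, y).
Proof. by rewrite /T3/= /cr/=; split=> -[h1 h2 h3]; split; lra. Qed.

Lemma I2_dx_sorted m g gx gy A B C : pd m g gx gy ->
  A.2 <= B.2 -> B.2 <= C.2 -> 0 < cr A B C ->
  I2 (T3 A B C) gx = (B.2 - A.2) * I01 (g \o lerp A B) +
    (C.2 - B.2) * I01 (g \o lerp B C) - (C.2 - A.2) * I01 (g \o lerp A C).
Proof.
move=> pg AB BC D0; have AC := sorted_lt D0 AB BC.
rewrite -[RHS]mul1r; apply: (I2_dx_core pg) => // [y Hy|y lAB Hy|y Hy|e].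
- by apply: slice_integral0 => x; exact: (slice_out D0 AB BC).
- have [lr _] := slice_low D0 AB BC 0 lAB Hy; rewrite mul1r.
  by apply: (slice_integral pg lr) => x; have [] := slice_low D0 AB BC x lAB Hy.
- have [lr _] := slice_high D0 AB BC 0 Hy; rewrite mul1r.
  by apply: (slice_integral pg lr) => x; have [] := slice_high D0 AB BC x Hy.
- have AB1 : A.1 <= B.1.
    rewrite -subr_ge0 -(@pmulr_lge0 _ (C.2 - A.2)) ?subr_gt0//.
    by apply: ltW; move: D0; rewrite /cr e; lra.
  eexists; apply: (slice_integral pg AB1) => x; rewrite /T3/= /cr/= -e.
  split=> [[h1 h2 h3]|/andP[h1 h2]].
    apply/andP; split; rewrite -subr_ge0 -(@pmulr_lge0 _ (C.2 - A.2)) ?subr_gt0//; lra.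
  have m1 : 0 <= (x - A.1) * (C.2 - A.2) by rewrite mulr_ge0 ?subr_ge0// ltW.
  have m2 : 0 <= (B.1 - x) * (C.2 - A.2) by rewrite mulr_ge0 ?subr_ge0// ltW.
  by split; lra.
Qed.

(** The middle vertex now lies on the left. The slices are those of the mirror image with left and
    right ends exchanged, which produces the minus sign. *)
Lemma I2_dx_sorted' m g gx gy A B C : pd m g gx gy ->
  A.2 <= B.2 -> B.2 <= C.2 -> 0 < cr A C B ->
  I2 (T3 A C B) gx = - ((B.2 - A.2) * I01 (g \o lerp A B) +
    (C.2 - B.2) * I01 (g \o lerp B C) - (C.2 - A.2) * I01 (g \o lerp A C)).
Proof.
move=> pg AB BC D0.
pose A' : pt := (- A.1, A.2); pose B' : pt := (- B.1, B.2).
pose C' : pt := (- C.1, C.2).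
have D0' : 0 < cr A' B' C' by move: D0; rewrite /cr/=; lra.
have AB' : A'.2 <= B'.2 by []. have BC' : B'.2 <= C'.2 by [].
have AC : A.2 < C.2 := sorted_lt D0' AB' BC'.
rewrite -[RHS]mulN1r; apply: (I2_dx_core pg) => // [y Hy|y lAB Hy|y Hy|e].
- apply: slice_integral0 => x /T3_refl; exact: (slice_out D0' AB' BC').
- have [lr _] := slice_low D0' AB' BC' 0 lAB Hy.
  rewrite !absc_refl lerN2 in lr; rewrite mulN1r opprB.
  apply: (slice_integral pg lr) => x; have [_] := slice_low D0' AB' BC' (- x) lAB Hy.
  by rewrite !absc_refl !lerN2 T3_refl andbC.
- have [lr _] := slice_high D0' AB' BC' 0 Hy.
  rewrite !absc_refl lerN2 in lr; rewrite mulN1r opprB.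
  apply: (slice_integral pg lr) => x; have [_] := slice_high D0' AB' BC' (- x) Hy.
  by rewrite !absc_refl !lerN2 T3_refl andbC.
- have AB1 : B.1 <= A.1.
    rewrite -subr_ge0 -(@pmulr_lge0 _ (C.2 - A.2)) ?subr_gt0//.
    by apply: ltW; move: D0; rewrite /cr -e; lra.
  eexists; apply: (slice_integral pg AB1) => x; rewrite /T3/= /cr/= -e.
  split=> [[h1 h2 h3]|/andP[h1 h2]].
    apply/andP; split; rewrite -subr_ge0 -(@pmulr_lge0 _ (C.2 - A.2)) ?subr_gt0//; lra.
  have m1 : 0 <= (A.1 - x) * (C.2 - A.2) by rewrite mulr_ge0 ?subr_ge0// ltW.
  have m2 : 0 <= (x - B.1) * (C.2 - A.2) by rewrite mulr_ge0 ?subr_ge0// ltW.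
  by split; lra.
Qed.

(** The differences of heights are the first components of the scaled outward normals. Rotate the
    vertices so that the lowest comes first; the two sorted cases then decide which of the others is
    in the middle. *)
Lemma I2_dx m g gx gy A B C : pd m g gx gy -> 0 < cr A B C ->
  I2 (T3 A B C) gx = (B.2 - A.2) * I01 (g \o lerp A B) +
    (C.2 - B.2) * I01 (g \o lerp B C) + (A.2 - C.2) * I01 (g \o lerp C A).
Proof.
move=> pg.
have low P Q S : 0 < cr P Q S -> P.2 <= Q.2 -> P.2 <= S.2 ->
    I2 (T3 P Q S) gx = (Q.2 - P.2) * I01 (g \o lerp P Q) +
    (S.2 - Q.2) * I01 (g \o lerp Q S) + (P.2 - S.2) * I01 (g \o lerp S P).
  move=> D0 PQ PS; have [QS|/ltW SQ] := leP Q.2 S.2.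
    by rewrite (I2_dx_sorted pg)// (I01_lerp_rev S P pg); ring.
  rewrite (I2_dx_sorted' pg)// (I01_lerp_rev Q S pg) (I01_lerp_rev S P pg); ring.
move=> D0; have DB : 0 < cr B C A by rewrite (cr_cycle A B C).
have DC : 0 < cr C A B by rewrite (cr_cycle B C A).
have TC : T3 C A B = T3 A B C by rewrite (T3_cycle B C A) (T3_cycle A B C).
have [AB|/ltW BA] := leP A.2 B.2.
  have [AC|/ltW CA] := leP A.2 C.2; first exact: low.
  by rewrite -TC (low _ _ _ DC CA (le_trans CA AB)); ring.
have [BC|/ltW CB] := leP B.2 C.2.
  by rewrite -(T3_cycle A B C) low//; ring.
by rewrite -TC (low _ _ _ DC (le_trans CB BA) CB); ring.
Qed.

Lemma pd_sw m g gx gy : pd m g gx gy -> pd m (g \o sw) (gy \o sw) (gx \o sw).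
Proof.
elim=> [|{}g {}gx {}gy h hx hy _ IH1 _ IH2|a b r ab].
- exact: pd0.
- exact: pdD IH1 IH2.
- by rewrite addnC in ab; apply: (pd_eq (pd_mono r ab)) => x /=; ring.
Qed.

Lemma I2_dy m g gx gy A B C : pd m g gx gy -> 0 < cr A B C ->
  I2 (T3 A B C) gy = (A.1 - B.1) * I01 (g \o lerp A B) +
    (B.1 - C.1) * I01 (g \o lerp B C) + (C.1 - A.1) * I01 (g \o lerp C A).
Proof.
move=> pg D0; have D0' : 0 < cr (sw A) (sw C) (sw B).
  by move: D0; rewrite /cr/=; lra.
have [_ [gyx [gyy pgy]]] := pd_deriv pg.
rewrite I2_swap//; [|exact: bm_pd pgy|exact: bm_pd (pd_sw pgy)].
rewrite (I2_dx (pd_sw pg) D0').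
have E P Q : I01 ((g \o sw) \o lerp (sw P) (sw Q)) = I01 (g \o lerp P Q) by [].
rewrite !E (I01_lerp_rev B A pg) (I01_lerp_rev C B pg) (I01_lerp_rev A C pg)/=.
ring.
Qed.

End DivergenceTheorem.

(** * Removal of null sets from integrals of arbitrary functions *)

Section NegligibleSets.
Context d (T : measurableType d) (R : realType).
Variable mu : {measure set T -> \bar R}.
Import HBNNSimple.

(* The integral is a supremum over simple functions below the integrand, so null
   sets can be discarded without any measurability of the integrand. *)
Lemma ge0_integral_setC_null (N : set T) (h : T -> \bar R) : measurable N ->
  mu N = 0%E -> (forall x, 0 <= h x)%E ->
  (\int[mu]_x h x = \int[mu]_x ((h \_ (~` N)) x))%E.
Proof.
move=> mN N0 h0.
have h0' x : (0 <= (h \_ (~` N)) x)%E by rewrite patchE; case: ifP.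
have hh x : ((h \_ (~` N)) x <= h x)%E by rewrite patchE; case: ifP.
rewrite !ge0_integralTE//; apply/eqP; rewrite eq_le; apply/andP; split.
(* A simple function below [h] keeps its integral when it is cut off on [N], and the truncated one
   lies below the truncated [h]. *)
- apply: ge_ereal_sup => _ [s sh <-]; apply: ereal_sup_ubound => /=.
  exists (proj_nnsfun s (measurableC mN)).
    move=> x; have -> : proj_nnsfun s (measurableC mN) x = (s \_ (~` N)) x.
      by rewrite (mrestrict s (measurableC mN)).
    by rewrite !patchE; case: ifP => // _; exact: sh.
  have ms (u : {nnsfun T >-> R}) : measurable_fun setT (fun x => (u x)%:E).
    exact/measurable_EFinP.
  have gs (u : {nnsfun T >-> R}) x : setT x -> (0 <= (u x)%:E)%E by rewrite lee_fin.
  rewrite -!integralT_nnsfun.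
  rewrite [RHS](ge0_negligible_integral mN measurableT (ms _) (gs _) N0).
  rewrite [LHS](ge0_negligible_integral mN measurableT (ms _) (gs _) N0).
  apply: eq_integral => x; rewrite inE => -[_ Nx].
  have -> : proj_nnsfun s (measurableC mN) x = (s \_ (~` N)) x.
    by rewrite (mrestrict s (measurableC mN)).
  by rewrite patchE mem_set.
- apply: ge_ereal_sup => _ [s sh <-]; apply: ereal_sup_ubound => /=.
  by exists s => // x; exact: le_trans (sh x) (hh x).
Qed.

Lemma integral_setD_null (D N : set T) (h : T -> \bar R) : measurable N ->
  mu N = 0%E -> (\int[mu]_(x in D) h x = \int[mu]_(x in D `\` N) h x)%E.
Proof.
move=> mN N0; rewrite integralE [RHS]integralE.
have E (k : T -> \bar R) : (forall x, 0 <= k x)%E ->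
    (\int[mu]_(x in D) k x = \int[mu]_(x in D `\` N) k x)%E.
  move=> k0; rewrite integral_mkcond (ge0_integral_setC_null mN N0)//.
    rewrite [RHS]integral_mkcond; apply: eq_integral => x _.
    by rewrite !patchE in_setD in_setC; case: (x \in N); case: (x \in D).
  by move=> x; rewrite patchE; case: ifP.
by congr (_ - _)%E; apply: E => x.
Qed.

End NegligibleSets.

(** * Open triangles and square integrable loads *)

Section OpenTriangle.
Variable R : realType.
Local Notation pt := (R * R)%type.
Local Notation mu := (@lebesgue_measure R).
Local Notation mu2 := (mu2 R).
Implicit Types (A B C : pt) (g h : pt -> R).

Definition T3o A B C : set pt :=
  [set x | [/\ 0 < cr A B x, 0 < cr B C x & 0 < cr C A x]].

Lemma T3o_T3 A B C : T3o A B C `<=` T3 A B C.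
Proof. by move=> x [? ? ?]; split; exact: ltW. Qed.

Definition line0 A B : set pt := [set x | cr A B x = 0].

Lemma measurable_line0 A B : measurable (line0 A B).
Proof.
rewrite (_ : line0 A B = cr A B @^-1` [set 0]); last by [].
rewrite -[X in measurable X]setTI; apply: (measurable_pd (pd_cr A B)) => //.
Qed.

(** A vertical line is the product of a point with the real line; any other line has a single point
    in each vertical section. *)
Lemma line0_null A B : A != B -> mu2 (line0 A B) = 0%E.
Proof.
move=> AB; have [e1|n1] := eqVneq A.1 B.1.
  have n2 : B.2 - A.2 != 0.
    rewrite subr_eq0; apply: contraNneq AB => e2.
    by rewrite (surjective_pairing A) (surjective_pairing B) e1 e2.
  have -> : line0 A B = [set A.1] `*` setT.
    apply/seteqP; split => [[x y]|[x y]]; rewrite /line0/= /cr/= -e1.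
      move=> H; split=> //; apply/eqP; rewrite -subr_eq0.
      by rewrite -(mulIr_eq0 _ (mulIf n2)); apply/eqP; lra.
    by move=> [-> _]; ring.
  have := product_measure1E mu mu (measurable_set1 A.1) (@measurableT _ R).
  move=> E; rewrite [LHS]E.
  transitivity (0 * mu setT)%E; last by rewrite mul0e.
  by congr (_ * _)%E; exact: lebesgue_measure_set1.
rewrite /mu2/= /product_measure1/=.
rewrite integral0_eq// => x _ /=.
have n1' : B.1 - A.1 != 0 by rewrite subr_eq0 eq_sym.
pose y := A.2 + (x - A.1) * (B.2 - A.2) / (B.1 - A.1).
have -> : xsection (line0 A B) x = [set y].
  apply/seteqP; split => z; rewrite /xsection/= inE /line0/= /cr/=.
    move=> H; apply: (mulfI n1'); rewrite /y mulrDr mulrCA mulfV// mulr1; lra.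
  by move=> ->; rewrite /y; field.
exact: lebesgue_measure_set1.
Qed.

(** Stated for arbitrary [g], because on the boundary of the domain nothing is known about the
    load. *)
Lemma I2_T3o A B C g : 0 < cr A B C -> I2 (T3 A B C) g = I2 (T3o A B C) g.
Proof.
move=> D0; pose N := line0 A B `|` line0 B C `|` line0 C A.
have crxx P Q : cr P P Q = 0 by rewrite /cr; ring.
have crxyx P Q : cr P Q P = 0 by rewrite /cr; ring.
have nAB : A != B by apply: contraTneq D0 => ->; rewrite crxx ltxx.
have nBC : B != C.
  by apply: contraTneq D0 => e; rewrite -cr_cycle -cr_cycle e crxyx ltxx.
have nCA : C != A by apply: contraTneq D0 => ->; rewrite crxyx ltxx.
have mN : measurable N by do 2?apply: measurableU; exact: measurable_line0.
have N0 : mu2 N = 0%E.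
  rewrite /N !measureU0//; try exact: measurable_line0; try exact: line0_null.
  by apply: measurableU; exact: measurable_line0.
have -> : T3o A B C = T3 A B C `\` N.
  apply/seteqP; split => [x [h1 h2 h3]|x [[h1 h2 h3] Nx]].
    split; first by split; exact: ltW.
    by move=> [[]|]; rewrite /line0/= => e; move: h1 h2 h3; rewrite e ltxx.
  have ne P Q : ~ line0 P Q x -> 0 <= cr P Q x -> 0 < cr P Q x.
    by move=> H h; rewrite lt_def h andbT; apply/eqP.
  by split; apply: ne => // H; apply: Nx; [left; left|left; right|right].
by rewrite /I2 /Rintegral; congr fine; apply: integral_setD_null.
Qed.

Lemma measurable_T3o A B C : measurable (T3o A B C).
Proof.
have H P Q : measurable [set x | 0 < cr P Q x].
  rewrite (_ : [set _ | _] = cr P Q @^-1` `]0, +oo[); last first.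
    by apply/seteqP; split => x /=; rewrite in_itv/= andbT.
  by rewrite -[X in measurable X]setTI; exact: (measurable_pd (pd_cr P Q)).
rewrite (_ : T3o _ _ _ = [set x | 0 < cr A B x] `&` [set x | 0 < cr B C x]
    `&` [set x | 0 < cr C A x]); last first.
  by apply/seteqP; split => x /= [] => [|[]] *; do ?split.
by do 2?apply: measurableI.
Qed.

(** An open set is the countable union of the boxes with rational corners that it contains. *)
Lemma open_measurable_pt (O : set pt) : open O -> measurable O.
Proof.
move=> oO.
pose box (a b c e : rat) : set pt :=
  `]ratr a, ratr b[%classic `*` `]ratr c, ratr e[%classic.
pose F (a b c e : rat) : set pt := if `[< box a b c e `<=` O >] then box a b c e else set0.
have -> : O = \bigcup_a \bigcup_b \bigcup_c \bigcup_e F a b c e.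
  apply/seteqP; split => x; last first.
    move=> [a _ [b _ [c _ [e _]]]]; rewrite /F; case: asboolP => // H.
    exact: H.
  move=> Ox; have /nbhs_ballP[r /= r0 rO] : nbhs x O by exact: open_nbhs_nbhs.
  have q (u v : R) : u < v -> exists w : rat, u < ratr w < v.
    by move=> /rat_in_itvoo[w]; rewrite in_itv/=; exists w.
  have [a /andP[a1 a2]] := q (x.1 - r) x.1 (ltac:(lra)).
  have [b /andP[b1 b2]] := q x.1 (x.1 + r) (ltac:(lra)).
  have [c /andP[c1 c2]] := q (x.2 - r) x.2 (ltac:(lra)).
  have [e /andP[e1 e2]] := q x.2 (x.2 + r) (ltac:(lra)).
  exists a => //; exists b => //; exists c => //; exists e => //.
  rewrite /F asboolT.
    by rewrite /box/=; split; rewrite /= in_itv/=; apply/andP.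
  move=> y []; rewrite /= !in_itv/= => /andP[y1 y2] /andP[y3 y4]; apply: rO.
  by split; rewrite /ball/= ltr_norml; apply/andP; split; lra.
do 4!(apply: bigcupT_measurable_rat => ?); rewrite /F; case: ifP => _ //.
by apply: measurableX; exact: measurable_itv.
Qed.

Section SquareIntegrable.
Variables (A B C : pt) (O : set pt) (f : pt -> R).
Hypotheses (D0 : 0 < cr A B C) (oO : open O) (TO : T3o A B C `<=` O).
Hypotheses (mf : measurable_fun O f)
  (f2 : (\int[leb2 (R := R)]_(x in O) ((f x) ^+ 2)%:E < +oo)%E).
Local Notation T := (T3 A B C).
Local Notation To := (T3o A B C).

Let mO : measurable O. Proof. exact: open_measurable_pt. Qed.

Lemma fin_T3o : (mu2 To < +oo)%E.
Proof.
apply: le_lt_trans (fin_T3 D0); apply: (le_measure mu2 _ _ (@T3o_T3 A B C));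
  rewrite inE; [exact: measurable_T3o|exact: measurable_T3].
Qed.

Lemma integrable_L2_T3o : mu2.-integrable To (EFin \o f).
Proof.
have mT := measurable_T3o A B C.
have mfT : measurable_fun To f by exact: measurable_funS mf.
have mf2 : measurable_fun O (fun x => (f x) ^+ 2) by exact: measurable_funX.
have i2 : mu2.-integrable To (EFin \o (fun x => (f x) ^+ 2)).
  apply: (@integrableS _ _ _ mu2 O) => //; apply/integrableP; split.
    exact/measurable_EFinP.
  move: f2; apply: le_lt_trans; rewrite le_eqVlt; apply/orP; left; apply/eqP.
  by apply: eq_integral => x _; rewrite /= ger0_norm ?sqr_ge0.
have i1 : mu2.-integrable To (EFin \o (fun=> 1 : R)).
  by apply: integrable_bm => //; [exact: fin_T3o|exact: bm_cst].
have i12 : mu2.-integrable To (fun x => ((fun=> 1) x)%:E + ((f x) ^+ 2)%:E)%E.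
  exact: (integrableD _ i1 i2).
apply: le_integrable i12; [exact: mT|exact/measurable_EFinP|].
move=> x _; rewrite /= lee_fin [leRHS]ger0_norm ?addr_ge0 ?sqr_ge0//.
(* This square gives [2 |f| <= 1 + f^2], so on a set of finite measure [f] is dominated by an
   integrable function. *)
have : 0 <= (`|f x| - 1) ^+ 2 by exact: sqr_ge0.
have := sqr_ge0 (f x); rewrite -(real_normK (num_real (f x))); have := normr_ge0 (f x).
nra.
Qed.

Lemma integrable_L2_bm g : bm T g -> mu2.-integrable To (EFin \o (fun x => f x * g x)).
Proof.
move=> [mg [M HM]].
have mT := measurable_T3o A B C.
have mgT : measurable_fun To g.
  by apply: measurable_funS mg; [exact: measurable_T3|exact: T3o_T3].
have [mfT _] := integrableP _ _ _ integrable_L2_T3o.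
have iM : mu2.-integrable To (fun x => (`|M|%:E * (EFin \o f) x)%E).
  exact: integrableZl integrable_L2_T3o.
apply: le_integrable iM; [exact: mT| |].
  by apply/measurable_EFinP; apply: measurable_funM => //; exact/measurable_EFinP.
move=> x /T3o_T3 Tx; rewrite /= lee_fin !normrM normr_id mulrC ler_wpM2r//.
by rewrite (le_trans (HM x Tx))// ler_norm.
Qed.

End SquareIntegrable.

Lemma I2_L2_lin A B C (O : set pt) (f : pt -> pt) (r : R) (g1 g2 h1 h2 : pt -> R) :
  0 < cr A B C -> open O -> T3o A B C `<=` O -> L2vec O f ->
  let T := T3 A B C in bm T g1 -> bm T g2 -> bm T h1 -> bm T h2 ->
  I2 T (fun x => (f x).1 * (r * g1 x + h1 x) + (f x).2 * (r * g2 x + h2 x)) =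
  r * I2 T (fun x => (f x).1 * g1 x + (f x).2 * g2 x) +
  I2 T (fun x => (f x).1 * h1 x + (f x).2 * h2 x).
Proof.
move=> D0 oO TO [m1 [m2 [s1 s2]]] T bg1 bg2 bh1 bh2; rewrite /T !I2_T3o//.
have mT := measurable_T3o A B C.
have i1 g : bm T g -> mu2.-integrable (T3o A B C) (EFin \o (fun x => (f x).1 * g x)).
  exact: (integrable_L2_bm D0 oO TO m1 s1).
have i2 g : bm T g -> mu2.-integrable (T3o A B C) (EFin \o (fun x => (f x).2 * g x)).
  exact: (integrable_L2_bm D0 oO TO m2 s2).
have i12 g h : bm T g -> bm T h ->
    mu2.-integrable (T3o A B C) (EFin \o (fun x => (f x).1 * g x + (f x).2 * h x)).
  by move=> bg bh; apply: (integrableD _ (i1 _ bg) (i2 _ bh)).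
have Z (g : pt -> R) : mu2.-integrable (T3o A B C) (EFin \o g) ->
    mu2.-integrable (T3o A B C) (EFin \o (fun x => r * g x)) /\
    I2 (T3o A B C) (fun x => r * g x) = r * I2 (T3o A B C) g.
  move=> ig; split; last by apply: RintegralZl => //; exact: mT.
  have : mu2.-integrable (T3o A B C) (fun x => (r%:E * (EFin \o g) x)%E).
    by apply: integrableZl => //; exact: mT.
  by apply: eq_integrable => // x _; rewrite /= EFinM.
have [iZ <-] := Z _ (i12 _ _ bg1 bg2).
transitivity (I2 (T3o A B C) (fun x => r * ((f x).1 * g1 x + (f x).2 * g2 x) +
    ((f x).1 * h1 x + (f x).2 * h2 x))).
  by apply: eq_Rintegral => x _; ring.
by apply: RintegralD => //; exact: i12.
Qed.

End OpenTriangle.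

(** * Planar geometry of triangulations *)

Section Planar.
Variable R : realType.
Local Notation pt := (R * R)%type.
Implicit Types (A B C x y z : pt) (t : R).

Lemma lerp0 x y : lerp x y 0 = x.
Proof. by rewrite /lerp !mul0r !addr0 -surjective_pairing. Qed.

Lemma lerp1 x y : lerp x y 1 = y.
Proof. by rewrite /lerp !mul1r !subrKC -surjective_pairing. Qed.

Lemma cr_lerp A B x y t : cr A B (lerp x y t) = (1 - t) * cr A B x + t * cr A B y.
Proof. by rewrite /cr /lerp/=; ring. Qed.

Lemma cr_anti A B x : cr B A x = - cr A B x.
Proof. by rewrite /cr; ring. Qed.

Lemma crAA A B : cr A B A = 0. Proof. by rewrite /cr; ring. Qed.
Lemma crBB A B : cr A B B = 0. Proof. by rewrite /cr; ring. Qed.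

Lemma cr_neq A B C : 0 < cr A B C -> A <> B.
Proof. by move=> + e; rewrite e /cr !subrr mul0r mulr0 subrr ltxx. Qed.

Lemma segment_T3 A B C x : 0 < cr A B C ->
  segment A B x <-> T3 A B C x /\ cr A B x = 0.
Proof.
move=> D0; split=> [[t /=]|[[h1 h2 h3] h0]].
  rewrite in_itv/= => /andP[t0 t1] <-.
  have u0 : 0 <= 1 - t by lra.
  have eCAB : cr C A B = cr A B C by rewrite (cr_cycle B C A) cr_cycle.
  rewrite /T3/= !cr_lerp !crAA !crBB eCAB (cr_cycle A B C); split; last by ring.
  by split; rewrite ?mulr0 ?addr0 ?add0r// mulr_ge0// ltW.
have [e1 e2] := cr_bary A B C x; have es := cr_sum A B C x.
have Dn := lt0r_neq0 D0.
(* The barycentric coordinate of [x] at [B]. *)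
exists (cr C A x / cr A B C).
  rewrite /= in_itv/=; apply/andP; split; first by rewrite divr_ge0// ltW.
  by rewrite ler_pdivrMr// mul1r; lra.
rewrite /lerp [RHS]surjective_pairing; congr pair; apply: (mulfI Dn).
  by rewrite e1 mulrDr mulrA (mulrC _ (_ / _)) divfK//; move: es; rewrite h0; nra.
by rewrite e2 mulrDr mulrA (mulrC _ (_ / _)) divfK//; move: es; rewrite h0; nra.
Qed.

Lemma corner_T3 A B C x : 0 < cr A B C -> cr A B x = 0 -> cr C A x = 0 -> x = A.
Proof.
move=> D0 h1 h2; have [e1 e2] := cr_bary A B C x; have es := cr_sum A B C x.
have Dn := lt0r_neq0 D0.
have e : cr B C x = cr A B C by rewrite -es h1 h2; ring.
rewrite (surjective_pairing x) (surjective_pairing A).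
by congr pair; apply: (mulfI Dn); rewrite ?e1 ?e2 h1 h2 e; ring.
Qed.

(** In the parameter of [A B] the other endpoints are [a] and [b], and conversely [c] and [d], all
    in [0,1]. Composing gives [(d - c) * (b - a) = 1], so [a] and [b] are 0 and 1 in one order or
    the other. *)
Lemma segment_endpoints A B A' B' : A <> B -> segment A B = segment A' B' ->
  (A' = A /\ B' = B) \/ (A' = B /\ B' = A).
Proof.
move=> AB e.
have end0 (P Q : pt) : segment P Q P.
  by exists 0; [rewrite /= in_itv/= lexx ler01|exact: lerp0].
have end1 (P Q : pt) : segment P Q Q.
  by exists 1; [rewrite /= in_itv/= lexx ler01|exact: lerp1].
have [a /= ia ea] : segment A B A' by rewrite e.
have [b /= ib eb] : segment A B B' by rewrite e.
have [c /= ic ec] : segment A' B' A by rewrite -e.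
have [d /= id ed] : segment A' B' B by rewrite -e.
move: ia ib ic id; rewrite !in_itv/= => /andP[a0 a1] /andP[b0 b1] /andP[c0 c1] /andP[d0 d1].
have ll P Q u v w : lerp (lerp P Q u) (lerp P Q v) w = lerp P Q (u + w * (v - u)).
  by rewrite /lerp/=; congr pair; ring.
have inj u v : lerp A B u = lerp A B v -> u = v.
  rewrite /lerp => -[E1 E2]; apply/eqP; apply/negPn/negP => uv; apply: AB.
  have uv0 : u - v != 0 by rewrite subr_eq0.
  by rewrite (surjective_pairing A) (surjective_pairing B); congr pair;
    apply/esym/eqP; rewrite -subr_eq0; apply/eqP; apply: (mulfI uv0);
    rewrite mulr0; lra.
have E0 : a + c * (b - a) = 0.
  by apply: inj; rewrite -ll ea eb ec lerp0.
have E1 : a + d * (b - a) = 1.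
  by apply: inj; rewrite -ll ea eb ed lerp1.
have E : (d - c) * (b - a) = 1 by lra.
have [ab|ab] := leP a b.
  left; have b1' : b = 1.
    by apply/eqP; rewrite eq_le b1/=; nra.
  have a0' : a = 0 by apply/eqP; rewrite eq_le a0 andbT; nra.
  by rewrite -ea -eb a0' b1' lerp0 lerp1.
right; have a1' : a = 1 by apply/eqP; rewrite eq_le a1/=; nra.
have b0' : b = 0 by apply/eqP; rewrite eq_le b0 andbT; nra.
by rewrite -ea -eb a1' b0' lerp0 lerp1.
Qed.

Lemma two_triangles_nbhs A B C C' z : cr A B z = 0 ->
  0 < cr B C z -> 0 < cr C A z -> 0 < cr A C' z -> 0 < cr C' B z ->
  nbhs z (T3 A B C `|` T3 B A C').
Proof.
move=> h0 /cr_gt0_near h1 /cr_gt0_near h2 /cr_gt0_near h3 /cr_gt0_near h4.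
near=> y.
have [k|k] := leP 0 (cr A B y).
  left; split=> //; apply/ltW; [near: y; exact: h1|near: y; exact: h2].
right; split; first by rewrite cr_anti oppr_ge0 ltW.
  by apply/ltW; near: y; exact: h3.
by apply/ltW; near: y; exact: h4.
Unshelve. all: by end_near. Qed.

Lemma near_pos_comb (u v : R) : 0 < u ->
  exists2 e, 0 < e & forall t, 0 < t < e -> 0 < (1 - t) * u + t * v.
Proof.
move=> u0; have s0 : 0 < u + `|v| by rewrite ltr_pwDl.
(* The combination is at least [u - t * (u + |v|)], which is positive below this threshold. *)
exists (u / (u + `|v|)); first exact: divr_gt0.
move=> t /andP[t0]; rewrite ltr_pdivlMr// => H.
have := ler_norm (- v); rewrite normrN => Hv; nra.
Qed.

(** Both triangles lie to the left of the same directed edge. A small move from its midpoint towards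
    [C] enters both interiors. *)
Lemma overlap A B C C' : 0 < cr A B C -> 0 < cr A B C' ->
  exists q, T3o A B C q /\ T3o A B C' q.
Proof.
move=> D0 D0'; pose z : pt := lerp A B (2^-1).
have z1 P : cr B P z = cr A B P / 2.
  by rewrite /z cr_lerp crAA -(cr_cycle A B P); field.
have z2 P : cr P A z = cr A B P / 2.
  by rewrite /z cr_lerp crBB -(cr_cycle A B P) -(cr_cycle B P A); field.
have z0 : cr A B z = 0 by rewrite /z cr_lerp crAA crBB; ring.
have [e1 e10 E1] := @near_pos_comb (cr B C' z) (cr B C' C) ltac:(by rewrite z1 divr_gt0).
have [e2 e20 E2] := @near_pos_comb (cr C' A z) (cr C' A C) ltac:(by rewrite z2 divr_gt0).
pose t := Num.min 1 (Num.min e1 e2) / 2.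
have m0 : 0 < Num.min 1 (Num.min e1 e2) by rewrite !lt_min ltr01 e10 e20.
have t0 : 0 < t by rewrite divr_gt0.
have tm : t < Num.min 1 (Num.min e1 e2).
  by rewrite ltr_pdivrMr// ltr_pMr// ltr1n.
move: tm; rewrite !lt_min => /and3P[t1 te1 te2].
have u0 : 0 < 1 - t by rewrite subr_gt0.
exists (lerp z C t); split; split; rewrite cr_lerp ?z0 ?mulr0 ?add0r.
- by rewrite mulr_gt0.
- by rewrite z1 crBB mulr0 addr0 mulr_gt0// divr_gt0.
- by rewrite z2 crAA mulr0 addr0 mulr_gt0// divr_gt0.
- by rewrite mulr_gt0.
- by apply: E1; rewrite t0.
- by apply: E2; rewrite t0.
Qed.

Definition centroid A B C : pt := ((A.1 + B.1 + C.1) / 3, (A.2 + B.2 + C.2) / 3).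

Lemma T3o_centroid A B C : 0 < cr A B C -> T3o A B C (centroid A B C).
Proof.
move=> D0; have D3 : 0 < cr A B C / 3 by rewrite divr_gt0.
have [e1 [e2 e3]] : cr A B (centroid A B C) = cr A B C / 3 /\
    cr B C (centroid A B C) = cr A B C / 3 /\ cr C A (centroid A B C) = cr A B C / 3.
  by rewrite /cr /centroid/=; do !split; field.
by split; rewrite ?e1 ?e2 ?e3.
Qed.

Lemma continuous_affine (a b : R) : continuous (fun s : R => a + s * b).
Proof.
have -> : (fun s : R => a + s * b) = horner (a%:P + b *: 'X).
  by apply/funext => s; rewrite !hornerE mulrC.
exact: continuous_horner.
Qed.

Lemma near_lerp x y t (P : set pt) : nbhs (lerp x y t) P ->
  \forall s \near t, P (lerp x y s).
Proof.
move=> [[Q1 Q2] /= [q1 q2] sub].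
have h1 := @continuous_affine _ _ t _ q1; have h2 := @continuous_affine _ _ t _ q2.
near=> s; apply: sub; split => /=; near: s; [exact: h1|exact: h2].
Unshelve. all: by end_near. Qed.

Lemma avoid_roots (I : finType) (P : I -> {poly R}) (e : R) : 0 < e ->
  (forall i, P i != 0) -> exists2 t, 0 < t < e & forall i, (P i).[t] != 0.
Proof.
move=> e0 P0; have pr0 : \prod_i P i != 0 by apply/prodf_neq0 => i _.
have [t te] := poly_nonroot pr0 e0; rewrite horner_prod => /prodf_neq0 H.
by exists t => // i; exact: H.
Qed.

(** [P i] is the squared distance from the moving point to [v i]; it is a nonzero polynomial because
    the moving point is not constant. *)
Lemma avoid_points (I : finType) (v : I -> pt) x y (e : R) : 0 < e -> x <> y ->
  exists2 t, 0 < t < e & forall i, lerp x y t <> v i.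
Proof.
move=> e0 xy.
pose q (a b c : R) : {poly R} := (a - c)%:P + (b - a) *: 'X.
have qE a b c t : (q a b c).[t] = a + t * (b - a) - c by rewrite /q !hornerE; ring.
pose P i := q x.1 y.1 (v i).1 ^+ 2 + q x.2 y.2 (v i).2 ^+ 2.
have PE i t : (P i).[t] = (x.1 + t * (y.1 - x.1) - (v i).1) ^+ 2 +
    (x.2 + t * (y.2 - x.2) - (v i).2) ^+ 2.
  by rewrite /P hornerD !horner_exp !qE.
have P0 i : P i != 0.
  apply/eqP => P0; apply: xy.
  have z s : (x.1 + s * (y.1 - x.1) = (v i).1) /\ (x.2 + s * (y.2 - x.2) = (v i).2).
    have := PE i s; rewrite P0 horner0 => /esym/eqP.
    rewrite paddr_eq0 ?sqr_ge0// !sqrf_eq0 !subr_eq0.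
    by move=> /andP[/eqP -> /eqP ->].
  have [a1 a2] := z 0; have [b1 b2] := z 1.
  by rewrite (surjective_pairing x) (surjective_pairing y); congr pair; lra.
have [t te H] := avoid_roots e0 P0; exists t => // i E.
have := H i; rewrite PE -E /lerp/= !subrr expr0n/= addr0 eqxx.
by [].
Qed.

(* The points A + t (B - A) + t^2 (C - A) lie on a conic arc inside the triangle,
   and each line through y meets the arc at finitely many parameters. *)
Lemma avoid_lines (I : finType) (v : I -> pt) A B C y : 0 < cr A B C ->
  (forall i, v i <> y) -> exists2 x, T3o A B C x & forall i, cr y x (v i) != 0.
Proof.
move=> D0 vy.
pose w i : pt := ((v i).1 - y.1, (v i).2 - y.2).
pose c1 i := (B.1 - A.1) * (w i).2 - (w i).1 * (B.2 - A.2).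
pose c2 i := (C.1 - A.1) * (w i).2 - (w i).1 * (C.2 - A.2).
pose P i : {poly R} := (cr y A (v i))%:P + c1 i *: 'X + c2 i *: 'X^2.
have P0 i : P i != 0.
  apply/eqP => P0; apply: (vy i).
  have e1 : c1 i = 0.
    have := congr1 (fun p : {poly R} => p`_1) P0.
    by rewrite /P !coefD coefC !coefZ coefX coefXn coef0/= mulr0 addr0 add0r mulr1.
  have e2 : c2 i = 0.
    have := congr1 (fun p : {poly R} => p`_2) P0.
    by rewrite /P !coefD coefC !coefZ coefX coefXn coef0/= mulr0 !add0r mulr1.
  have Dn := lt0r_neq0 D0.
  have k1 : cr A B C * (w i).1 = 0.
    transitivity ((C.1 - A.1) * c1 i - (B.1 - A.1) * c2 i).
      by rewrite /cr /c1 /c2; ring.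
    by rewrite e1 e2; ring.
  have k2 : cr A B C * (w i).2 = 0.
    transitivity ((C.2 - A.2) * c1 i - (B.2 - A.2) * c2 i).
      by rewrite /cr /c1 /c2; ring.
    by rewrite e1 e2; ring.
  move/eqP: k1; move/eqP: k2; rewrite !mulf_eq0 (negbTE Dn)/= !subr_eq0.
  move=> /eqP k2 /eqP k1.
  by rewrite (surjective_pairing (v i)) (surjective_pairing y) k1 k2.
have [t /andP[t0 t1] H] := avoid_roots (e := 2^-1) ltac:(by rewrite invr_gt0) P0.
have t2 : t < 2^-1 := t1.
pose x : pt := (A.1 + t * (B.1 - A.1) + t ^+ 2 * (C.1 - A.1),
        A.2 + t * (B.2 - A.2) + t ^+ 2 * (C.2 - A.2)).
exists x => [|i].
  (* The barycentric weight at [A]; the bound one half on [t] was chosen to keep it positive. *)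
  have h : 0 < 1 - t - t ^+ 2 by nra.
  have k1 : cr A B x = t ^+ 2 * cr A B C by rewrite /cr/=; ring.
  have k2 : cr B C x = (1 - t - t ^+ 2) * cr A B C by rewrite /cr/=; ring.
  have k3 : cr C A x = t * cr A B C by rewrite /cr/=; ring.
  by split; rewrite ?k1 ?k2 ?k3 mulr_gt0// exprn_gt0.
have := H i; rewrite /P !hornerE.
by congr (_ != 0); rewrite /cr /c1 /c2 /w/=; ring.
Qed.

(** Otherwise the 0-1 indicator [f] would be continuous with [f 0 = 0] and [f 1 = 1], and would take
    the value one half. *)
Lemma locally_constant_01 (F : R -> Prop) :
  (forall t, 0 <= t <= 1 -> \forall s \near t, 0 <= s <= 1 -> (F s <-> F t)) ->
  F 0 -> F 1.
Proof.
move=> H F0; apply: contrapT => F1.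
pose f t : R := if `[< F t >] then 0 else 1.
have f0 : f 0 = 0 by rewrite /f asboolT.
have f1 : f 1 = 1 by rewrite /f asboolF.
have cf : {within `[0, 1], continuous f}.
  apply/subspace_continuousP => t; rewrite /= in_itv/= => t01.
  apply: cvg_near_cst.
  apply: filterS (H t t01) => s Hs; rewrite /= in_itv/= => s01.
  by rewrite /f; congr (if _ then _ else _); apply/asbool_equiv_eq/Hs.
have : exists2 c, c \in `[0, 1]%R & f c = 2^-1.
  apply: IVT => //; rewrite f0 f1 minEle maxEle ler01 invr_ge0 ler0n/=.
  by rewrite invf_le1// ler1n.
move=> [c _]; rewrite /f; case: ifP => _ /eqP.
  by rewrite eq_sym invr_eq0 pnatr_eq0.
by rewrite eq_sym invr_eq1 pnatr_eq1.
Qed.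

End Planar.

(** * Shared edges, boundary edges and connectedness of a triangulation *)

Section Triangulations.
Variables (R : realType) (n : nat).
Local Notation pt := (R * R)%type.
Variable V : 'I_n -> 'I_3 -> pt.
Implicit Types (i : 'I_n) (j : 'I_3) (x y z : pt).

Lemma ord3P (P : 'I_3 -> Prop) : P 0 -> P 1 -> P 2 -> forall j, P j.
Proof.
move=> P0 P1 P2 [[|[|[|//]]] ltj].
- by have -> : Ordinal ltj = 0 by exact/val_inj.
- by have -> : Ordinal ltj = 1 by exact/val_inj.
- by have -> : Ordinal ltj = 2 by exact/val_inj.
Qed.

Lemma nxt0 : nxt 0 = 1. Proof. by apply/val_inj; rewrite /= inordK. Qed.
Lemma nxt1 : nxt 1 = 2. Proof. by apply/val_inj; rewrite /= inordK. Qed.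
Lemma nxt2 : nxt 2 = 0. Proof. by apply/val_inj; rewrite /= inordK. Qed.

Lemma nxt3 j : nxt (nxt (nxt j)) = j.
Proof. by elim/ord3P: j; rewrite !(nxt0, nxt1, nxt2). Qed.

Lemma nxt_cases j k : j != k -> k = nxt j \/ k = nxt (nxt j).
Proof.
by elim/ord3P: j; elim/ord3P: k; rewrite !(nxt0, nxt1, nxt2) ?eqxx// => _; tauto.
Qed.

Lemma sum3 (F : 'I_3 -> R) : \sum_j F j = F 0 + F 1 + F 2.
Proof.
rewrite !big_ord_recr big_ord0 /= add0r.
by congr (F _ + F _ + F _); exact/val_inj.
Qed.

(** Up to a positive factor, the barycentric coordinate at the vertex opposite to the local edge
    [j]. *)
Definition hh i j x := cr (V i j) (V i (nxt j)) x.

Lemma ccw_nxt i j : ccw V i -> 0 < cr (V i j) (V i (nxt j)) (V i (nxt (nxt j))).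
Proof.
move=> c; have c0 : 0 < cr (V i 0) (V i 1) (V i 2) := c.
by elim/ord3P: j; rewrite !(nxt0, nxt1, nxt2)// ?(cr_cycle (V i 0))// (cr_cycle (V i 1)) (cr_cycle (V i 0)).
Qed.

Lemma triE i j : ccw V i -> tri V i = T3 (V i j) (V i (nxt j)) (V i (nxt (nxt j))).
Proof.
move=> c; have c0 : 0 < cr (V i 0) (V i 1) (V i 2) := c.
have -> : T3 (V i j) (V i (nxt j)) (V i (nxt (nxt j))) = T3 (V i 0) (V i 1) (V i 2).
  by elim/ord3P: j; rewrite !(nxt0, nxt1, nxt2)// ?(T3_cycle (V i 0))// (T3_cycle (V i 1)) (T3_cycle (V i 0)).
move: c0; set A := V i 0; set B := V i 1; set C := V i 2 => D0.
have Dn := lt0r_neq0 D0.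
apply/seteqP; split => [x [l [l0 [l1 ->]]]|x [h1 h2 h3]].
  rewrite !sum3 -/A -/B -/C in l1 *.
  move: (l 0) (l 1) (l 2) (l0 0) (l0 1) (l0 2) l1 => a b u a0 b0 u0 e.
  have {}e : a = 1 - b - u by lra.
  split.
  - by rewrite (_ : cr A B _ = u * cr A B C); [exact: mulr_ge0 _ (ltW D0)|rewrite /cr/= e; ring].
  - by rewrite (_ : cr B C _ = a * cr A B C); [exact: mulr_ge0 _ (ltW D0)|rewrite /cr/= e; ring].
  - by rewrite (_ : cr C A _ = b * cr A B C); [exact: mulr_ge0 _ (ltW D0)|rewrite /cr/= e; ring].
have [e1 e2] := cr_bary A B C x.
exists (fun j => if j == 0 then cr B C x / cr A B C else
  if j == 1 then cr C A x / cr A B C else cr A B x / cr A B C).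
split; first by elim/ord3P; rewrite /= divr_ge0// ltW.
rewrite !sum3/= -/A -/B -/C; split.
  by apply: (mulfI Dn); rewrite !mulrDr !(mulrC (cr A B C)) !divfK// mul1r -(cr_sum A B C x); ring.
rewrite [LHS]surjective_pairing; congr pair; apply: (mulfI Dn).
  by rewrite e1; field.
by rewrite e2; field.
Qed.

Lemma triP i x : ccw V i -> tri V i x <-> forall j, 0 <= hh i j x.
Proof.
move=> c; rewrite (triE 0 c) /T3/= nxt0 nxt1; split=> [[h1 h2 h3]|H].
  by elim/ord3P; rewrite /hh ?nxt0 ?nxt1 ?nxt2.
by move: (H 0) (H 1) (H 2); rewrite /hh nxt0 nxt1 nxt2.
Qed.

Lemma edgeP i j x : ccw V i -> edge V i j x <-> tri V i x /\ hh i j x = 0.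
Proof. by move=> c; rewrite (triE j c); apply: segment_T3; exact: ccw_nxt. Qed.

Lemma edge_ends i j : edge V i j (V i j) /\ edge V i j (V i (nxt j)).
Proof.
split; [exists 0|exists 1]; rewrite /= ?in_itv/= ?lexx ?ler01//.
  exact: lerp0.
exact: lerp1.
Qed.

(** This is how avoiding vertices pays off: a point of one edge that is no vertex is strictly inside
    with respect to the other two. *)
Lemma corner i j k x : ccw V i -> j != k -> hh i j x = 0 -> hh i k x = 0 ->
  exists m, x = V i m.
Proof.
move=> c jk h1 h2.
have key l : hh i l x = 0 -> hh i (nxt (nxt l)) x = 0 -> x = V i l.
  move=> k1 k2; apply: (corner_T3 (ccw_nxt l c) k1).
  by move: k2; rewrite /hh nxt3.
case: (nxt_cases jk) => e; subst k; last by exists j; exact: key.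
by exists (nxt j); apply: key => //; rewrite nxt3.
Qed.

Lemma hh_vertex i m : ccw V i -> exists j, hh i j (V i m) = 0.
Proof. by exists m; exact: crAA. Qed.

Lemma nbhs_not_tri i z : ccw V i -> ~ tri V i z -> \forall y \near z, ~ tri V i y.
Proof.
move=> c /(triP _ c) /existsNP[j /negP]; rewrite -ltNge => h.
have : 0 < cr (V i (nxt j)) (V i j) z by rewrite cr_anti oppr_gt0.
move=> /cr_gt0_near; apply: filterS => y; rewrite cr_anti oppr_gt0 => hy.
by move=> /(triP _ c) /(_ j); rewrite leNgt hy.
Qed.

Lemma nbhs_tri i z : ccw V i -> (forall j, 0 < hh i j z) -> nbhs z (tri V i).
Proof.
move=> c H; rewrite (triE 0 c) nxt0 nxt1; apply: open_interior_T3.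
- by have := H 0; rewrite /hh nxt0.
- by have := H 1; rewrite /hh nxt1.
- by have := H 2; rewrite /hh nxt2.
Qed.

Hypothesis HT : triangulation V.
Let Hccw i : ccw V i. Proof. by case: HT. Qed.

Lemma tri_common_edge i i' x : i != i' -> tri V i x -> tri V i' x ->
  (forall m, x <> V i m) -> exists j j', [/\ edge V i j = edge V i' j',
    tri V i `&` tri V i' = edge V i j & edge V i j x].
Proof.
move=> ii' t1 t2 nv; have I : (tri V i `&` tri V i') x by split.
case: (HT.2 _ _ ii') => [e|[[j [j' [_ e]]]|[j [j' [e1 e2]]]]].
- by rewrite e in I.
- by rewrite e in I; case: (nv _ I).
- by exists j, j'; split=> //; rewrite -e2.
Qed.

Lemma interior_unique i i' x : (forall j, 0 < hh i j x) -> tri V i' x -> i' = i.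
Proof.
move=> H t; apply/eqP; rewrite eq_sym; apply: contrapT => /negP ii'.
have ti : tri V i x by apply/(triP _ (Hccw i)) => j; exact: ltW.
have nv m : x <> V i m.
  by move=> e; have [j] := hh_vertex m (Hccw i); rewrite -e => h; have := H j; rewrite h ltxx.
have [j [j' [_ _ /(edgeP _ _ (Hccw i))[_ h]]]] := tri_common_edge ii' ti t nv.
by have := H j; rewrite h ltxx.
Qed.

(** If both counterclockwise triangles ran through the edge in the same direction, [overlap] would
    give them a common interior point. *)
Lemma shared_edge_rev i i' j j' : i != i' -> edge V i j = edge V i' j' ->
  V i' j' = V i (nxt j) /\ V i' (nxt j') = V i j.
Proof.
move=> ii' e; have D := ccw_nxt j (Hccw i); have D' := ccw_nxt j' (Hccw i').
case: (segment_endpoints (cr_neq D) e) => [[e1 e2]|[]//].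
exfalso; rewrite /eA /eB in e1 e2; rewrite e1 e2 in D'.
have [q [q1 q2]] := overlap D D'.
have H : forall l, 0 < hh i l q.
  have [h1 h2 h3] := q1.
  move=> l; have [->|jl] := eqVneq l j; first exact: h1.
  rewrite eq_sym in jl; case: (nxt_cases jl) => ->; first exact: h2.
  by rewrite /hh nxt3.
have : tri V i' q by rewrite (triE j' (Hccw i')) e1 e2; exact: T3o_T3.
by move=> /(interior_unique H) e'; rewrite e' eqxx in ii'.
Qed.

Lemma shared_edge_nrm i i' j j' : i != i' -> edge V i j = edge V i' j' ->
  nrm V i' j' = (- (nrm V i j).1, - (nrm V i j).2).
Proof.
move=> ii' e; have [e1 e2] := shared_edge_rev ii' e.
by rewrite /nrm /eA /eB e1 e2 /=; congr pair; ring.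
Qed.

Lemma edge_inj i j k : edge V i j = edge V i k -> j = k.
Proof.
move=> e; apply/eqP; apply: contrapT => /negP jk.
have [a b] := edge_ends i j.
have [_ h1] := (edgeP j _ (Hccw i)).1 a.
move: a b; rewrite e => /(edgeP _ _ (Hccw i))[_ a] /(edgeP _ _ (Hccw i))[_ b].
have := ccw_nxt j (Hccw i).
case: (nxt_cases jk) => ek; subst k; move: a b; rewrite /hh ?nxt3 => a b.
  by rewrite -(cr_cycle (V i j)) a ltxx.
by rewrite -(cr_cycle (V i j)) -(cr_cycle (V i (nxt j))) b ltxx.
Qed.

(* A third triangle on the same edge would again reverse its orientation. *)
Lemma shared_edge_two i i' i'' j j' j'' : i != i' -> i' != i'' -> i != i'' ->
  edge V i j = edge V i' j' -> edge V i j = edge V i'' j'' -> False.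
Proof.
move=> a b c e1 e2; have [u1 u2] := shared_edge_rev a e1.
have [w1 w2] := shared_edge_rev c e2.
have [v1 v2] := shared_edge_rev b (etrans (esym e1) e2).
by apply: (cr_neq (ccw_nxt j (Hccw i))); rewrite -w2 v2 u1.
Qed.

Lemma shared_edge_nbhs i i' j j' z : i != i' -> edge V i j = edge V i' j' ->
  edge V i j z -> (forall i m, z <> V i m) -> nbhs z (tri V i `|` tri V i').
Proof.
move=> ii' e ez nv; have [e1 e2] := shared_edge_rev ii' e.
have pos k l : edge V k l z -> 0 < hh k (nxt l) z /\ 0 < hh k (nxt (nxt l)) z.
  move=> /(edgeP _ _ (Hccw k))[/(triP _ (Hccw k)) t h].
  have ne m : m != l -> 0 < hh k m z.
    move=> ml; rewrite lt_def t andbT; apply/eqP => hm.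
    by have [q] := corner (Hccw k) ml hm h; exact: nv.
  by split; apply: ne; elim/ord3P: (l); rewrite !(nxt0, nxt1, nxt2).
have [p1 p2] := pos _ _ ez; have ez' := ez; rewrite e in ez'.
have [p3 p4] := pos _ _ ez'.
rewrite (triE j (Hccw i)) (triE j' (Hccw i')) e1 e2.
have [_ h] := (edgeP j z (Hccw i)).1 ez.
apply: two_triangles_nbhs => //.
- by move: p2; rewrite /hh nxt3.
- by move: p3; rewrite /hh e2.
- by move: p4; rewrite /hh nxt3 e1.
Qed.

Local Notation U := [set x | exists i, tri V i x].

Lemma tri_closure i : tri V i `<=` closure (interior U).
Proof.
move=> x tx W nW.
pose G := centroid (V i 0) (V i 1) (V i 2).
have c0 : 0 < cr (V i 0) (V i 1) (V i 2) := Hccw i.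
have [g1 g2 g3] := T3o_centroid c0.
have HG j : 0 < hh i j G.
  by elim/ord3P: j; rewrite /hh !(nxt0, nxt1, nxt2).
have : nbhs (lerp x G 0) W by rewrite lerp0.
move=> /near_lerp /nbhs_ballP[e /= e0 be].
pose t := Num.min e 1 / 2.
have t0 : 0 < t by rewrite divr_gt0// lt_min e0 ltr01.
have : t < Num.min e 1 by rewrite ltr_pdivrMr// ltr_pMr ?ltr1n// lt_min e0 ltr01.
rewrite lt_min => /andP[te t1].
exists (lerp x G t); split; last first.
  by apply: be; rewrite /ball/= sub0r normrN gtr0_norm.
have : nbhs (lerp x G t) (tri V i).
  apply: nbhs_tri => // j; rewrite /hh cr_lerp.
  rewrite ltr_wpDl ?(mulr_gt0 t0 (HG j))//.
  by apply: mulr_ge0; [rewrite subr_ge0 ltW|exact: ((triP _ (Hccw i)).1 tx j)].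
by move=> N; apply: (@filterS _ (nbhs (lerp x G t)) _ (tri V i)) N => y ty; exists i.
Qed.

(** Suppose a point of the edge were interior to the union. A nearby point [x'] of the edge is still
    interior and no vertex, so triangle [i] is the only one containing it and would have to be a
    neighbourhood of it; yet points just beyond the edge are outside. *)
Lemma unshared_edge_bnd i j :
  (forall i' j', i != i' -> edge V i j <> edge V i' j') ->
  edge V i j `<=` bnd (interior U).
Proof.
move=> H x ex; have [tx hx] := (edgeP j x (Hccw i)).1 ex.
split; first exact: tri_closure tx.
move=> Ox.
have [ea eb] := edge_ends i j.
have [y ey xy] : exists2 y, edge V i j y & x <> y.
  have [e|] := pselect (x = V i j); last by exists (V i j).
  by exists (V i (nxt j)) => //; rewrite e; exact: cr_neq (ccw_nxt j (Hccw i)).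
have [ty hy] := (edgeP j y (Hccw i)).1 ey.
have oU : nbhs (lerp x y 0) (interior U).
  by rewrite lerp0; exact/open_nbhs_nbhs/(conj (@open_interior _ _) Ox).
have /nbhs_ballP[e /= e0 be] := near_lerp oU.
have m0 : 0 < Num.min e 1 by rewrite lt_min e0 ltr01.
have [t /andP[t0 tm] nvt] :=
  @avoid_points R ('I_n * 'I_3)%type (fun p => V p.1 p.2) x y _ m0 xy.
move: tm; rewrite lt_min => /andP[te t1].
set x' := lerp x y t in nvt.
have Ox' : nbhs x' U by apply: be; rewrite /ball/= sub0r normrN gtr0_norm.
have nv i0 m : x' <> V i0 m by exact: (nvt (i0, m)).
have hx' : hh i j x' = 0 by rewrite /hh cr_lerp -/(hh i j x) -/(hh i j y) hx hy; ring.
have tx' : tri V i x'.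
  apply/(triP _ (Hccw i)) => k; rewrite /hh cr_lerp.
  apply: addr_ge0; apply: mulr_ge0.
  - by rewrite subr_ge0 ltW.
  - exact: ((triP _ (Hccw i)).1 tx k).
  - exact: ltW.
  - exact: ((triP _ (Hccw i)).1 ty k).
have nt i' : i != i' -> ~ tri V i' x'.
  move=> ii' ti'; have [k [k' [e1 _ /(edgeP _ _ (Hccw i))[_ hk]]]] :=
    tri_common_edge ii' tx' ti' (nv i).
  have [kj|kj] := eqVneq k j; first by subst k; exact: (H _ _ ii' e1).
  by have [m] := corner (Hccw i) kj hk hx'; exact: nv.
have near_i : \forall z \near x', tri V i z.
  have : \forall z \near x', forall i', i != i' -> ~ tri V i' z.
    apply: (@filter_forall pt _ (fun i' z => i != i' -> ~ tri V i' z) (nbhs x')) => i'.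
    have [ii'|ii'] := eqVneq i i'.
      exact: nearW.
    by apply: filterS (nbhs_not_tri (Hccw i') (nt _ ii')) => z.
  move=> F; apply: filterS2 Ox' F => z [i' ti'] Hz.
  by have [->//|/Hz] := eqVneq i i'.
have : nbhs (lerp x' (V i (nxt (nxt j))) 0) (tri V i) by rewrite lerp0.
move=> /near_lerp /nbhs_ballP[r /= r0 br].
(* The negative parameter moves away from the opposite vertex, hence across the edge, where [hh i j]
   is negative. *)
have : tri V i (lerp x' (V i (nxt (nxt j))) (- (r / 2))).
  apply: br; rewrite /ball/= sub0r opprK gtr0_norm ?divr_gt0//.
  by rewrite ltr_pdivrMr// ltr_pMr// ltr1n.
move=> /(triP _ (Hccw i)) /(_ j); rewrite /hh cr_lerp -/(hh i j x') hx' mulr0 add0r.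
by rewrite leNgt mulNr oppr_lt0 mulr_gt0 ?divr_gt0 ?ccw_nxt.
Unshelve. all: by end_near. Qed.

(** The centroid [y] of triangle [i0] is interior, hence no vertex of the mesh, so [avoid_lines]
    applies. A vertex on the line through [y] and [x] would be a zero of [cr y x]. *)
Lemma generic_segment i0 A B C : 0 < cr A B C ->
  exists y x, [/\ forall j, 0 < hh i0 j y, T3o A B C x &
    forall t i m, lerp y x t <> V i m].
Proof.
move=> D0; have c0 : 0 < cr (V i0 0) (V i0 1) (V i0 2) := Hccw i0.
have [g1 g2 g3] := T3o_centroid c0.
set y := centroid _ _ _ in g1 g2 g3.
have Hy j : 0 < hh i0 j y by elim/ord3P: j; rewrite /hh !(nxt0, nxt1, nxt2).
have vy (p : 'I_n * 'I_3) : V p.1 p.2 <> y.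
  move=> e; have ty : tri V p.1 y.
    by rewrite -e; exact: ((edgeP _ _ (Hccw p.1)).1 (edge_ends p.1 p.2).1).1.
  have := interior_unique Hy ty => ei.
  have [j] := hh_vertex p.2 (Hccw p.1); rewrite e ei => h.
  by have := Hy j; rewrite h ltxx.
have [x Tx Hx] := avoid_lines D0 vy.
exists y, x; split=> // t i m e; have := Hx (i, m).
by rewrite /= -e cr_lerp crAA crBB !mulr0 addr0 eqxx.
Qed.

(* The status "lies in a triangle of S" is locally constant along a segment that
   avoids all vertices. *)
Lemma edge_connected (S : 'I_n -> Prop) : convex_set2 (interior U) ->
  (forall i i' j j', i != i' -> edge V i j = edge V i' j' -> S i -> S i') ->
  forall i0 i1, S i0 -> S i1.
Proof.
move=> cvx HS i0 i1 S0.
have c1 : 0 < cr (V i1 0) (V i1 1) (V i1 2) := Hccw i1.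
have [y [x [Hy [x1 x2 x3] nv]]] := generic_segment i0 c1.
have Hx j : 0 < hh i1 j x by elim/ord3P: j; rewrite /hh !(nxt0, nxt1, nxt2).
have ty : tri V i0 y by apply/(triP _ (Hccw i0)) => j; exact: ltW.
have intU i z : (forall j, 0 < hh i j z) -> interior U z.
  by move=> /(nbhs_tri (Hccw i)); apply: filterS => w tw; exists i.
(* Convexity enters here: every point of the segment is covered by some triangle. *)
have inU t : 0 <= t <= 1 -> U (lerp y x t).
  by move=> t01; apply: interior_subset; apply: cvx => //; exact: intU.
pose F t := exists2 i, S i & tri V i (lerp y x t).
have : F 1.
  apply: (@locally_constant_01 R F); last by exists i0; rewrite ?lerp0.
  move=> t t01.
  have same i i' : tri V i (lerp y x t) -> tri V i' (lerp y x t) -> S i -> S i'.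
    move=> a b Si; have [<-//|ii'] := eqVneq i i'.
    have [j [j' [e _ _]]] := tri_common_edge ii' a b (nv t i).
    exact: HS ii' e Si.
  have : \forall s \near t, forall i, ~ tri V i (lerp y x t) -> ~ tri V i (lerp y x s).
    apply: (@filter_forall R _ (fun i s => ~ tri V i (lerp y x t) ->
      ~ tri V i (lerp y x s)) (nbhs t)) => i.
    have [ti|ti] := pselect (tri V i (lerp y x t)).
      exact: nearW.
    by apply: filterS (near_lerp (nbhs_not_tri (Hccw i) ti)) => s Hs _.
  apply: filterS => s Hs s01.
  have back i : tri V i (lerp y x s) -> tri V i (lerp y x t).
    by move=> a; apply: contrapT => /Hs; exact.
  split=> [[i Si ti]|[i Si ti]]; first by exists i => //; exact: back.
  have [i' ti'] := inU s s01; exists i' => //.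
  exact: same ti (back _ ti') Si.
by move=> [i Si]; rewrite lerp1 => /(interior_unique Hx) <-.
Qed.

(* Otherwise a segment leaving the union of the triangles of S could only exit
   through a vertex. *)
Lemma no_closed_family (S : 'I_n -> Prop) :
  (forall i j, S i -> exists i' j', [/\ i != i', edge V i j = edge V i' j' & S i']) ->
  forall i0, ~ S i0.
Proof.
move=> HS i0 S0.
have /choice[M HM] : forall i, exists M : R, forall x, tri V i x -> `|x.1| <= M.
  move=> i.
  have [M HM] := T3_bounded (ccw_nxt 0 (Hccw i)).
  by exists M => x; rewrite (triE 0 (Hccw i)) => /HM[].
pose N := \sum_i `|M i|.
have MN i : M i <= N.
  rewrite /N (bigD1 i)//= (le_trans (ler_norm _))// lerDl; exact: sumr_ge0.
(* A target triangle to the right of the whole mesh, so that the generic segment certainly ends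
   outside. *)
have D1 : 0 < cr (N + 1, 0) (N + 2, 0) (N + 1, 1) by rewrite /cr/=; lra.
have [y [x [Hy [_ _ x3] nv]]] := generic_segment i0 D1.
have xN : N < x.1 by move: x3; rewrite /cr/=; lra.
have ty : tri V i0 y by apply/(triP _ (Hccw i0)) => j; exact: ltW.
pose F t := exists2 i, S i & tri V i (lerp y x t).
have : F 1.
  apply: (@locally_constant_01 R F); last by exists i0; rewrite ?lerp0.
  move=> t _.
  have [[i Si ti]|nF] := pselect (F t).
    have : \forall s \near t, F s.
      have [pos|] := pselect (forall j, 0 < hh i j (lerp y x t)).
        by apply: filterS (near_lerp (nbhs_tri (Hccw i) pos)) => s; exists i.
      move=> /existsNP[j /negP]; rewrite -leNgt => hj.
      have ej : edge V i j (lerp y x t).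
        apply/(edgeP _ _ (Hccw i)); split=> //; apply/eqP; rewrite eq_le hj.
        exact: ((triP _ (Hccw i)).1 ti j).
      (* The neighbour across the edge also belongs to [S], and the two triangles together cover a
         neighbourhood of the point. *)
      have [i' [j' [ii' e Si']]] := HS i j Si.
      have := near_lerp (shared_edge_nbhs ii' e ej (nv t)).
      by apply: filterS => s [] ts; [exists i|exists i'].
    by apply: filterS => s Fs _; split=> // _; exists i.
  have : \forall s \near t, forall i, S i -> ~ tri V i (lerp y x s).
    apply: (@filter_forall R _ (fun i s => S i -> ~ tri V i (lerp y x s)) (nbhs t)) => i.
    have [Si|nSi] := pselect (S i); last exact: nearW.
    have nti : ~ tri V i (lerp y x t) by move=> ti; apply: nF; exists i.
    by apply: filterS (near_lerp (nbhs_not_tri (Hccw i) nti)) => s Hs _.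
  apply: filterS => s Hs _; split=> [[i Si ti]|//].
  by case: (Hs i Si ti).
move=> [i _]; rewrite lerp1 => /HM; rewrite leNgt => /negP; apply.
rewrite (le_lt_trans (MN i))// (lt_le_trans xN)// ler_norm.
by [].
Qed.

End Triangulations.

(** * Solvability and the local weak gradient *)

Section FiniteDimensionalSolvability.
Variable F : fieldType.

(** Take a matrix of maximal rank whose row space lies in [P]; a vector of [P] outside that row
    space could be added and would raise the rank. *)
Lemma subspace_matrix N (P : 'rV[F]_N -> Prop) : P 0 ->
  (forall a x y, P x -> P y -> P (a *: x + y)) ->
  exists A : 'M[F]_N, forall x, P x <-> (x <= A)%MS.
Proof.
move=> P0 Plin.
pose Q r := exists2 A : 'M[F]_N, \rank A = r & forall x, (x <= A)%MS -> P x.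
have exQ : exists r, `[< Q r >].
  by exists 0%N; apply/asboolP; exists 0; [exact: mxrank0|move=> x; rewrite submx0 => /eqP ->].
have ubQ r : `[< Q r >] -> (r <= N)%N by move=> /asboolP[A <- _]; exact: rank_leq_row.
have [r /asboolP[A rA HA] maxr] := ex_maxnP exQ ubQ.
exists A => x; split=> [Px|]; last exact: HA.
apply: contrapT => /negP xA; pose B := (A + x)%MS.
have AB : (A < B)%MS.
  rewrite ltmxE addsmxSl; apply: contra xA => BA.
  exact: submx_trans (addsmxSr A x) BA.
have : (\rank B <= r)%N.
  apply: maxr; apply/asboolP; exists B => // y /sub_addsmxP[[u w] /= ->].
  rewrite addrC [w]mx11_scalar mul_scalar_mx; apply: Plin => //.
  by apply: HA; exact: submxMl.
by rewrite leqNgt -rA (rank_ltmx AB).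
Qed.

Section Solve.
Variables (N : nat) (P : 'rV[F]_N -> Prop).
Hypotheses (P0 : P 0) (Plin : forall a x y, P x -> P y -> P (a *: x + y)).

Definition linear_on (g : 'rV[F]_N -> F) :=
  forall a x y, P x -> P y -> g (a *: x + y) = a * g x + g y.

Lemma linear_on_mulmx g m (A : 'M[F]_(m, N)) (u : 'rV_m) : linear_on g ->
  (forall i, P (row i A)) ->
  P (u *m A) /\ g (u *m A) = \sum_i u 0 i * g (row i A).
Proof.
move=> gl PA; rewrite mulmx_sum_row.
have g0 : g 0 = 0.
  have := gl (- 1) 0 0 P0 P0; rewrite scaler0 addr0 mulN1r addNr; exact.
elim: (index_enum _) => [|i s [IH1 IH2]]; first by rewrite !big_nil.
by rewrite !big_cons; split; [exact: Plin|rewrite gl// IH2].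
Qed.

(* The right hand side has to vanish only on the right kernel of the form, so the
   coordinates need not be faithful. *)
Lemma solve_bilinear (B : 'rV[F]_N -> 'rV[F]_N -> F) (l : 'rV[F]_N -> F) :
  (forall y, P y -> linear_on (B ^~ y)) -> (forall x, P x -> linear_on (B x)) ->
  linear_on l ->
  (forall y, P y -> (forall x, P x -> B x y = 0) -> l y = 0) ->
  exists2 x, P x & forall y, P y -> B x y = l y.
Proof.
move=> Bl Br ll ker; have [A HA] := subspace_matrix P0 Plin.
have PA i : P (row i A) by apply/HA; exact: row_sub.
have comb x : P x -> exists u : 'rV_N, x = u *m A by move=> /HA /submxP.
pose M := \matrix_(i, j) B (row i A) (row j A).
pose b := \row_j l (row j A).
(* Fredholm alternative: each column of [cokermx M] yields a vector [y] of the right kernel of [B],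
   and [l] vanishes there. *)
have : (b <= M)%MS.
  rewrite submxE; apply/eqP/rowP => k; rewrite [RHS]mxE.
  pose y : 'rV[F]_N := (col k (cokermx M))^T.
  have yE j : y 0 j = cokermx M j k by rewrite !mxE.
  have [Py ly] := linear_on_mulmx y ll PA.
  rewrite mxE -[RHS](ker _ Py); last first.
    move=> x /comb[u ->]; have [_ ->] := linear_on_mulmx u (Bl _ Py) PA.
    rewrite big1// => i _; have [_ ->] := linear_on_mulmx y (Br _ (PA i)) PA.
    have E : \sum_j M i j * cokermx M j k = 0.
      by have := congr1 (fun X : 'M[F]_N => X i k) (mulmx_coker M); rewrite mxE [in RHS]mxE.
    rewrite (_ : \sum_j _ = 0) ?mulr0// -[RHS]E; apply: eq_bigr => j _.
    by rewrite yE mulrC; congr (_ * _); rewrite mxE.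
  by rewrite ly; apply: eq_bigr => j _; rewrite yE mxE mulrC.
move=> /submxP[x bE].
have [Px _] := linear_on_mulmx x ll PA.
exists (x *m A) => // y /comb[w ->].
have [_ ->] := linear_on_mulmx w (Br _ Px) PA.
have [_ ->] := linear_on_mulmx w ll PA.
apply: eq_bigr => j _; have [_ ->] := linear_on_mulmx x (Bl _ (PA j)) PA.
have := congr1 (fun X : 'rV[F]_N => X 0 j) bE; rewrite !mxE => ->.
by congr (_ * _); apply: eq_bigr => i _; rewrite mxE.
Qed.

End Solve.
End FiniteDimensionalSolvability.

(** * Polynomials on one triangle and on its edges *)

Section LocalTheory.
Variable R : realType.
Local Notation pt := (R * R)%type.
Implicit Types (A B C : pt) (c d : nat -> nat -> R).

Lemma poly2_lin m (a : R) c d x :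
  poly2 m (fun i j => a * c i j + d i j) x = a * poly2 m c x + poly2 m d x.
Proof.
rewrite /poly2 mulr_sumr -big_split; apply: eq_bigr => i _.
by rewrite mulr_sumr -big_split; apply: eq_bigr => j _ /=; ring.
Qed.

Lemma poly2_dx_lin m (a : R) c d x :
  poly2_dx m (fun i j => a * c i j + d i j) x = a * poly2_dx m c x + poly2_dx m d x.
Proof.
rewrite /poly2_dx mulr_sumr -big_split; apply: eq_bigr => i _.
by rewrite mulr_sumr -big_split; apply: eq_bigr => j _ /=; ring.
Qed.

Lemma poly2_dy_lin m (a : R) c d x :
  poly2_dy m (fun i j => a * c i j + d i j) x = a * poly2_dy m c x + poly2_dy m d x.
Proof.
rewrite /poly2_dy mulr_sumr -big_split; apply: eq_bigr => i _.
by rewrite mulr_sumr -big_split; apply: eq_bigr => j _ /=; ring.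
Qed.

Lemma eq_poly2 m c d : (forall i j, (i <= m)%N -> (j <= m)%N -> c i j = d i j) ->
  poly2 m c = poly2 m d.
Proof.
move=> cd; apply/funext => x; apply: eq_bigr => i _; apply: eq_bigr => j _.
by rewrite cd// -ltnS.
Qed.

Lemma poly2_0 m x : poly2 m (fun _ _ => 0 : R) x = 0.
Proof. by rewrite /poly2 big1// => i _; rewrite big1// => j _; rewrite !mul0r. Qed.

(** Riesz representation in the polynomials on [T], the source of weak gradients and divergences. A
    table orthogonal to all others has vanishing square integral, so its polynomial is zero on [T];
    the condition on [L] says that [L] depends only on that polynomial. *)
Lemma poly2_riesz A B C m (L : (nat -> nat -> R) -> R) : 0 < cr A B C ->
  let T := T3 A B C in
  (forall a c d, L (fun i j => a * c i j + d i j) = a * L c + L d) ->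
  (forall c, (forall x, T x -> poly2 m c x = 0) -> L c = 0) ->
  exists g, forall d, I2 T (fun x => poly2 m g x * poly2 m d x) = L d.
Proof.
move=> D0 T Llin L0.
pose cf (x : 'rV[R]_(m.+1 * m.+1)) (i j : nat) : R := vec_mx x (inord i) (inord j).
have cfl a x y : cf (a *: x + y) = (fun i j => a * cf x i j + cf y i j).
  by apply/funext => i; apply/funext => j; rewrite /cf linearP !mxE.
have bp c : bm T (poly2 m c) by exact: bm_pd D0 (pd_poly2 m c).
have lin c a d e : I2 T (fun x => (a * poly2 m d x + poly2 m e x) * poly2 m c x) =
    a * I2 T (fun x => poly2 m d x * poly2 m c x) + I2 T (fun x => poly2 m e x * poly2 m c x).
  rewrite -I2Z//; last exact: bmM.
  rewrite -I2D//; [|by apply: bmM; [exact: bm_cst|exact: bmM]|exact: bmM].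
  by apply: eq_I2 => x _; ring.
have I2C c d : I2 T (fun x => poly2 m c x * poly2 m d x) =
    I2 T (fun x => poly2 m d x * poly2 m c x) by apply: eq_I2 => x _; rewrite mulrC.
have [||||||x _ Hx] := @solve_bilinear R _ (fun _ : 'rV[R]_(m.+1 * m.+1) => True) _ _
  (fun x y => I2 T (fun z => poly2 m (cf x) z * poly2 m (cf y) z)) (fun x => L (cf x)).
- by [].
- by [].
- move=> y _ a u w _ _; rewrite cfl -lin.
  by apply: eq_I2 => z _; rewrite poly2_lin.
- move=> u _ a y w _ _; rewrite I2C cfl (I2C _ (cf y)) (I2C _ (cf w)) -lin.
  by apply: eq_I2 => z _; rewrite poly2_lin.
- by move=> a u w _ _; rewrite cfl Llin.
- move=> y _ /(_ y I) Hy; apply: L0.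
  have psq := pdM (pd_poly2 m (cf y)) (pd_poly2 m (cf y)).
  have sq0 : forall z, T z -> 0 <= poly2 m (cf y) z * poly2 m (cf y) z.
    by move=> z _; rewrite -expr2 sqr_ge0.
  move=> z Tz; have := I2_eq0 D0 psq sq0 Hy Tz.
  by move/eqP; rewrite mulf_eq0 orbb => /eqP.
exists (cf x) => d.
pose y : 'rV_(m.+1 * m.+1) := mxvec (\matrix_(i, j) d i j).
have E : poly2 m (cf y) = poly2 m d.
  apply: eq_poly2 => i j im jm; rewrite /cf /y mxvecK mxE.
  by rewrite !inordK.
have -> : L d = L (cf y).
  have : L (fun i j => (- 1) * cf y i j + d i j) = 0.
    by apply: L0 => z _; rewrite poly2_lin E; ring.
  by rewrite Llin => H; lra.
by rewrite -(Hx y I) E.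
Qed.

Lemma I01_eq (F G : R -> R) : (forall t, 0 <= t <= 1 -> F t = G t) -> I01 F = I01 G.
Proof. by move=> FG; apply: eq_Rintegral => t; rewrite inE/= in_itv/= => /FG. Qed.

(** Agreement is demanded on [0,1] alone, since the edge part of a weak function is prescribed only
    on its edge. *)
Definition poly_on01 (F : R -> R) :=
  exists p : {poly R}, forall t, 0 <= t <= 1 -> F t = p.[t].

Lemma I01_lin (a : R) (F G : R -> R) : poly_on01 F -> poly_on01 G ->
  I01 (fun t => a * F t + G t) = a * I01 F + I01 G.
Proof.
move=> [p Hp] [q Hq]; rewrite (I01_eq Hp) (I01_eq Hq).
rewrite (@I01_eq _ (fun t => (a *: p).[t] + q.[t])); last first.
  by move=> t t01; rewrite Hp// Hq// hornerZ.
rewrite /I01 RintegralD//; try exact: integrable_poly.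
congr (_ + _); rewrite -RintegralZl//; last exact: integrable_poly.
by apply: eq_Rintegral => t _; rewrite hornerZ.
Qed.

Lemma poly_on01M F G : poly_on01 F -> poly_on01 G -> poly_on01 (fun t => F t * G t).
Proof. by move=> [p Hp] [q Hq]; exists (p * q) => t t01; rewrite hornerM Hp// Hq. Qed.

Lemma poly_on01_poly1 k (c : nat -> R) : poly_on01 (poly1 k c).
Proof.
exists (\poly_(i < k.+1) c i) => t _; rewrite horner_poly.
by apply: eq_bigr => i _.
Qed.

Lemma poly_on01_lerp m g gx gy A B : pd m g gx gy -> poly_on01 (fun t => g (lerp A B t)).
Proof. by move=> /(pd_line A B)[p Hp]; exists p => t _; rewrite (Hp t).1. Qed.

Lemma T3_lerp A B C x y (t : R) : T3 A B C x -> T3 A B C y -> 0 <= t <= 1 ->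
  T3 A B C (lerp x y t).
Proof.
move=> [h1 h2 h3] [k1 k2 k3] /andP[t0 t1]; have u0 : 0 <= 1 - t by rewrite subr_ge0.
by split; rewrite cr_lerp; apply: addr_ge0; apply: mulr_ge0.
Qed.

(** Integrate the derivative along the segment from [x] to [y], which stays in the triangle where
    the gradient vanishes. *)
Lemma pd_const A B C m g gx gy x y : pd m g gx gy ->
  (forall z, T3 A B C z -> gx z = 0) -> (forall z, T3 A B C z -> gy z = 0) ->
  T3 A B C x -> T3 A B C y -> g x = g y.
Proof.
move=> pg gx0 gy0 Tx Ty; have [p Hp] := pd_line x y pg.
have : I01 (fun t => p^`().[t]) = 0.
  rewrite (@I01_eq _ (fun=> 0)); first by rewrite /I01 /Rintegral integral0.
  move=> t t01; have Tt := T3_lerp Tx Ty t01.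
  by rewrite (Hp t).2 gx0// gy0//; ring.
by rewrite I01_poly (Hp 1).1 (Hp 0).1 lerp0 lerp1 => /subr0_eq.
Qed.

Lemma divergence m g gx gy m' h hx hy A B C : pd m g gx gy -> pd m' h hx hy ->
  0 < cr A B C ->
  I2 (T3 A B C) (fun x => gx x + hy x) =
    I01 (fun t => g (lerp A B t) * (B.2 - A.2) + h (lerp A B t) * (A.1 - B.1)) +
    I01 (fun t => g (lerp B C t) * (C.2 - B.2) + h (lerp B C t) * (B.1 - C.1)) +
    I01 (fun t => g (lerp C A t) * (A.2 - C.2) + h (lerp C A t) * (C.1 - A.1)).
Proof.
move=> pg ph D0.
have [[? [? pgx]] _] := pd_deriv pg; have [_ [? [? phy]]] := pd_deriv ph.
rewrite I2D; [|exact: D0|exact: bm_pd pgx|exact: bm_pd phy].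
rewrite (I2_dx pg D0) (I2_dy ph D0).
have E P Q (a b : R) : I01 (fun t => g (lerp P Q t) * a + h (lerp P Q t) * b) =
    a * I01 (g \o lerp P Q) + b * I01 (h \o lerp P Q).
  have cst r : poly_on01 (fun=> r : R) by exists r%:P => t _; rewrite hornerC.
  have pb : poly_on01 (fun t => h (lerp P Q t) * b).
    by apply: poly_on01M; [exact: poly_on01_lerp ph|exact: cst].
  transitivity (I01 (fun t => a * g (lerp P Q t) + h (lerp P Q t) * b)).
    by apply: I01_eq => t _; rewrite mulrC.
  rewrite I01_lin//; last exact: poly_on01_lerp pg.
  congr (_ + _); transitivity (I01 (fun t => b * h (lerp P Q t) + 0)).
    by apply: I01_eq => t _; rewrite addr0 mulrC.
  rewrite I01_lin//; last exact: poly_on01_lerp ph.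
  by rewrite {2}/I01 /Rintegral integral0 addr0.
rewrite !E; ring.
Qed.

(** * Kernel of the weak gradient on one triangle *)

Section WeakGradientKernel.
Variables (k : nat) (A B C : pt) (v0 vx vy : pt -> R) (m1 m2 m3 : R -> R).
Hypotheses (D0 : 0 < cr A B C) (pv : pd k v0 vx vy).
Local Notation T := (T3 A B C).

(* The weak gradient vanishes: v0 is the interior part, and m1, m2, m3 are the edge
   parts in the affine parameter of AB, BC, CA. *)
Definition wg_kernel (A B C : pt) (m1 m2 m3 : R -> R) :=
  forall q1 q1x q1y q2 q2x q2y, pd k.+1 q1 q1x q1y -> pd k.+1 q2 q2x q2y ->
  I2 (T3 A B C) (fun x => v0 x * (q1x x + q2y x)) =
    I01 (fun t => m1 t * (q1 (lerp A B t) * (B.2 - A.2) + q2 (lerp A B t) * (A.1 - B.1))) +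
    I01 (fun t => m2 t * (q1 (lerp B C t) * (C.2 - B.2) + q2 (lerp B C t) * (B.1 - C.1))) +
    I01 (fun t => m3 t * (q1 (lerp C A t) * (A.2 - C.2) + q2 (lerp C A t) * (C.1 - A.1))).

Lemma wg_kernel_cycle : wg_kernel A B C m1 m2 m3 -> wg_kernel B C A m2 m3 m1.
Proof.
move=> H q1 q1x q1y q2 q2x q2y p1 p2; rewrite (T3_cycle A B C) (H _ _ _ _ _ _ p1 p2).
ring.
Qed.

Hypothesis H : wg_kernel A B C m1 m2 m3.

(* Test with q = h_BC h_CA (tau . grad v0) tau, tau = B - A: its normal component
   vanishes on all three edges. *)
Lemma tangential_derivative0 x : T x ->
  vx x * (B.1 - A.1) + vy x * (B.2 - A.2) = 0.
Proof.
case: (posnP k) => [k0|k0].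
  by move: pv; rewrite k0 => /pd_deg0[-> ->] _; ring.
have [[vxx [vxy pvx]] [vyx [vyy pvy]]] := pd_deriv pv.
pose tx := B.1 - A.1; pose ty := B.2 - A.2.
have pt1 : pd k.-1 (fun x => vx x * tx + vy x * ty) (fun x => vxx x * tx + vyx x * ty)
    (fun x => vxy x * tx + vyy x * ty).
  by apply: (pd_eq (pdD (pdZ tx pvx) (pdZ ty pvy))) => y; rewrite !(mulrC _ tx) !(mulrC _ ty).
have pb := pdM (pd_cr B C) (pd_cr C A).
have := pdM pb pt1; set s := fun x => vx x * tx + vy x * ty.
(* The degree count that admits this test field; it uses [k > 0]. *)
rewrite (_ : (1 + 1 + k.-1 = k.+1)%N); last by rewrite add2n prednK.
set q := fun x => cr B C x * cr C A x * s x; set qx := fun x => _ + _; set qy := fun x => _ + _.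
move=> pq.
have pq1 : pd k.+1 (fun x => tx * q x) (fun x => tx * qx x) (fun x => tx * qy x) := pdZ tx pq.
have pq2 : pd k.+1 (fun x => ty * q x) (fun x => ty * qx x) (fun x => ty * qy x) := pdZ ty pq.
have z1 t : q (lerp B C t) = 0 by rewrite /q !cr_lerp !crAA !crBB; ring.
have z2 t : q (lerp C A t) = 0 by rewrite /q !cr_lerp !crAA !crBB; ring.
have K1 := H pq1 pq2.
have K2 := divergence (pdM pv pq1) (pdM pv pq2) D0.
have I0 : I01 (fun=> 0 : R) = 0 by rewrite /I01 /Rintegral integral0.
have K1' : I2 T (fun x => v0 x * (tx * qx x + ty * qy x)) = 0.
  rewrite K1 !(@I01_eq _ (fun=> 0)) ?I0 ?addr0// => t _; rewrite ?z1 ?z2; try ring.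
  by rewrite /tx /ty; ring.
have K2' : I2 T (fun x => (vx x * (tx * q x) + v0 x * (tx * qx x)) +
    (vy x * (ty * q x) + v0 x * (ty * qy x))) = 0.
  rewrite K2 !(@I01_eq _ (fun=> 0)) ?I0 ?addr0// => t _; rewrite ?z1 ?z2; try ring.
  by rewrite /tx /ty; ring.
have b0 : bm T v0 := bm_pd D0 pv.
have bq : bm T q := bm_pd D0 pq.
have [[? [? /(bm_pd D0) bqx]] [? [? /(bm_pd D0) bqy]]] := pd_deriv pq.
have bs : bm T s := bm_pd D0 pt1.
have bC r : bm T (fun=> r) := bm_cst T r.
(* The divergence of [v0 q] integrates to zero and so does [v0] times the divergence of [q]; their
   difference is the integral of [grad v0 . q]. *)
have K3 : I2 T (fun x => cr B C x * cr C A x * s x * s x) = 0.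
  have : I2 T (fun x => cr B C x * cr C A x * s x * s x +
      v0 x * (tx * qx x + ty * qy x)) = 0.
    by rewrite -[RHS]K2'; apply: eq_I2 => y _; rewrite /q /s; ring.
  rewrite I2D ?K1' ?addr0//; first exact: bmM bq bs.
  by apply: bmM => //; apply: bmD; apply: bmM.
have pG := pdM pq pt1.
have G0 y : T y -> 0 <= q y * s y.
  move=> [_ h2 h3]; rewrite /q -mulrA -expr2.
  by apply: mulr_ge0; [exact: mulr_ge0|exact: sqr_ge0].
have Z := I2_eq0 D0 pG G0 K3.
apply: (pd_eq0_T3 D0 pt1) => y h1 h2 h3.
have := Z y (And3 (ltW h1) (ltW h2) (ltW h3)); move/eqP.
rewrite /q !mulf_eq0 (gt_eqF h2) (gt_eqF h3)/= orbb => /eqP; exact.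
Qed.

(* Test with q = l_A r (C - A) + l_B s (C - B), where l_A, l_B are barycentric
   coordinates and mu = (1 - t) r + t s is the jump on the edge AB. *)
Lemma edge_jump0 (c0 : R) (c : nat -> R) :
  (forall x, T x -> v0 x = c0) -> (forall t, 0 <= t <= 1 -> m1 t = poly1 k.+1 c t) ->
  forall t, 0 <= t <= 1 -> m1 t = c0.
Proof.
move=> vc Hm.
pose D := cr A B C; have Dn : D != 0 := lt0r_neq0 D0.
pose lA x := D^-1 * cr B C x; pose lB x := D^-1 * cr C A x.
have plA := pdZ D^-1 (pd_cr B C); have plB := pdZ D^-1 (pd_cr C A).
pose e l : R := c l - (if l == 0%N then c0 else 0).
(* With [e] the coefficients of the jump, write it as [(1 - t) * e 0 + t * s(t)], where [s] is the
   sum of [e 0] and the [e l.+1 * t ^ l]. Thus [r] is the constant [e 0] and [s] has degree [k],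
   which leaves room for the factor [lB]. *)
have [sx [sy ps]] : exists sx sy, pd k (fun x => e 0%N +
    \sum_(l < k.+1) e l.+1 * lB x ^+ l) sx sy.
  have /choice[f Hf] : forall l : nat, exists f : (pt -> R) * (pt -> R),
      (l <= k)%N -> pd k (fun x => e l.+1 * lB x ^+ l) f.1 f.2.
    move=> l; have [hx [hy ph]] := pdX l plB.
    exists (fun x => e l.+1 * hx x, fun x => e l.+1 * hy x) => lk /=.
    by apply: pdZ; apply: pd_leq ph; rewrite muln1.
  do 2!eexists; apply: pdD; first exact: pd_cst.
  by apply: pd_sum => l _; apply: Hf; rewrite -ltnS.
set s := fun x => _ in ps.
pose q1 x := (C.1 - A.1) * (e 0%N * lA x) + (C.1 - B.1) * (lB x * s x).
pose q2 x := (C.2 - A.2) * (e 0%N * lA x) + (C.2 - B.2) * (lB x * s x).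
have pA := pd_leq (ltn0Sn k) (pdZ (e 0%N) plA).
have pB := pdM plB ps; rewrite add1n in pB.
have [q1x [q1y pq1]] : exists q1x q1y, pd k.+1 q1 q1x q1y.
  by do 2!eexists; exact: (pdD (pdZ (C.1 - A.1) pA) (pdZ (C.1 - B.1) pB)).
have [q2x [q2y pq2]] : exists q2x q2y, pd k.+1 q2 q2x q2y.
  by do 2!eexists; exact: (pdD (pdZ (C.2 - A.2) pA) (pdZ (C.2 - B.2) pB)).
have K1 := H pq1 pq2; have K2 := divergence pq1 pq2 D0.
have lAB t : lA (lerp A B t) = 1 - t.
  by rewrite /lA cr_lerp (cr_cycle A B C) crAA -/D; field.
have lBB t : lB (lerp A B t) = t.
  have eD : cr C A B = D by rewrite (cr_cycle B C A) cr_cycle.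
  by rewrite /lB cr_lerp crBB eD; field.
pose mu : {poly R} := \poly_(l < k.+2) e l.
have muE t : mu.[t] = (1 - t) * e 0%N + t * s (lerp A B t).
  have -> : t * s (lerp A B t) = t * e 0%N + \sum_(i < k.+1) t * (e i.+1 * t ^+ i).
    by rewrite /s lBB [t * (_ + _)]mulrDr [t * \sum_(_ < _) _]mulr_sumr.
  rewrite /mu horner_poly big_ord_recl/= expr0 mulr1.
  have -> : \sum_(i < k.+1) e (bump 0 i) * t ^+ bump 0 i =
      \sum_(i < k.+1) t * (e i.+1 * t ^+ i).
    by apply: eq_bigr => i _; rewrite /bump/= add1n exprS; ring.
  ring.
have mmu t : 0 <= t <= 1 -> m1 t = c0 + mu.[t].
  move=> t01; rewrite Hm// /poly1 /mu horner_poly; apply/eqP.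
  rewrite -subr_eq -sumrB big_ord_recl big1 ?addr0 => [|i _].
    by rewrite /e eqxx !expr0; apply/eqP; ring.
  by rewrite /e lift0 subr0 subrr.
have lBC t : lA (lerp B C t) = 0 by rewrite /lA cr_lerp crAA crBB; ring.
have lCA t : lB (lerp C A t) = 0 by rewrite /lB cr_lerp crAA crBB; ring.
(* On [AB] both [C - A] and [C - B] have scaled normal component [- D]. On each of the other edges
   one barycentric factor vanishes and the remaining direction is tangent. *)
have n1 t : q1 (lerp A B t) * (B.2 - A.2) + q2 (lerp A B t) * (A.1 - B.1) = - D * mu.[t].
  by rewrite muE /q1 /q2 lAB lBB /D /cr; ring.
have n2 t : q1 (lerp B C t) * (C.2 - B.2) + q2 (lerp B C t) * (B.1 - C.1) = 0.
  by rewrite /q1 /q2 lBC; ring.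
have n3 t : q1 (lerp C A t) * (A.2 - C.2) + q2 (lerp C A t) * (C.1 - A.1) = 0.
  by rewrite /q1 /q2 lCA; ring.
have I0 : I01 (fun=> 0 : R) = 0 by rewrite /I01 /Rintegral integral0.
have K1' : I2 T (fun x => v0 x * (q1x x + q2y x)) =
    I01 (fun t => - D * ((c0 + mu.[t]) * mu.[t])).
  rewrite K1 -[RHS]addr0 -[RHS]addr0; congr (_ + _ + _).
  - by apply: I01_eq => t t01; rewrite n1 mmu//; ring.
  - by rewrite -[RHS]I0; apply: I01_eq => t _; rewrite n2 mulr0.
  - by rewrite -[RHS]I0; apply: I01_eq => t _; rewrite n3 mulr0.
have K2' : I2 T (fun x => q1x x + q2y x) = I01 (fun t => - D * mu.[t] + 0).
  rewrite K2 -[RHS]addr0 -[RHS]addr0; congr (_ + _ + _).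
  - by apply: I01_eq => t t01; rewrite n1 addr0.
  - by rewrite -[RHS]I0; apply: I01_eq => t _; rewrite n2.
  - by rewrite -[RHS]I0; apply: I01_eq => t _; rewrite n3.
have [[? [? /(bm_pd D0) b1]] _] := pd_deriv pq1.
have [_ [? [? /(bm_pd D0) b2]]] := pd_deriv pq2.
have K3 : I2 T (fun x => v0 x * (q1x x + q2y x)) = c0 * I2 T (fun x => q1x x + q2y x).
  rewrite -I2Z//; last exact: bmD.
  by apply: eq_I2 => x Tx; rewrite vc.
have pc r : poly_on01 (fun=> r : R) by exists r%:P => t _; rewrite hornerC.
have pmu : poly_on01 (horner mu) by exists mu.
have pmu2 : poly_on01 (fun t => mu.[t] ^+ 2).
  by exists (mu ^+ 2) => t _; rewrite horner_exp.
have K4 : I01 (fun t => - D * ((c0 + mu.[t]) * mu.[t])) =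
    - D * I01 (fun t => mu.[t] ^+ 2) + (- D * c0 * I01 (horner mu) + 0).
  rewrite -[in RHS]I0 -(I01_lin _ pmu (pc 0)) -I01_lin//.
    by apply: I01_eq => t _; ring.
  exists ((- D * c0) *: mu) => t _; by rewrite hornerZ addr0.
(* The kernel identity yields the edge integral of [(c0 + mu) * mu], the divergence theorem that of
   [c0 * mu], both times [- D]; subtraction leaves [mu ^ 2]. *)
have : I01 (fun t => mu.[t] ^+ 2) = 0.
  apply: (mulfI Dn); move: K3; rewrite K1' K2' K4 (I01_lin _ pmu (pc 0)) I0; lra.
by move=> /I01_sq_eq0 mu0 t t01; rewrite mmu// mu0 horner0 addr0.
Qed.

End WeakGradientKernel.
End LocalTheory.

(** * Weak operators *)

Section WeakOperators.
Variables (R : realType) (k n : nat).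
Local Notation pt := (R * R)%type.
Variable V : 'I_n -> 'I_3 -> pt.
Implicit Types (v u w : wfun R n) (d c : nat -> nat -> R).

Definition wcomb (a : R) u v : wfun R n :=
  (fun i x => a * u.1 i x + v.1 i x, fun i j x => a * u.2 i j x + v.2 i j x).

(** The local half of [in_Sh0], without matching across edges or boundary values: enough for weak
    operators on a single triangle. *)
Definition pw v : Prop :=
  (forall i, exists c, forall x, tri V i x -> v.1 i x = poly2 k c x) /\
  (forall i j, exists c : nat -> R, forall t, 0 <= t <= 1 ->
    v.2 i j (lerp (eA V i j) (eB V i j) t) = poly1 k.+1 c t).

Lemma poly1_lin m (a : R) (c d : nat -> R) t :
  poly1 m (fun l => a * c l + d l) t = a * poly1 m c t + poly1 m d t.
Proof.
rewrite /poly1 mulr_sumr -big_split; apply: eq_bigr => l _ /=; ring.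
Qed.

Lemma pw_comb a u v : pw u -> pw v -> pw (wcomb a u v).
Proof.
move=> [u1 u2] [v1 v2]; split=> [i|i j].
  have [c Hc] := u1 i; have [d Hd] := v1 i.
  by exists (fun r s => a * c r s + d r s) => x tx; rewrite poly2_lin /= Hc// Hd.
have [c Hc] := u2 i j; have [d Hd] := v2 i j.
by exists (fun l => a * c l + d l) => t t01; rewrite poly1_lin /= Hc// Hd.
Qed.

(** A pressure has degree [k], whereas the weak divergence is tested with tables of degree
    [k + 1]. *)
Lemma poly2_raise m c : exists c' : nat -> nat -> R, [/\ poly2 m.+1 c' = poly2 m c,
  poly2_dx m.+1 c' = poly2_dx m c & poly2_dy m.+1 c' = poly2_dy m c].
Proof. by have [c' [-> -> ->]] := pdP (pd_leq (leqnSn m) (pd_poly2 m c)); exists c'. Qed.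

Lemma I01_lin2 (a b : R) F G : poly_on01 F -> poly_on01 G ->
  I01 (fun t => a * F t + b * G t) = a * I01 F + b * I01 G.
Proof.
move=> pF pG; rewrite I01_lin//; last first.
  by apply: poly_on01M => //; exists b%:P => t _; rewrite hornerC.
congr (_ + _); have p0 : poly_on01 (fun=> 0 : R) by exists 0 => t _; rewrite horner0.
transitivity (I01 (fun t => b * G t + 0)); first by apply: I01_eq => t _; rewrite addr0.
by rewrite I01_lin// {2}/I01 /Rintegral integral0 addr0.
Qed.

(* Integration by parts in one direction: D is a partial derivative and nu the
   corresponding component of the normals. *)
Definition Lw (D : (nat -> nat -> R) -> pt -> R) (nu : 'I_3 -> R) v i d : R :=
  - I2 (tri V i) (fun x => v.1 i x * D d x) +
  \sum_(j < 3) nu j * eint V i j (fun x => v.2 i j x * poly2 k.+1 d x).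

Definition Ldx v i := Lw (poly2_dx k.+1) (fun j => (nrm V i j).1) v i.
Definition Ldy v i := Lw (poly2_dy k.+1) (fun j => (nrm V i j).2) v i.

Section OneTriangle.
Variable i : 'I_n.
Hypothesis Hc : ccw V i.
Local Notation T := (tri V i).

Let c0 : 0 < cr (V i 0) (V i 1) (V i 2) := Hc.
Let TE : T = T3 (V i 0) (V i 1) (V i 2).
Proof. by rewrite (triE 0 Hc) nxt0 nxt1. Qed.

Lemma bmt m g gx gy : pd m g gx gy -> bm T g.
Proof. by rewrite TE; exact: bm_pd. Qed.

Lemma bm_poly2 m c : bm T (poly2 m c).
Proof. exact: bmt (pd_poly2 m c). Qed.

Lemma bm_dx m c : bm T (poly2_dx m c).
Proof. by have [[? [? /bmt]]] := pd_deriv (pd_poly2 m c). Qed.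

Lemma bm_dy m c : bm T (poly2_dy m c).
Proof. by have [_ [? [? /bmt]]] := pd_deriv (pd_poly2 m c). Qed.

Lemma I2tD g h : bm T g -> bm T h -> I2 T (fun x => g x + h x) = I2 T g + I2 T h.
Proof. by rewrite TE; exact: I2D. Qed.

Lemma I2tZ r g : bm T g -> I2 T (fun x => r * g x) = r * I2 T g.
Proof. by rewrite TE; exact: I2Z. Qed.

Lemma I2t_lin r g h : bm T g -> bm T h ->
  I2 T (fun x => r * g x + h x) = r * I2 T g + I2 T h.
Proof. by move=> bg bh; rewrite I2tD ?I2tZ//; apply: bmM => //; exact: bm_cst. Qed.

Lemma bm_pw v : pw v -> bm T (v.1 i).
Proof.
move=> [/(_ i)[c H] _]; apply: bm_eq (bm_poly2 k c) => x Tx.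
by rewrite H.
Qed.

Lemma on01_pw v j : pw v -> poly_on01 (fun t => v.2 i j (lerp (eA V i j) (eB V i j) t)).
Proof.
move=> [_ /(_ i j)[c H]]; have [p Hp] := @poly_on01_poly1 R k.+1 c.
by exists p => t t01; rewrite H// Hp.
Qed.

Lemma on01_poly2 j m c : poly_on01 (fun t => poly2 m c (lerp (eA V i j) (eB V i j) t)).
Proof. exact: poly_on01_lerp (pd_poly2 m c). Qed.

Lemma eint_comb j (a b : R) F G :
  poly_on01 (fun t => F (lerp (eA V i j) (eB V i j) t)) ->
  poly_on01 (fun t => G (lerp (eA V i j) (eB V i j) t)) ->
  eint V i j (fun x => a * F x + b * G x) = a * eint V i j F + b * eint V i j G.
Proof. by move=> pF pG; exact: (I01_lin2 a b pF pG). Qed.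

Lemma eint_lin j (a : R) F G :
  poly_on01 (fun t => F (lerp (eA V i j) (eB V i j) t)) ->
  poly_on01 (fun t => G (lerp (eA V i j) (eB V i j) t)) ->
  eint V i j (fun x => a * F x + G x) = a * eint V i j F + eint V i j G.
Proof. by move=> pF pG; exact: (I01_lin a pF pG). Qed.

Lemma eq_eint j F G : (forall x, edge V i j x -> F x = G x) ->
  eint V i j F = eint V i j G.
Proof.
by move=> FG; apply: I01_eq => t t01; apply: FG; exists t => //; rewrite /= in_itv.
Qed.

Section Direction.
Variables (D : (nat -> nat -> R) -> pt -> R) (nu : 'I_3 -> R).
Hypotheses
  (Dl : forall a c d x, D (fun i j => a * c i j + d i j) x = a * D c x + D d x)
  (Db : forall c, bm T (D c))
  (D0 : forall c, (forall x, T x -> poly2 k.+1 c x = 0) -> forall x, T x -> D c x = 0).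

Lemma Lw_lin_fun a u v d : pw u -> pw v ->
  Lw D nu (wcomb a u v) i d = a * Lw D nu u i d + Lw D nu v i d.
Proof.
move=> pu pv; rewrite /Lw /=.
have -> : I2 T (fun x => (a * u.1 i x + v.1 i x) * D d x) =
    a * I2 T (fun x => u.1 i x * D d x) + I2 T (fun x => v.1 i x * D d x).
  rewrite -I2t_lin; [|by apply: bmM => //; exact: bm_pw..].
  by apply: eq_I2 => x _; ring.
rewrite mulrDr mulr_sumr opprD mulrN addrACA -big_split; congr (_ + _).
apply: eq_bigr => j _ /=.
rewrite -(mulrCA (nu j)) -mulrDr -eint_lin.
- by congr (_ * _); apply: eq_eint => x _; ring.
- by apply: poly_on01M; [exact: on01_pw|exact: on01_poly2].
- by apply: poly_on01M; [exact: on01_pw|exact: on01_poly2].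
Qed.

Lemma Lw_lin_test v a c d : pw v ->
  Lw D nu v i (fun i j => a * c i j + d i j) = a * Lw D nu v i c + Lw D nu v i d.
Proof.
move=> pv; rewrite /Lw /=.
have -> : I2 T (fun x => v.1 i x * D (fun i j => a * c i j + d i j) x) =
    a * I2 T (fun x => v.1 i x * D c x) + I2 T (fun x => v.1 i x * D d x).
  rewrite -I2t_lin; [|by apply: bmM => //; exact: bm_pw..].
  by apply: eq_I2 => x _; rewrite Dl; ring.
rewrite mulrDr mulr_sumr opprD mulrN addrACA -big_split; congr (_ + _).
apply: eq_bigr => j _ /=.
rewrite -(mulrCA (nu j)) -mulrDr -eint_lin.
- by congr (_ * _); apply: eq_eint => x _; rewrite poly2_lin; ring.
- by apply: poly_on01M; [exact: on01_pw|exact: on01_poly2].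
- by apply: poly_on01M; [exact: on01_pw|exact: on01_poly2].
Qed.

(** A polynomial that is zero on the triangle has zero derivatives and zero traces there, so the
    functional depends on the polynomial and not on its table, as [poly2_riesz] requires. *)
Lemma Lw_eq0 v d : (forall x, T x -> poly2 k.+1 d x = 0) -> Lw D nu v i d = 0.
Proof.
move=> d0; rewrite /Lw (eq_I2 (h := fun=> 0)) => [|x Tx]; last by rewrite (D0 d0)// mulr0.
rewrite I2_cst0 oppr0 add0r big1// => j _.
rewrite (@eq_eint j _ (fun=> 0)) => [|x /(edgeP _ _ Hc)[Tx _]]; last by rewrite d0// mulr0.
by rewrite /eint /I01 /Rintegral integral0 mulr0.
Qed.

Lemma Lw_interior v d : (forall j x, edge V i j x -> v.2 i j x = 0) ->
  Lw D nu v i d = - I2 T (fun x => v.1 i x * D d x).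
Proof.
move=> v0; rewrite /Lw big1 ?addr0// => j _.
rewrite (@eq_eint j _ (fun=> 0)) => [|x ex]; last by rewrite v0// mul0r.
by rewrite /eint /I01 /Rintegral integral0 mulr0.
Qed.

Lemma Lw_boundary v d : (forall x, T x -> v.1 i x = 0) ->
  Lw D nu v i d = \sum_(j < 3) nu j * eint V i j (fun x => v.2 i j x * poly2 k.+1 d x).
Proof.
move=> v0; rewrite /Lw (eq_I2 (h := fun=> 0)) => [|x Tx]; last by rewrite v0// mul0r.
by rewrite I2_cst0 oppr0 add0r.
Qed.

Lemma Lw_riesz v : pw v -> exists g, forall d,
  I2 T (fun x => poly2 k.+1 g x * poly2 k.+1 d x) = Lw D nu v i d.
Proof.
move=> pv; rewrite TE; apply: poly2_riesz => // [a c d|c Hc0].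
  exact: Lw_lin_test.
by apply: Lw_eq0; rewrite TE.
Qed.

End Direction.

Lemma dx_eq0 c : (forall x, T x -> poly2 k.+1 c x = 0) ->
  forall x, T x -> poly2_dx k.+1 c x = 0.
Proof.
by rewrite TE => H x Tx; have [] := pd_eq0_deriv c0 (pd_poly2 k.+1 c) H Tx.
Qed.

Lemma dy_eq0 c : (forall x, T x -> poly2 k.+1 c x = 0) ->
  forall x, T x -> poly2_dy k.+1 c x = 0.
Proof.
by rewrite TE => H x Tx; have [] := pd_eq0_deriv c0 (pd_poly2 k.+1 c) H Tx.
Qed.

Lemma Ldx_lin a u v d : pw u -> pw v ->
  Ldx (wcomb a u v) i d = a * Ldx u i d + Ldx v i d.
Proof. by apply: Lw_lin_fun => c; exact: bm_dx. Qed.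

Lemma Ldy_lin a u v d : pw u -> pw v ->
  Ldy (wcomb a u v) i d = a * Ldy u i d + Ldy v i d.
Proof. by apply: Lw_lin_fun => c; exact: bm_dy. Qed.

Lemma wgrad_rhs v d1 d2 : pw v ->
  - I2 T (fun x => v.1 i x * (poly2_dx k.+1 d1 x + poly2_dy k.+1 d2 x))
    + \sum_(j < 3) eint V i j (fun x => v.2 i j x *
         (poly2 k.+1 d1 x * (nrm V i j).1 + poly2 k.+1 d2 x * (nrm V i j).2)) =
  Ldx v i d1 + Ldy v i d2.
Proof.
move=> pv; rewrite /Ldx /Ldy /Lw.
have -> : I2 T (fun x => v.1 i x * (poly2_dx k.+1 d1 x + poly2_dy k.+1 d2 x)) =
   I2 T (fun x => v.1 i x * poly2_dx k.+1 d1 x) +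
   I2 T (fun x => v.1 i x * poly2_dy k.+1 d2 x).
  rewrite -I2tD; [|by apply: bmM; [exact: bm_pw|exact: bm_dx]|
    by apply: bmM; [exact: bm_pw|exact: bm_dy]].
  by apply: eq_I2 => x _; ring.
rewrite opprD [RHS]addrACA -big_split; congr (_ + _); apply: eq_bigr => j _ /=.
rewrite -eint_comb.
- by apply: eq_eint => x _; ring.
- by apply: poly_on01M; [exact: on01_pw|exact: on01_poly2].
- by apply: poly_on01M; [exact: on01_pw|exact: on01_poly2].
Qed.

Lemma wdiv_rhs (v : wfun R n * wfun R n) d : pw v.1 -> pw v.2 ->
  - I2 T (fun x => v.1.1 i x * poly2_dx k.+1 d x + v.2.1 i x * poly2_dy k.+1 d x)
    + \sum_(j < 3) eint V i j (fun x =>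
        (v.1.2 i j x * (nrm V i j).1 + v.2.2 i j x * (nrm V i j).2) * poly2 k.+1 d x) =
  Ldx v.1 i d + Ldy v.2 i d.
Proof.
move=> pv1 pv2; rewrite /Ldx /Ldy /Lw I2tD; [|by apply: bmM; [exact: bm_pw|exact: bm_dx]|
    by apply: bmM; [exact: bm_pw|exact: bm_dy]].
rewrite opprD [RHS]addrACA -big_split; congr (_ + _); apply: eq_bigr => j _ /=.
rewrite -eint_comb.
- by apply: eq_eint => x _; ring.
- by apply: poly_on01M; [exact: on01_pw|exact: on01_poly2].
- by apply: poly_on01M; [exact: on01_pw|exact: on01_poly2].
Qed.

Lemma Ldx_riesz v : pw v -> exists g, forall d,
  I2 T (fun x => poly2 k.+1 g x * poly2 k.+1 d x) = Ldx v i d.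
Proof. by apply: Lw_riesz; [exact: poly2_dx_lin|exact: bm_dx|exact: dx_eq0]. Qed.

Lemma Ldy_riesz v : pw v -> exists g, forall d,
  I2 T (fun x => poly2 k.+1 g x * poly2 k.+1 d x) = Ldy v i d.
Proof. by apply: Lw_riesz; [exact: poly2_dy_lin|exact: bm_dy|exact: dy_eq0]. Qed.

Lemma Ldx0 v : Ldx v i (fun _ _ => 0) = 0.
Proof. by apply: Lw_eq0; [exact: dx_eq0|move=> x _; exact: poly2_0]. Qed.

Lemma Ldy0 v : Ldy v i (fun _ _ => 0) = 0.
Proof. by apply: Lw_eq0; [exact: dy_eq0|move=> x _; exact: poly2_0]. Qed.

Lemma wgradP v d : pw v ->
  I2 T (fun x => (wgrad k V v i x).1 * poly2 k.+1 d x) = Ldx v i d /\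
  I2 T (fun x => (wgrad k V v i x).2 * poly2 k.+1 d x) = Ldy v i d.
Proof.
move=> pv; have [gx Hx] := Ldx_riesz pv; have [gy Hy] := Ldy_riesz pv.
have S : wgrad_spec k V v i (gx, gy).
  move=> e; rewrite wgrad_rhs// -Hx -Hy I2tD//; by apply: bmM; exact: bm_poly2.
have := getPex (P := [set g | wgrad_spec k V v i g]) (ex_intro _ (gx, gy) S).
rewrite /wgrad; set g := get _ => /= Hg; split.
  have := Hg (d, fun _ _ => 0); rewrite wgrad_rhs// Ldy0 addr0 => <-.
  by apply: eq_I2 => x _ /=; rewrite poly2_0 mulr0 addr0.
have := Hg (fun _ _ => 0, d); rewrite wgrad_rhs// Ldx0 add0r => <-.
by apply: eq_I2 => x _ /=; rewrite poly2_0 mulr0 add0r.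
Qed.

Lemma wdivP (v : wfun R n * wfun R n) d : pw v.1 -> pw v.2 ->
  I2 T (fun x => wdiv k V v i x * poly2 k.+1 d x) = Ldx v.1 i d + Ldy v.2 i d.
Proof.
move=> pv1 pv2; have [gx Hx] := Ldx_riesz pv1; have [gy Hy] := Ldy_riesz pv2.
have S : wdiv_spec k V v i (fun i j => 1 * gx i j + gy i j).
  move=> e; rewrite wdiv_rhs// -Hx -Hy -I2tD; [|by apply: bmM; exact: bm_poly2..].
  by apply: eq_I2 => x _; rewrite poly2_lin; ring.
have := getPex (P := [set g | wdiv_spec k V v i g]) (ex_intro _ _ S).
by rewrite /wdiv; set g := get _ => /= Hg; rewrite Hg wdiv_rhs.
Qed.

Lemma weak_gradient_kernel v : pw v -> (forall d, Ldx v i d = 0) ->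
  (forall d, Ldy v i d = 0) -> exists r,
  (forall x, T x -> v.1 i x = r) /\ (forall j x, edge V i j x -> v.2 i j x = r).
Proof.
move=> pv Hx Hy; have [c Hv] := pv.1 i.
have pg := pd_poly2 k c.
pose m j t := v.2 i j (lerp (eA V i j) (eB V i j) t).
have K0 : wg_kernel k (poly2 k c) (V i 0) (V i 1) (V i 2) (m 0) (m 1) (m 2).
  move=> q1 q1x q1y q2 q2x q2y /pdP[d1 [-> -> _]] /pdP[d2 [-> _ ->]].
  have := wgrad_rhs d1 d2 pv; rewrite Hx Hy addr0 sum3 => /eqP.
  rewrite addrC subr_eq0 => /eqP E; rewrite -TE.
  transitivity (I2 T (fun x => v.1 i x * (poly2_dx k.+1 d1 x + poly2_dy k.+1 d2 x))).
    by apply: eq_I2 => x Tx; rewrite Hv.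
  by rewrite -E /eint /m /nrm /eA /eB nxt0 nxt1 nxt2.
have K j : wg_kernel k (poly2 k c) (V i j) (V i (nxt j)) (V i (nxt (nxt j)))
    (m j) (m (nxt j)) (m (nxt (nxt j))).
  elim/ord3P: j; rewrite !(nxt0, nxt1, nxt2) //; first exact: wg_kernel_cycle.
  exact/wg_kernel_cycle/wg_kernel_cycle.
(* Rotating the kernel identity gives the derivative along every edge; two edges already determine
   the gradient by Cramer's rule. *)
have tan j x : T x -> poly2_dx k c x * ((V i (nxt j)).1 - (V i j).1) +
    poly2_dy k c x * ((V i (nxt j)).2 - (V i j).2) = 0.
  rewrite (triE j Hc); exact: (tangential_derivative0 (ccw_nxt j Hc) pg (K j)).
have grad0 x : T x -> poly2_dx k c x = 0 /\ poly2_dy k c x = 0.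
  move=> Tx; have := tan 0 x Tx; have := tan 1 x Tx; rewrite nxt0 nxt1.
  have cc := c0; set A := V i 0 in cc *; set B := V i 1 in cc *; set C := V i 2 in cc *.
  move=> e2 e1; have Dn := lt0r_neq0 cc.
  split; apply: (mulfI Dn); rewrite mulr0.
  - transitivity ((C.2 - B.2) * (poly2_dx k c x * (B.1 - A.1) + poly2_dy k c x * (B.2 - A.2))
      - (B.2 - A.2) * (poly2_dx k c x * (C.1 - B.1) + poly2_dy k c x * (C.2 - B.2))).
      by rewrite /cr; ring.
    by rewrite e1 e2; ring.
  - transitivity ((B.1 - A.1) * (poly2_dx k c x * (C.1 - B.1) + poly2_dy k c x * (C.2 - B.2))
      - (C.1 - B.1) * (poly2_dx k c x * (B.1 - A.1) + poly2_dy k c x * (B.2 - A.2))).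
      by rewrite /cr; ring.
    by rewrite e1 e2; ring.
have TA : T (V i 0) by exact: ((edgeP 0 _ Hc).1 (edge_ends V i 0).1).1.
pose r := poly2 k c (V i 0).
have cst x : T x -> poly2 k c x = r.
  move=> Tx; move: (Tx) (TA); rewrite TE => Tx' TA'.
  apply: (pd_const pg _ _ Tx' TA') => z; rewrite -TE => Tz; by have [] := grad0 z Tz.
exists r; split=> [x Tx|j x [t /=]]; first by rewrite Hv// cst.
rewrite in_itv/= => t01 <-; have [cb Hb] := pv.2 i j.
rewrite -[LHS]/(m j t).
refine (edge_jump0 (ccw_nxt j Hc) (K j) (c := cb) _ Hb t01) => z.
by rewrite -(triE j Hc); exact: cst.
Qed.

End OneTriangle.
End WeakOperators.

(** * The discrete Stokes problem *)

Section GlobalProblem.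
Variables (R : realType) (k n : nat).
Local Notation pt := (R * R)%type.
Variable V : 'I_n -> 'I_3 -> pt.
Local Notation U := [set x | exists i, tri V i x].
Local Notation O := (interior U).
Local Notation vfun := (wfun R n * wfun R n)%type.
Implicit Types (w : wfun R n) (u v : vfun) (p q : 'I_n -> pt -> R).
Hypotheses (HT : triangulation V) (cvx : convex_set2 O).

Let Hc i : ccw V i. Proof. by case: HT. Qed.

Definition comb2 (a : R) (u v : vfun) : vfun := (wcomb a u.1 v.1, wcomb a u.2 v.2).
Definition pcomb (a : R) p q : 'I_n -> pt -> R := fun i x => a * p i x + q i x.
Definition w0 : wfun R n := (fun _ _ => 0, fun _ _ _ => 0).
Definition pwV (v : vfun) := pw k V v.1 /\ pw k V v.2.
Definition pP p := forall i, exists c, forall x, tri V i x -> p i x = poly2 k c x.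

Lemma sh0_pw (v : wfun R n) : in_Sh0 k V O v -> pw k V v.
Proof. by move=> [h1 [h2 _]]; split. Qed.

Lemma vh_pw v : in_Vh k V O v -> pwV v.
Proof. by move=> [h1 h2]; split; exact: sh0_pw. Qed.

Lemma sh0_comb a (v : wfun R n) w : in_Sh0 k V O v -> in_Sh0 k V O w -> in_Sh0 k V O (wcomb a v w).
Proof.
move=> hv hw; have [p1 p2] := pw_comb a (sh0_pw hv) (sh0_pw hw).
case: hv => _ [_ [v3 v4]]; case: hw => _ [_ [w3 w4]].
split=> //; split=> //; split=> [i j i' j' e x ex|i j e x ex] /=.
  by rewrite (v3 _ _ _ _ e)// (w3 _ _ _ _ e).
by rewrite (v4 _ _ e)// (w4 _ _ e)//; ring.
Qed.

Lemma vh_comb a u v : in_Vh k V O u -> in_Vh k V O v -> in_Vh k V O (comb2 a u v).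
Proof. by move=> [u1 u2] [v1 v2]; split; exact: sh0_comb. Qed.

Lemma sh0_w0 : in_Sh0 k V O w0.
Proof.
split; first by move=> i; exists (fun _ _ => 0) => x _; rewrite poly2_0.
split=> //; move=> i j; exists (fun=> 0) => t _.
by rewrite /poly1 big1// => l _; rewrite mul0r.
Qed.

Lemma vh_w0 : in_Vh k V O (w0, w0).
Proof. by split; exact: sh0_w0. Qed.

Lemma sh0_eq (v : wfun R n) w : wfun_eq V v w -> in_Sh0 k V O v -> in_Sh0 k V O w.
Proof.
move=> [e1 e2] [h1 [h2 [h3 h4]]]; split.
  by move=> i; have [c H] := h1 i; exists c => x tx; rewrite -e1// H.
split.
  move=> i j; have [c H] := h2 i j; exists c => t t01; rewrite -e2 ?H//.
  by exists t => //; rewrite /= in_itv.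
split=> [i j i' j' e x ex|i j e x ex].
  by rewrite -e2// -e2 -?e// (h3 _ _ _ _ e).
by rewrite -e2// (h4 _ _ e).
Qed.

Lemma pcomb_poly a p q : pP p -> pP q -> pP (pcomb a p q).
Proof.
move=> pp pq i; have [c Hp] := pp i; have [d Hq] := pq i.
by exists (fun r s => a * c r s + d r s) => x tx; rewrite poly2_lin /pcomb Hp// Hq.
Qed.

Lemma bm_pP p i : pP p -> bm (tri V i) (p i).
Proof.
by move=> /(_ i)[c H]; apply: bm_eq (bm_poly2 (Hc i) k c) => x tx; rewrite H.
Qed.

Lemma mh_comb a p q : in_Mh k V p -> in_Mh k V q -> in_Mh k V (pcomb a p q).
Proof.
move=> [p1 p2] [q1 q2]; split; first exact: pcomb_poly.
transitivity (a * (\sum_i I2 (tri V i) (p i)) + \sum_i I2 (tri V i) (q i)).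
  rewrite mulr_sumr -big_split; apply: eq_bigr => i _ /=.
  by rewrite -(I2t_lin (Hc i)); [|exact: bm_pP..].
by rewrite p2 q2; ring.
Qed.

Lemma mh_eq p q : Mh_eq V p q -> in_Mh k V p -> in_Mh k V q.
Proof.
move=> e [h1 h2]; split.
  by move=> i; have [c H] := h1 i; exists c => x tx; rewrite -e// H.
by rewrite -[RHS]h2; apply: eq_bigr => i _; apply: eq_I2 => x tx; rewrite e.
Qed.

Lemma mh_0 : in_Mh k V (fun _ _ => 0).
Proof.
split; first by move=> i; exists (fun _ _ => 0) => x _; rewrite poly2_0.
by rewrite big1// => i _; exact: I2_cst0.
Qed.

(** The two specifications are the same set, so [get] picks the same table; the gradients agree
    everywhere, not just on the triangles. *)
Lemma wgrad_eq (v : wfun R n) w : wfun_eq V v w -> wgrad k V v = wgrad k V w.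
Proof.
move=> [e1 e2]; apply/funext => i; apply/funext => x; rewrite /wgrad.
suff -> : [set g | wgrad_spec k V v i g] = [set g | wgrad_spec k V w i g] by [].
apply/funext => g; apply/propext; split=> H d; rewrite H; congr (- _ + _).
- by apply: eq_I2 => y ty; rewrite e1.
- by apply: eq_bigr => j _; apply: eq_eint => y ey; rewrite e2.
- by apply: eq_I2 => y ty; rewrite e1.
- by apply: eq_bigr => j _; apply: eq_eint => y ey; rewrite e2.
Qed.

Definition veq (u v : vfun) := wfun_eq V u.1 v.1 /\ wfun_eq V u.2 v.2.

Lemma vh_eq u v : veq u v -> in_Vh k V O u -> in_Vh k V O v.
Proof. by move=> [e1 e2] [h1 h2]; split; [exact: sh0_eq e1 h1|exact: sh0_eq e2 h2]. Qed.

Lemma wdiv_eq u v : veq u v -> wdiv k V u = wdiv k V v.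
Proof.
move=> [[e1 e2] [e3 e4]]; apply/funext => i; apply/funext => x; rewrite /wdiv.
suff -> : [set g | wdiv_spec k V u i g] = [set g | wdiv_spec k V v i g] by [].
apply/funext => g; apply/propext; split=> H d; rewrite H; congr (- _ + _).
- by apply: eq_I2 => y ty; rewrite e1// e3.
- by apply: eq_bigr => j _; apply: eq_eint => y ey; rewrite e2// e4.
- by apply: eq_I2 => y ty; rewrite e1// e3.
- by apply: eq_bigr => j _; apply: eq_eint => y ey; rewrite e2// e4.
Qed.

Lemma a_h_eq u v v' : veq v v' -> a_h k V u v = a_h k V u v'.
Proof. by move=> [/wgrad_eq e1 /wgrad_eq e2]; rewrite /a_h e1 e2. Qed.

Lemma b_h_eq p v v' : veq v v' -> b_h k V p v = b_h k V p v'.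
Proof. by move=> /wdiv_eq e; rewrite /b_h e. Qed.

Lemma b_h_eqp p q v : Mh_eq V p q -> b_h k V p v = b_h k V q v.
Proof. by move=> e; apply: eq_bigr => i _; apply: eq_I2 => x tx; rewrite e. Qed.

Lemma f_h_eq f v v' : veq v v' -> f_h V f v = f_h V f v'.
Proof.
by move=> [[e1 _] [e2 _]]; apply: eq_bigr => i _; apply: eq_I2 => x tx; rewrite e1// e2.
Qed.

Lemma swap4 (x1 x2 x3 x4 y1 y2 y3 y4 : R) :
  x1 * y1 + x2 * y2 + x3 * y3 + x4 * y4 = y1 * x1 + y2 * x2 + y3 * x3 + y4 * x4.
Proof. by ring. Qed.

Lemma a_h_sym u v : a_h k V u v = a_h k V v u.
Proof.
apply: eq_bigr => i _; apply: eq_I2 => x tx.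
exact: swap4.
Qed.

Lemma lin4 (a x1 x2 x3 x4 y1 y2 y3 y4 : R) :
  (a * x1 + y1) + (a * x2 + y2) + (a * x3 + y3) + (a * x4 + y4) =
  a * (x1 + x2 + x3 + x4) + (y1 + y2 + y3 + y4).
Proof. by ring. Qed.

Lemma lin2 (a x1 x2 y1 y2 : R) :
  (a * x1 + y1) + (a * x2 + y2) = a * (x1 + x2) + (y1 + y2).
Proof. by ring. Qed.

Definition gc (v : wfun R n) i := get [set g | wgrad_spec k V v i g].

Lemma bm_wgrad1 (v : wfun R n) i : bm (tri V i) (fun x => (wgrad k V v i x).1).
Proof. exact: (bm_poly2 (Hc i) k.+1 (gc v i).1). Qed.

Lemma bm_wgrad2 (v : wfun R n) i : bm (tri V i) (fun x => (wgrad k V v i x).2).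
Proof. exact: (bm_poly2 (Hc i) k.+1 (gc v i).2). Qed.

Lemma bm_wdiv v i : bm (tri V i) (wdiv k V v i).
Proof. exact: (bm_poly2 (Hc i) k.+1 _). Qed.

(** The weak gradient of [v] is itself a test polynomial for that of [u]. Linearity in [u] thereby
    reduces to that of [Ldx] and [Ldy], and linearity in [v] follows by symmetry. *)
Lemma a_hE u v : pwV u -> a_h k V u v =
  \sum_i (Ldx k V u.1 i (gc v.1 i).1 + Ldy k V u.1 i (gc v.1 i).2 +
          Ldx k V u.2 i (gc v.2 i).1 + Ldy k V u.2 i (gc v.2 i).2).
Proof.
move=> [p1 p2]; apply: eq_bigr => i _.
have [e1 _] := wgradP (Hc i) (gc v.1 i).1 p1; have [_ e2] := wgradP (Hc i) (gc v.1 i).2 p1.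
have [e3 _] := wgradP (Hc i) (gc v.2 i).1 p2; have [_ e4] := wgradP (Hc i) (gc v.2 i).2 p2.
rewrite -e1 -e2 -e3 -e4.
have b1 w w' : bm (tri V i) (fun x => (wgrad k V w i x).1 * (wgrad k V w' i x).1).
  by apply: bmM; exact: bm_wgrad1.
have b2 w w' : bm (tri V i) (fun x => (wgrad k V w i x).2 * (wgrad k V w' i x).2).
  by apply: bmM; exact: bm_wgrad2.
rewrite (I2tD (Hc i)); [|by do 2?apply: bmD|exact: b2].
rewrite (I2tD (Hc i)); [|by apply: bmD|exact: b1].
by rewrite (I2tD (Hc i)).
Qed.

Lemma a_h_linl a u u' v : pwV u -> pwV u' ->
  a_h k V (comb2 a u u') v = a * a_h k V u v + a_h k V u' v.
Proof.
move=> [p1 p2] [q1 q2].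
rewrite !a_hE//; last by split; exact: pw_comb.
rewrite mulr_sumr -big_split; apply: eq_bigr => i _ /=.
by rewrite !Ldx_lin// !Ldy_lin//; exact: lin4.
Qed.

Lemma a_h_linr a u v v' : pwV v -> pwV v' ->
  a_h k V u (comb2 a v v') = a * a_h k V u v + a_h k V u v'.
Proof. by move=> pv pv'; rewrite !(a_h_sym u) a_h_linl. Qed.

Lemma pressure_coef p : pP p -> exists c c' : 'I_n -> nat -> nat -> R, forall i,
  [/\ forall x, tri V i x -> p i x = poly2 k (c i) x, poly2 k.+1 (c' i) = poly2 k (c i),
      poly2_dx k.+1 (c' i) = poly2_dx k (c i) & poly2_dy k.+1 (c' i) = poly2_dy k (c i)].
Proof.
move=> /choice[c Hp].
have /choice[c' Hr] : forall i, exists c' : nat -> nat -> R,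
    [/\ poly2 k.+1 c' = poly2 k (c i), poly2_dx k.+1 c' = poly2_dx k (c i) &
        poly2_dy k.+1 c' = poly2_dy k (c i)].
  by move=> i; exact: poly2_raise.
by exists c, c' => i; have [? ? ?] := Hr i; split=> //; exact: Hp.
Qed.

Lemma b_hE p c' v : (forall i x, tri V i x -> p i x = poly2 k.+1 (c' i) x) -> pwV v ->
  b_h k V p v = \sum_i (Ldx k V v.1 i (c' i) + Ldy k V v.2 i (c' i)).
Proof.
move=> Hp [p1 p2]; apply: eq_bigr => i _; rewrite -(wdivP (Hc i))//.
by apply: eq_I2 => x tx; rewrite Hp// mulrC.
Qed.

Lemma b_h_linr p a v v' : pP p -> pwV v -> pwV v' ->
  b_h k V p (comb2 a v v') = a * b_h k V p v + b_h k V p v'.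
Proof.
move=> /pressure_coef[c [c' Hp]] [p1 p2] [q1 q2].
have E i x : tri V i x -> p i x = poly2 k.+1 (c' i) x.
  by move=> tx; have [H -> _ _] := Hp i; exact: H.
rewrite !(b_hE E)//; last by split; exact: pw_comb.
rewrite mulr_sumr -big_split; apply: eq_bigr => i _ /=.
by rewrite !Ldx_lin// !Ldy_lin//; exact: lin2.
Qed.

Lemma b_h_linl a p q v : pP p -> pP q ->
  b_h k V (pcomb a p q) v = a * b_h k V p v + b_h k V q v.
Proof.
move=> pp pq; rewrite mulr_sumr -big_split; apply: eq_bigr => i _ /=.
rewrite -(I2t_lin (Hc i)); [|by apply: bmM; [exact: bm_pP|exact: bm_wdiv]..].
by apply: eq_I2 => x tx; rewrite /pcomb mulrDl mulrA.
Qed.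

Lemma f_h_lin f a v v' : L2vec O f -> pwV v -> pwV v' ->
  f_h V f (comb2 a v v') = a * f_h V f v + f_h V f v'.
Proof.
move=> Hf [p1 p2] [q1 q2]; rewrite mulr_sumr -big_split; apply: eq_bigr => i _ /=.
have TE : tri V i = T3 (V i 0) (V i 1) (V i 2) by rewrite (triE 0 (Hc i)) nxt0 nxt1.
have c0 : 0 < cr (V i 0) (V i 1) (V i 2) := Hc i.
have TO : T3o (V i 0) (V i 1) (V i 2) `<=` O.
  move=> x [h1 h2 h3]; have := open_interior_T3 h1 h2 h3; rewrite -TE => N.
  by apply: (@filterS _ (nbhs x) _ (tri V i)) N => y ty; exists i.
have b w : pw k V w -> bm (tri V i) (w.1 i) by exact: bm_pw.
rewrite TE in b *.
exact: (I2_L2_lin a c0 (@open_interior _ _) TO Hf (b _ p1) (b _ p2) (b _ q1) (b _ q2)).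
Qed.

Lemma sq2_eq0 (a b : R) : a * a + b * b = 0 -> a = 0 /\ b = 0.
Proof.
rewrite -!expr2 => /eqP; rewrite paddr_eq0 ?sqr_ge0// !sqrf_eq0.
by move=> /andP[/eqP-> /eqP->].
Qed.

Lemma sq4_ge0 (a b c d : R) : 0 <= a * a + b * b + c * c + d * d.
Proof. by rewrite -!expr2 !addr_ge0// sqr_ge0. Qed.

Lemma sq4_eq0 (a b c d : R) : a * a + b * b + c * c + d * d = 0 ->
  [/\ a = 0, b = 0, c = 0 & d = 0].
Proof.
rewrite -!expr2 => /eqP; rewrite !paddr_eq0 ?addr_ge0 ?sqr_ge0// !sqrf_eq0.
by move=> /andP[/andP[/andP[/eqP-> /eqP->] /eqP->] /eqP->].
Qed.

Lemma energy0 u : pwV u -> a_h k V u u = 0 -> forall i d,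
  [/\ Ldx k V u.1 i d = 0, Ldy k V u.1 i d = 0, Ldx k V u.2 i d = 0 & Ldy k V u.2 i d = 0].
Proof.
move=> [p1 p2] H i d.
have c0 : 0 < cr (V i 0) (V i 1) (V i 2) := Hc i.
have TE : tri V i = T3 (V i 0) (V i 1) (V i 2) by rewrite (triE 0 (Hc i)) nxt0 nxt1.
move: H => /eqP; rewrite psumr_eq0 => [/allP /(_ i)|i' _]; last first.
  by apply: I2_ge0 => x _; exact: sq4_ge0.
rewrite mem_index_enum => /(_ isT) /eqP; rewrite TE => E.
have pp (g : nat -> nat -> R) :
    pd (k.+1 + k.+1) (fun x => poly2 k.+1 g x * poly2 k.+1 g x) _ _ :=
  pdM (pd_poly2 k.+1 g) (pd_poly2 k.+1 g).
have Z x : tri V i x -> [/\ (wgrad k V u.1 i x).1 = 0, (wgrad k V u.1 i x).2 = 0,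
    (wgrad k V u.2 i x).1 = 0 & (wgrad k V u.2 i x).2 = 0].
  rewrite TE => tx; apply: sq4_eq0.
  exact: (I2_eq0 c0 (pdD (pdD (pdD (pp (gc u.1 i).1) (pp (gc u.1 i).2))
    (pp (gc u.2 i).1)) (pp (gc u.2 i).2)) (fun _ _ => sq4_ge0 _ _ _ _) E tx).
have [<- _] := wgradP (Hc i) d p1; have [_ <-] := wgradP (Hc i) d p1.
have [<- _] := wgradP (Hc i) d p2; have [_ <-] := wgradP (Hc i) d p2.
by split; rewrite (eq_I2 (h := fun=> 0)) ?I2_cst0// => x tx;
  have [z1 z2 z3 z4] := Z x tx; rewrite ?z1 ?z2 ?z3 ?z4 mul0r.
Qed.

Lemma velocity0 (v : wfun R n) : in_Sh0 k V O v ->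
  (forall i d, Ldx k V v i d = 0 /\ Ldy k V v i d = 0) -> wfun_eq V v w0.
Proof.
move=> hv H; have pv := sh0_pw hv; case: hv => _ [_ [v3 v4]].
have /choice[r Hr] : forall i, exists r, (forall x, tri V i x -> v.1 i x = r) /\
    (forall j x, edge V i j x -> v.2 i j x = r).
  by move=> i; apply: (weak_gradient_kernel (Hc i) pv) => d; have [] := H i d.
have r0 i : r i = 0.
  (* The triangles with nonzero constant would be a closed family: an unshared edge lies on the
     boundary and forces 0, and across a shared edge the constant is passed on. *)
  apply/eqP; apply: contrapT; apply: (no_closed_family HT (S := fun i => ~ (r i == 0))) i.
  move=> i j ri; apply: contrapT => N; apply: (ri); apply/eqP.
  have [ea _] := edge_ends V i j.
  have [_ Hi] := Hr i; rewrite -(Hi j _ ea); apply: v4 => //.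
  apply: (unshared_edge_bnd HT) => i' j' ii' e; apply: N; exists i', j'; split=> //.
  suff <- : r i = r i' by [].
  rewrite -(Hi j _ ea) (v3 _ _ _ _ e)//; have [_ ->//] := Hr i'; by rewrite -e.
by split=> [i x tx|i j x ex]; have [h1 h2] := Hr i; rewrite ?(h1 _ tx) ?(h2 _ _ ex) r0.
Qed.

Lemma I01_cst (r : R) : I01 (fun=> r) = r.
Proof.
transitivity (I01 (fun t => (r *: 'X : {poly R})^`().[t])).
  by apply: I01_eq => t _; rewrite derivZ derivX alg_polyC hornerC.
by rewrite I01_poly !hornerE; ring.
Qed.

Lemma pressure_locally_const p : pP p ->
  (forall v, in_Vh k V O v -> b_h k V p v = 0) ->
  forall i x, tri V i x -> p i x = p i (V i 0).
Proof.
move=> /pressure_coef[c [c' Hp]] Hb i0.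
have E i x : tri V i x -> p i x = poly2 k.+1 (c' i) x.
  by move=> tx; have [H -> _ _] := Hp i; exact: H.
have TE : tri V i0 = T3 (V i0 0) (V i0 1) (V i0 2) by rewrite (triE 0 (Hc i0)) nxt0 nxt1.
have c0 : 0 < cr (V i0 0) (V i0 1) (V i0 2) := Hc i0.
have [pi0 _ dxE dyE] := Hp i0.
have [[gxx [gxy px]] [gyx [gyy py]]] := pd_deriv (pd_poly2 k (c i0)).
(* Zero edge parts make this weak function admissible; with the gradient of [p] inserted, [b_h] is
   minus the integral of its squared length over triangle [i0]. *)
pose v g : wfun R n := (fun i x => if i == i0 then g x else 0, fun _ _ _ => 0).
have hv g hx hy : pd k.-1 g hx hy -> in_Sh0 k V O (v g).
  move=> pg; have [e [He _ _]] := pdP (pd_leq (leq_pred k) pg).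
  have [_ [z2 [z3 z4]]] := sh0_w0; split; last by split; [|split].
  move=> i; rewrite /v/=; case: eqVneq => [_|_]; first by exists e => x _; rewrite He.
  by exists (fun _ _ => 0) => x _; rewrite poly2_0.
pose vv : vfun := (v (poly2_dx k (c i0)), v (poly2_dy k (c i0))).
have hvv : in_Vh k V O vv by split; [exact: hv px|exact: hv py].
have := Hb vv hvv; rewrite (b_hE E (vh_pw hvv)) (bigD1 i0)//= big1 ?addr0; last first.
  move=> i ii0; have zI g F : I2 (tri V i) (fun x => (v g).1 i x * F x) = 0.
    rewrite -[RHS](I2_cst0 (tri V i)); apply: eq_I2 => x _.
    by rewrite /v/= (negbTE ii0) mul0r.
  by rewrite /Ldx /Ldy !Lw_interior// !zI oppr0 addr0.
rewrite /Ldx /Ldy !Lw_interior// /v/= eqxx dxE dyE -opprD => /eqP; rewrite oppr_eq0 => /eqP.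
rewrite -(I2tD (Hc i0)); [|by apply: bmM; exact: bm_dx|by apply: bmM; exact: bm_dy].
rewrite TE => I0.
have Z x : tri V i0 x -> poly2_dx k (c i0) x = 0 /\ poly2_dy k (c i0) x = 0.
  rewrite TE => tx; apply: sq2_eq0.
  apply: (I2_eq0 c0 (pdD (pdM px px) (pdM py py)) _ I0 tx) => y _.
  by rewrite -!expr2 addr_ge0// sqr_ge0.
have tA : tri V i0 (V i0 0) by exact: ((edgeP 0 _ (Hc i0)).1 (edge_ends V i0 0).1).1.
have gx0 z : T3 (V i0 0) (V i0 1) (V i0 2) z -> poly2_dx k (c i0) z = 0.
  by rewrite -TE => /Z[].
have gy0 z : T3 (V i0 0) (V i0 1) (V i0 2) z -> poly2_dy k (c i0) z = 0.
  by rewrite -TE => /Z[].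
move=> x tx; have tx' : tri V i0 x by rewrite TE.
rewrite (pi0 _ tx') (pi0 _ tA); rewrite TE in tA.
exact: (pd_const (pd_poly2 k (c i0)) gx0 gy0 tx tA).
Qed.

(* Test with the normal field supported on the common edge. *)
Lemma pressure_shared p (q : 'I_n -> R) : pP p ->
  (forall i x, tri V i x -> p i x = q i) ->
  (forall v, in_Vh k V O v -> b_h k V p v = 0) ->
  forall i i' j j', i != i' -> edge V i j = edge V i' j' -> q i = q i'.
Proof.
move=> /pressure_coef[c [c' Hp]] pq Hb i i' j j' ii' e.
have E l x : tri V l x -> p l x = poly2 k.+1 (c' l) x.
  by move=> tx; have [H -> _ _] := Hp l; exact: H.
(* Edges are compared as point sets, so the resulting edge function is single-valued. *)
pose chi (r : R) l m : R := if `[< edge V l m = edge V i j >] then r else 0.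
pose v r : wfun R n := (fun _ _ => 0, fun l m _ => chi r l m).
have AB := cr_neq (ccw_nxt j (Hc i)).
have hv r : in_Sh0 k V O (v r).
  have [z1 [z2 [z3 z4]]] := sh0_w0; split=> //; split.
    move=> l m; exists (fun a => if a == 0%N then chi r l m else 0) => t _.
    rewrite /poly1 big_ord_recl big1 ?addr0 ?expr0 ?mulr1// => a _.
    by rewrite lift0 mul0r.
  split=> [l m l' m' el x _|l m el x ex]; first by rewrite /= /chi el.
  rewrite /= /chi; case: asboolP => // elm; exfalso.
  (* The boundary condition is vacuous on a shared edge: a point of it that is no vertex has a
     neighbourhood covered by the two triangles, hence is interior. *)
  have [t /andP[t0 t1] nvt] :=
    @avoid_points R ('I_n * 'I_3)%type (fun s => V s.1 s.2) _ _ 1 ltr01 AB.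
  set z := lerp _ _ _ in nvt.
  have ez : edge V i j z by exists t => //; rewrite /= in_itv/= !ltW.
  have Oz : O z.
    have := shared_edge_nbhs HT ii' e ez (fun l m => nvt (l, m)).
    by apply: filterS => y [ty|ty]; [exists i|exists i'].
  by rewrite -elm in ez; have [_] := el _ ez.
pose al := (nrm V i j).1; pose be := (nrm V i j).2.
have hvv : in_Vh k V O (v al, v be) by split; exact: hv.
pose G l m := chi (q l * (al * (nrm V l m).1 + be * (nrm V l m).2)) l m.
have eintE r l m : eint V l m (fun x => chi r l m * poly2 k.+1 (c' l) x) = chi (r * q l) l m.
  rewrite (eq_eint (G := fun=> chi r l m * q l)); last first.
    by move=> x /(edgeP _ _ (Hc l))[tx _]; rewrite -E// pq.
  by rewrite /eint I01_cst /chi; case: asboolP => _; rewrite ?mul0r.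
have sumG : \sum_l \sum_m G l m = 0.
  rewrite -[RHS](Hb _ hvv) (b_hE E (vh_pw hvv)); apply: eq_bigr => l _.
  rewrite /Ldx /Ldy !Lw_boundary// -big_split; apply: eq_bigr => m _ /=.
  rewrite !eintE /G /chi; case: asboolP => _; last by rewrite !mulr0 addr0.
  by rewrite /nrm/=; ring.
have G0 l m : edge V l m <> edge V i j -> G l m = 0 by move=> H; rewrite /G /chi asboolF.
have rowE l m : edge V l m = edge V i j -> \sum_s G l s = G l m.
  move=> el; rewrite (bigD1 m)//= big1 ?addr0// => s sm; apply: G0 => es.
  by move/eqP: sm; apply; apply: (edge_inj HT (i := l)); rewrite es.
have Gi : G i j = q i * (al ^+ 2 + be ^+ 2) by rewrite /G /chi asboolT// /al /be; ring.
have Gi' : G i' j' = - q i' * (al ^+ 2 + be ^+ 2).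
  have [n1 n2] : (nrm V i' j').1 = - al /\ (nrm V i' j').2 = - be.
    by rewrite (shared_edge_nrm HT ii' e).
  by rewrite /G /chi asboolT// n1 n2; ring.
(* Only the two triangles at the edge contribute, with opposite normals, so [q i - q i'] times the
   squared edge length is zero. *)
move: sumG; rewrite (bigD1 i)//= (bigD1 i')/=; last by rewrite eq_sym.
rewrite [X in _ + (_ + X)]big1 => [|l /andP[li li']]; last first.
  apply: big1 => m _; apply: G0 => el.
  by apply: (shared_edge_two HT ii' _ _ e (esym el)); rewrite eq_sym.
rewrite (rowE i j)// (rowE i' j')// Gi Gi' addr0 -mulrDl => /eqP.
rewrite mulf_eq0 => /orP[|]; first by rewrite subr_eq0 => /eqP.
rewrite paddr_eq0 ?sqr_ge0// !sqrf_eq0 /al /be /nrm/= !subr_eq0 => /andP[/eqP h2 /eqP h1].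
exfalso; apply: AB; rewrite (surjective_pairing (V i j)) (surjective_pairing (V i (nxt j))).
by congr pair.
Qed.

Lemma area_gt0 i : 0 < I2 (tri V i) (fun=> 1).
Proof.
have c0 : 0 < cr (V i 0) (V i 1) (V i 2) := Hc i.
have TE : tri V i = T3 (V i 0) (V i 1) (V i 2) by rewrite (triE 0 (Hc i)) nxt0 nxt1.
rewrite lt_def I2_ge0 ?andbT//; apply/eqP => I0.
have tA : tri V i (V i 0) by exact: ((edgeP 0 _ (Hc i)).1 (edge_ends V i 0).1).1.
rewrite TE in I0 tA.
have := I2_eq0 c0 (pd_cst 0 1) (fun _ _ => ler01) I0 tA.
by move/eqP; rewrite oner_eq0.
Qed.

Lemma pressure0 p : in_Mh k V p -> (forall v, in_Vh k V O v -> b_h k V p v = 0) ->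
  Mh_eq V p (fun _ _ => 0).
Proof.
move=> [pp p0] Hb; have lc := pressure_locally_const pp Hb.
pose q i := p i (V i 0).
have sh := pressure_shared (q := q) pp lc Hb.
move=> i x tx; rewrite (lc _ _ tx) -/(q i).
have qE l : q l = q i.
  apply: (edge_connected HT cvx (S := fun l => q l = q i)) (erefl (q i)) => //.
  by move=> l1 l2 m1 m2 l12 e <-; rewrite (sh _ _ _ _ l12 e).
move: p0; have -> : \sum_(l < n) I2 (tri V l) (p l) = q i * \sum_(l < n) I2 (tri V l) (fun=> 1).
  rewrite mulr_sumr; apply: eq_bigr => l _; rewrite -(I2tZ (Hc l)); last exact: bm_cst.
  by apply: eq_I2 => y ty; rewrite (lc _ _ ty) -/(q l) qE mulr1.
move=> /eqP; rewrite mulf_eq0 => /orP[/eqP//|].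
rewrite gt_eqF// (bigD1 i)//= ltr_pwDl ?area_gt0//.
by apply: sumr_ge0 => l _; rewrite ltW ?area_gt0.
Qed.

(** Testing with [u] itself cancels the pressure and leaves zero energy. Then [a_h u] vanishes on
    every test function, so [p] is orthogonal to all weak divergences. *)
Lemma homogeneous u p : in_Vh k V O u -> in_Mh k V p ->
  (forall v, in_Vh k V O v -> a_h k V u v = b_h k V p v) ->
  (forall q, in_Mh k V q -> b_h k V q u = 0) ->
  veq u (w0, w0) /\ Mh_eq V p (fun _ _ => 0).
Proof.
move=> hu hp H1 H2; have pu := vh_pw hu.
have a0 : a_h k V u u = 0 by rewrite H1// H2.
have L0 := energy0 pu a0; split.
  by split; apply: velocity0; [exact: hu.1|move=> i d; have [] := L0 i d|
    exact: hu.2|move=> i d; have [] := L0 i d].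
apply: (pressure0 hp) => v hv; have <- := H1 v hv.
rewrite (a_hE v pu); apply: big1 => i _.
have [e1 _ _ _] := L0 i (gc v.1 i).1; have [_ e2 _ _] := L0 i (gc v.1 i).2.
have [_ _ e3 _] := L0 i (gc v.2 i).1; have [_ _ _ e4] := L0 i (gc v.2 i).2.
by rewrite e1 e2 e3 e4 !addr0.
Qed.

(** The parameter of the orthogonal projection of [z] onto the line [A B], a left inverse of
    [lerp A B] that extends edge polynomials to the plane. *)
Definition tpar (A B z : pt) : R :=
  ((z.1 - A.1) * (B.1 - A.1) + (z.2 - A.2) * (B.2 - A.2)) /
  ((B.1 - A.1) ^+ 2 + (B.2 - A.2) ^+ 2).

Lemma tpar_lerp (A B : pt) t : A <> B -> tpar A B (lerp A B t) = t.
Proof.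
move=> AB; have d0 : (B.1 - A.1) ^+ 2 + (B.2 - A.2) ^+ 2 != 0.
  apply/eqP => /eqP; rewrite paddr_eq0 ?sqr_ge0// !sqrf_eq0 !subr_eq0.
  move=> /andP[/eqP h1 /eqP h2]; apply: AB.
  by rewrite (surjective_pairing A) (surjective_pairing B) h1 h2.
rewrite /tpar /lerp /=; apply: (mulIf d0); rewrite divfK//; ring.
Qed.

(* Coordinates: three copies of the scalar weak functions, for the two velocity
   components and for the pressure, whose edge part is ignored. *)
Definition dof := ('I_3 * 'I_n * ('I_k.+1 * 'I_k.+1) + 'I_3 * 'I_n * 'I_3 * 'I_k.+2)%type.

Definition coord (x : 'rV[R]_#|{: dof}|) (s : dof) : R := x 0 (enum_rank s).

(** The map is not injective, as [poly2] reads only entries with [a + b <= k]. A shared edge has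
    separate coefficients in each of its triangles; matching them is left to [adm]. *)
Definition of_coord (m : 'I_3) x : wfun R n :=
  (fun i z => poly2 k (fun a b => coord x (inl (m, i, (inord a, inord b)))) z,
   fun i j z => poly1 k.+1 (fun l => coord x (inr (m, i, j, inord l)))
     (tpar (eA V i j) (eB V i j) z)).

Lemma coord_lin a x y s : coord (a *: x + y) s = a * coord x s + coord y s.
Proof. by rewrite /coord !mxE. Qed.

Lemma of_coord_lin m a x y :
  of_coord m (a *: x + y) = wcomb a (of_coord m x) (of_coord m y).
Proof.
rewrite /of_coord /wcomb; congr pair; apply/funext => i.
  apply/funext => z /=; rewrite -poly2_lin; congr (poly2 k _ z).
  by apply/funext => r; apply/funext => s; rewrite coord_lin.
apply/funext => j; apply/funext => z /=; rewrite -poly1_lin; congr (poly1 _ _ _).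
by apply/funext => l; rewrite coord_lin.
Qed.

Lemma of_coord_surj (w : 'I_3 -> wfun R n) : (forall m, pw k V (w m)) ->
  exists x, forall m, wfun_eq V (of_coord m x) (w m).
Proof.
move=> pww.
have /choice[c Hcf] : forall s : 'I_3 * 'I_n, exists c, forall x, tri V s.2 x ->
    (w s.1).1 s.2 x = poly2 k c x by move=> s; exact: (pww s.1).1.
have /choice[e He] : forall s : 'I_3 * 'I_n * 'I_3, exists c : nat -> R,
    forall t, 0 <= t <= 1 -> (w s.1.1).2 s.1.2 s.2
      (lerp (eA V s.1.2 s.2) (eB V s.1.2 s.2) t) = poly1 k.+1 c t.
  by move=> s; exact: (pww s.1.1).2.
pose x : 'rV[R]_#|{: dof}| := \row_(s < #|{: dof}|) match (enum_val s : dof) with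
  | inl (m, i, (a, b)) => c (m, i) a b
  | inr (m, i, j, l) => e (m, i, j) l end.
have xE s : coord x s = match s with
  | inl (m, i, (a, b)) => c (m, i) a b
  | inr (m, i, j, l) => e (m, i, j) l end by rewrite /coord mxE enum_rankK.
exists x => m; split=> [i z tz|i j z ez] /=.
  rewrite (Hcf (m, i))//; apply: (congr1 (fun P : pt -> R => P z)).
  by apply: eq_poly2 => a b ak bk; rewrite xE !inordK.
have AB := cr_neq (ccw_nxt j (Hc i)).
case: ez => t /=; rewrite in_itv/= => t01 <-.
rewrite tpar_lerp//; have := He (m, i, j) t t01 => /= ->.
by apply: eq_bigr => l _; rewrite xE inordK.
Qed.

(** * Existence and uniqueness for a given load *)

Section Solution.
Variable f : pt -> pt.
Hypothesis Hf : L2vec O f.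

Let uc x : vfun := (of_coord 0 x, of_coord 1 x).
Let pc x : 'I_n -> pt -> R := (of_coord 2 x).1.
Let adm x := in_Vh k V O (uc x) /\ in_Mh k V (pc x).

Lemma adm_lin a x y : adm x -> adm y -> adm (a *: x + y).
Proof.
move=> [ux px] [uy py]; rewrite /adm /uc /pc !of_coord_lin.
by split; [exact: (vh_comb a ux uy)|exact: (mh_comb a px py)].
Qed.

Lemma adm_surj u p : in_Vh k V O u -> in_Mh k V p ->
  exists2 x, adm x & veq (uc x) u /\ Mh_eq V (pc x) p.
Proof.
move=> hu hp; have [pu1 pu2] := vh_pw hu.
pose w (m : 'I_3) : wfun R n :=
  if m == 0 then u.1 else if m == 1 then u.2 else (p, fun _ _ _ => 0).
have [] := @of_coord_surj w => [|x Hx].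
  elim/ord3P; rewrite /w//=; split; first exact: hp.1.
  by have [_ [h _]] := sh0_w0; exact: h.
have e : veq (uc x) u by split; [exact: (Hx 0)|exact: (Hx 1)].
have ep : Mh_eq V (pc x) p by have [h _] := Hx 2; exact: h.
exists x; last by [].
split; first by apply: vh_eq hu; split; split=> *; rewrite ?(e.1.1, e.1.2, e.2.1, e.2.2).
by apply: mh_eq hp => i z tz; rewrite ep.
Qed.

(** Both equations in one form: test pairs with zero pressure give the momentum equation, those with
    zero velocity the divergence constraint. *)
Let form x y := a_h k V (uc x) (uc y) - b_h k V (pc x) (uc y) + b_h k V (pc y) (uc x).

Lemma exists_solution : exists u p, [/\ in_Vh k V O u, in_Mh k V p,
  forall v, in_Vh k V O v -> a_h k V u v - b_h k V p v = f_h V f v &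
  forall q, in_Mh k V q -> b_h k V q u = 0].
Proof.
have ucl a x y : uc (a *: x + y) = comb2 a (uc x) (uc y).
  by rewrite /uc !of_coord_lin.
have pcl a x y : pc (a *: x + y) = pcomb a (pc x) (pc y).
  by rewrite /pc !of_coord_lin.
have au x : adm x -> pwV (uc x) by move=> [/vh_pw].
have ap x : adm x -> pP (pc x) by move=> [_ []].
have b0 v : b_h k V (fun _ _ => 0) v = 0.
  rewrite /b_h big1// => i _; rewrite -[RHS](I2_cst0 (tri V i)).
  by apply: eq_I2 => z _; rewrite mul0r.
have f0 : f_h V f (w0, w0) = 0.
  rewrite /f_h big1// => i _; rewrite -[RHS](I2_cst0 (tri V i)).
  by apply: eq_I2 => z _; rewrite /= !mulr0 addr0.
have pw00 : pwV (w0, w0) := vh_pw vh_w0.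
have lin0 (g : vfun -> R) : (forall a u v, pwV u -> pwV v ->
    g (comb2 a u v) = a * g u + g v) -> g (w0, w0) = 0.
  move=> gl; have := gl (- 1) _ _ pw00 pw00.
  have -> : comb2 (- 1) (w0, w0) (w0, w0) = (w0, w0).
    rewrite /comb2 /wcomb /w0 /=; do 2!congr pair; do ?[apply/funext => ?]; ring.
  by rewrite mulN1r addNr.
have [x0 adm0 [e0 ep0]] := adm_surj vh_w0 mh_0.
have adm00 : adm 0.
  have := adm_lin (- 1) adm0 adm0; by rewrite scaleN1r addNr.
have lin4' (a x1 x2 x3 y1 y2 y3 : R) :
    (a * x1 + y1) - (a * x2 + y2) + (a * x3 + y3) =
    a * (x1 - x2 + x3) + (y1 - y2 + y3) by ring.
have [||||x ax Hx] := @solve_bilinear R _ adm adm00 adm_lin form (fun y => f_h V f (uc y)).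
- move=> y ay a x x' ax ax'; rewrite /form ucl pcl.
  rewrite (a_h_linl a (uc y) (au _ ax) (au _ ax')) (b_h_linl a (uc y) (ap _ ax) (ap _ ax')).
  by rewrite (b_h_linr a (ap _ ay) (au _ ax) (au _ ax')); exact: lin4'.
- move=> x ax a y y' ay ay'; rewrite /form ucl pcl.
  rewrite (a_h_linr a (uc x) (au _ ay) (au _ ay')) (b_h_linl a (uc x) (ap _ ay) (ap _ ay')).
  by rewrite (b_h_linr a (ap _ ax) (au _ ay) (au _ ay')); exact: lin4'.
- by move=> a y y' ay ay'; rewrite ucl (f_h_lin a Hf (au _ ay) (au _ ay')).
- move=> y [uy py] H.
  (* The kernel is taken in the second argument, where the pressure enters with the opposite sign;
     so minus the pressure of [y] solves the homogeneous problem. *)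
  have [e _] : veq (uc y) (w0, w0) /\ Mh_eq V (pcomb (- 1) (pc y) (fun _ _ => 0)) (fun _ _ => 0).
    apply: homogeneous => //; first by apply: mh_comb => //; exact: mh_0.
      move=> v hv; have [x ax [ev ep]] := adm_surj hv mh_0.
      have := H x ax; rewrite /form (b_h_eqp _ ep) b0 subr0 a_h_sym (a_h_eq _ ev) (b_h_eq _ ev).
      rewrite b_h_linl; [|exact: py.1|exact: mh_0.1]; rewrite b0 mulN1r addr0.
      by move=> /eqP; rewrite addr_eq0 => /eqP.
    move=> q hq; have [x ax [ev ep]] := adm_surj vh_w0 hq.
    have := H x ax; rewrite /form (b_h_eqp _ ep) a_h_sym (a_h_eq _ ev) (b_h_eq _ ev).
    rewrite (lin0 (a_h k V (uc y))); last by move=> *; exact: a_h_linr.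
    rewrite (lin0 (b_h k V (pc y))); last by move=> *; apply: b_h_linr => //; exact: py.1.
    by rewrite addr0 sub0r => /eqP; rewrite oppr_eq0 => /eqP.
  by rewrite (f_h_eq _ e).
exists (uc x), (pc x); split; [exact: ax.1|exact: ax.2|move=> v hv|move=> q hq].
  have [y ay [ev ep]] := adm_surj hv mh_0.
  have := Hx y ay; rewrite /form (b_h_eqp _ ep) b0 addr0.
  by rewrite (a_h_eq _ ev) (b_h_eq _ ev) (f_h_eq _ ev).
have [y ay [ev ep]] := adm_surj vh_w0 hq.
have := Hx y ay; rewrite /form (b_h_eqp _ ep) (a_h_eq _ ev) (b_h_eq _ ev) (f_h_eq _ ev) f0.
rewrite (lin0 (a_h k V (uc x))); last by move=> *; exact: a_h_linr.
rewrite (lin0 (b_h k V (pc x))); last by move=> *; apply: b_h_linr => //; exact: ax.2.1.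
by rewrite subr0 add0r.
Qed.

Lemma unique_solution u p u' p' :
  in_Vh k V O u -> in_Mh k V p -> in_Vh k V O u' -> in_Mh k V p' ->
  (forall v, in_Vh k V O v -> a_h k V u v - b_h k V p v = f_h V f v) ->
  (forall v, in_Vh k V O v -> a_h k V u' v - b_h k V p' v = f_h V f v) ->
  (forall q, in_Mh k V q -> b_h k V q u = 0) ->
  (forall q, in_Mh k V q -> b_h k V q u' = 0) ->
  veq u u' /\ Mh_eq V p p'.
Proof.
move=> hu hp hu' hp' E E' B B'.
have [] := homogeneous (vh_comb (- 1) hu hu') (mh_comb (- 1) hp hp').
- move=> v hv; rewrite a_h_linl; [|exact: vh_pw|exact: vh_pw].
  rewrite b_h_linl; [|exact: hp.1|exact: hp'.1].
  by have := E v hv; have := E' v hv => <- /eqP; rewrite subr_eq => /eqP ->; ring.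
- move=> q hq; rewrite b_h_linr ?B ?B'//; [ring|exact: hq.1|exact: vh_pw|exact: vh_pw].
have sub0 (r s : R) : - 1 * r + s = 0 -> r = s.
  by rewrite mulN1r addrC => /subr0_eq.
move=> [[e1 e2] [e3 e4]] ep; split; last by move=> i x tx; apply: sub0; exact: ep.
by split; split=> [i x tx|i j x ex]; apply: sub0;
  [exact: e1|exact: e2|exact: e3|exact: e4].
Qed.

End Solution.

End GlobalProblem.

Theorem theorem2p1 (R : realType) (k n : nat)
    (V : 'I_n -> 'I_3 -> (R * R)%type) (O : set (R * R)%type) :
  triangulation V ->
  O = interior [set x | exists i, tri V i x] ->
  convex_set2 O ->
  forall f : (R * R)%type -> (R * R)%type, L2vec O f ->
  exists (u : wfun R n * wfun R n) (p : 'I_n -> (R * R)%type -> R),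
    WG_Stokes k V f u p O /\
    (forall u' p', WG_Stokes k V f u' p' O ->
       (wfun_eq V u.1 u'.1 /\ wfun_eq V u.2 u'.2) /\ Mh_eq V p p').
Proof.
move=> HT -> cvx f Hf.
have sw u p : \sum_(i < n) I2 (tri V i) (fun x => wdiv k V u i x * p i x) = b_h k V p u.
  by apply: eq_bigr => i _; apply: eq_I2 => x _; rewrite mulrC.
have [u [p [hu hp E B]]] := exists_solution k HT cvx Hf.
exists u, p; split; first by split=> //; split=> //; split=> // q hq; rewrite sw B.
move=> u' p' [hu' [hp' [E' B']]].
have B2 q : in_Mh k V q -> b_h k V q u' = 0 by move=> hq; rewrite -sw B'.
by have [] := unique_solution HT cvx hu hp hu' hp' E E' B B2.
Qed.
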